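(* In the setting of the context, write $V=V(Y_{t_0},Y_{t_1};\theta)$, $\tilde f_1=\tilde f_1(Y_{t_0},Y_{t_1})$, and $\Lambda(y)=E[VV'\mid Y_{t_0}=y]$. Consider weighting matrices of the form $$W^*(y)=\Lambda(y)^{-1}\Big\{E[\partial_{\theta_2}V\mid Y_{t_0}=y]\,C_1+E[\partial_{\theta_1}V\mid Y_{t_0}=y]\,C_2+E[V\tilde f_1'\mid Y_{t_0}=y]\,C_3\Big\},$$ with constant matrices $C_1$ ($p_2\times p_2$), $C_2$, $C_3$ ($p_1\times p_2$). Define $$Q_1=E\big[(\partial_{\theta_1}V)'\Lambda(Y_{t_0})^{-1}E[\partial_{\theta_2}V\mid Y_{t_0}]\big],\quad Q_2=E\big[(\partial_{\theta_1}V)'\Lambda(Y_{t_0})^{-1}E[\partial_{\theta_1}V\mid Y_{t_0}]\big],$$ $$Q_3=E\big[(\partial_{\theta_1}V)'\Lambda(Y_{t_0})^{-1}E[V\tilde f_1'\mid Y_{t_0}]\big],\quad Q_4=E\big[\tilde f_1V'\Lambda(Y_{t_0})^{-1}E[\partial_{\theta_2}V\mid Y_{t_0}]\big],$$ $$Q_5=E\big[\tilde f_1V'\Lambda(Y_{t_0})^{-1}E[V\tilde f_1'\mid Y_{t_0}]\big].$$ Then $W^*$ is an optimal weighting matrix when $C_1=I$ and $C_2,C_3$ solve the linear system $$\begin{bmatrix}-Q_2 & D_{1,1}'-Q_3\\ D_{1,1}-Q_3' & nS_{1,1}-Q_5\end{bmatrix}\begin{bmatrix}C_2\\ C_3\end{bmatrix}=\begin{bmatrix}Q_1\\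 Q_4\end{bmatrix}.$$
   Context: Notation: $'$ is transpose; for a vector function $F$ and a parameter vector $\theta$, $\partial_\theta F$ is the matrix with entries $(\partial_\theta F)_{i,j}=\partial_{\theta_j}F_i$; $I$ also denotes the identity matrix. Let $X$ be a diffusion on an interval with endpoints $-\infty\le l<r\le\infty$, with drift $\mu$ and diffusion coefficient $\sigma$ depending on a parameter $\theta_1\in\mathbb R^{p_1}$, satisfying: (1) $X$ is ergodic with stationary density $q(x)=m(x)/\int_l^r m(y)dy$, $m(x)=\sigma^{-2}(x)\exp[\int^x 2\mu(y)/\sigma^2(y)dy]$; (2) its generator $\mathcal G f=\mu f'+\frac12\sigma^2f''$ on $L^2(q)$ has purely discrete spectrum, with eigenvalues $0=\lambda_0>\lambda_1>\cdots$ and eigenfunctions $\varphi_0\equiv1,\varphi_1,\varphi_2,\dots$ orthonormal in $L^2(q)$; (3) $\mu,\sigma$ are twice continuously differentiable and $\sigma>0$. Let $T$ be an independent Lévy subordinator with Laplace exponent $\phi(\cdot;\theta)$, i.e. $E[e^{-\lambda T_t}]=e^{-\phi(\lambda)t}$, whose parameter vector is $\theta_2\in\mathbb R^{p_2}$; $\theta=(\theta_1',\theta_2')'$. Let $Y_t=X_{T_t}$, observed at $t_i=i\Delta$, $i=0,1,\dots,n$. $E$ denotes expectation under $\theta$ with $Y_{t_0}$ distributed according to the stationary density $q$. Let $F_{n,1}(\theta_1)=\sum_{i=1}^nf_1(Y_{t_{i-1}},Y_{t_i};\theta_1)$, where $f_1$ is $\mathbb R^{p_1}$-valued with components chosen from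 moment conditions $E[f_1(Y_{t_0},Y_{t_1};\theta_1)]=0$ of the following two types: $\mu(Y_t)g'(Y_t)+\frac12\sigma^2(Y_t)g''(Y_t)$ with $g$ in the domain of $\mathcal G$; or $\mathcal A\Psi(Y_{t+\Delta},Y_t)-\mathcal A'\Psi(Y_{t+\Delta},Y_t)$, where $\mathcal A\Psi(x,y)$ and $\mathcal A'\Psi(x,y)$ are obtained by applying $\mathcal G$ to $\Psi$ in its first and second variable, respectively, and where $\Psi(x,\cdot),\Psi(\cdot,y)$ are bounded, continuous and in the domain of $\mathcal G$, and $\mathcal A\Psi(\cdot,y)$, $\mathcal A'\Psi(x,\cdot)$ are bounded and continuous. Fix $M\ge1$. Let $V(y_1,y_2;\theta)$ be the $M\times1$ vector with entries $V_m(y_1,y_2;\theta)=\varphi_m(y_2;\theta)-e^{-\phi(-\lambda_m;\theta)\Delta}\varphi_m(y_1;\theta)$, $1\le m\le M$. For an $M\times p_2$ weighting matrix $W(y;\theta)$ let $F_{n,2}(\theta)=\sum_{i=1}^nW'(Y_{t_{i-1}};\theta)V(Y_{t_{i-1}},Y_{t_i};\theta)$. Put $D_{1,1}=E[\partial_{\theta_1}F_{n,1}]$, $D_{2,1}=E[\partial_{\theta_1}F_{n,2}]$, $D_{2,2}=E[\partial_{\theta_2}F_{n,2}]$, $S_{1,1}=E[F_{n,1}F_{n,1}']$, $S_{1,2}=E[F_{n,1}F_{n,2}']$, $S_{2,1}=S_{1,2}'$, $S_{2,2}=E[F_{n,2}F_{n,2}']$. Quantities with a star are those computed with $W^*$ in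 place of $W$. Also $$\tilde f_1(Y_{t_0},Y_{t_1})=E\Big[\sum_{j=1}^n(n-j+1)f_1(Y_{t_{j-1}},Y_{t_j};\theta_1)\,\Big|\,Y_{t_0},Y_{t_1}\Big].$$ $\mathcal W$ is the collection of all weighting matrices $W$ (for which the derivatives $\partial_{\theta_1}F_{n,1}$, $\partial_{\theta_1}F_{n,2}$, $\partial_{\theta_2}F_{n,2}$ and the moments $D_{1,1}$, $D_{2,1}$, $D_{2,2}$, $S_{1,1}$, $S_{1,2}$, $S_{2,1}$, $S_{2,2}$ exist, and $D_{2,2}$ is invertible); it is assumed that $D_{1,1}$ is invertible, that the conditional matrices $\Lambda(y)=E[V(Y_{t_0},Y_{t_1};\theta)V(Y_{t_0},Y_{t_1};\theta)'\mid Y_{t_0}=y]$ are invertible, and that the weighting matrix $W^*$ under consideration belongs to $\mathcal W$ (in particular $D_{2,2}^*$ is invertible). Definition of optimality: $W^*$ is optimal within $\mathcal W$ if for every $W\in\mathcal W$ the matrix $$D_{2,2}^{-1}\begin{bmatrix}-D_{2,1}D_{1,1}^{-1}&I\end{bmatrix}\begin{bmatrix}S_{1,1}&S_{1,2}\\ S_{2,1}&S_{2,2}\end{bmatrix}\begin{bmatrix}-(D_{1,1}')^{-1}D_{2,1}'\\ I\end{bmatrix}(D_{2,2}')^{-1}$$ $$-(D_{2,2}^* )^{-1}\begin{bmatrix}-D_{2,1}^*D_{1,1}^{-1}&I\end{bmatrix}\begin{bmatrix}S_{1,1}&S_{1,2}^*\\ S_{2,1}^*&S_{2,2}^*\end{bmatrix}\begin{bmatrix}-(D_{1,1}')^{-1}(D_{2,1}^*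 )'\\ I\end{bmatrix}({D_{2,2}^*}')^{-1}$$ is positive semi-definite. *)

(* Defs.v *)
From HB Require Import structures.
From mathcomp Require Import all_boot all_order all_algebra.
From mathcomp Require Import all_classical all_reals all_analysis.
Set Implicit Arguments.
Unset Strict Implicit.
Unset Printing Implicit Defensive.
Import Order.TTheory GRing.Theory Num.Theory.
Import numFieldNormedType.Exports.

Local Open Scope classical_set_scope.
Local Open Scope ring_scope.

(* ---- Matrices: derivatives in a parameter, expectations, conditioning ---- *)

(* The matrix of partial derivatives (d_theta F)_{i,j} = d_{theta_j} F_i. *)
Definition dtheta (R : realType) (k p : nat) (F : 'cV[R]_p -> 'cV[R]_k)
    (theta : 'cV[R]_p) : 'M[R]_(k, p) :=
  \matrix_(i, j) 'D_(delta_mx j 0 : 'cV[R]_p) (fun t => F t i 0) theta.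

Definition dtheta_exists (R : realType) (k p : nat) (F : 'cV[R]_p -> 'cV[R]_k)
    (theta : 'cV[R]_p) : Prop :=
  forall i j, derivable (fun t => F t i 0) theta (delta_mx j 0 : 'cV[R]_p).

Definition psd (R : realType) (k : nat) (A : 'M[R]_k) : Prop :=
  A^T = A /\ forall x : 'cV[R]_k, 0 <= (x^T *m A *m x) 0 0.

Definition mx_integrable (R : realType) (d : measure_display)
    (T : measurableType d) (P : probability T R) (a b : nat)
    (Z : T -> 'M[R]_(a, b)) : Prop :=
  forall i j, P.-integrable setT (fun w => (Z w i j)%:E).

Definition Emx (R : realType) (d : measure_display) (T : measurableType d)
    (P : probability T R) (a b : nat) (Z : T -> 'M[R]_(a, b)) :
    'M[R]_(a, b) :=
  \matrix_(i, j) \int[P]_w Z w i j.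

(* [g] is a version of y |-> E[Z | xi = y]. *)
Definition cond_expectation (R : realType) (d d' : measure_display)
    (T : measurableType d) (U : measurableType d') (P : probability T R)
    (xi : T -> U) (a b : nat) (Z : T -> 'M[R]_(a, b))
    (g : U -> 'M[R]_(a, b)) : Prop :=
  [/\ mx_integrable P Z,
      forall i j, measurable_fun setT (fun u => g u i j),
      mx_integrable P (fun w => g (xi w)) &
      forall (A : set U), measurable A -> forall i j,
        \int[P]_(w in xi @^-1` A) Z w i j
        = \int[P]_(w in xi @^-1` A) g (xi w) i j].

(* ---- The model: data ---- *)

(* [X] and [T] are indexed by R, but only times t >= 0 are ever constrained.
   As in a canonical construction, the processes are fixed and the
   parameters enter through the probability measure.
   [trans theta1 (t, x) B] is P(X_{s+t} \in B | X_s = x). *)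
Record model (R : realType) (p1 p2 : nat) (d : measure_display)
    (Omega : measurableType d) := Model {
  lend : \bar R;
  rend : \bar R;
  state : set R;
  basept : R;
  Theta1 : set 'cV[R]_p1;
  Theta2 : set 'cV[R]_p2;
  drift : 'cV[R]_p1 -> R -> R;
  vol : 'cV[R]_p1 -> R -> R;
  trans : 'cV[R]_p1 -> R.-pker (measurableTypeR R * measurableTypeR R)%type
                               ~> (measurableTypeR R);
  eigval : 'cV[R]_p1 -> nat -> R;
  eigfun : 'cV[R]_p1 -> nat -> R -> R;
  laplace : 'cV[R]_p2 -> R -> R;
  prob : 'cV[R]_p1 -> 'cV[R]_p2 -> probability Omega R;
  X : R -> Omega -> R;
  T : R -> Omega -> R }.

Section Model.
Context (R : realType) (p1 p2 : nat) (d : measure_display)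
        (Omega : measurableType d).
Variable S : model R p1 p2 Omega.

Let mu := @lebesgue_measure R.

Definition inner : set R := [set x | (lend S < x%:E < rend S)%E].

(* ---- Stationary density ---- *)

Definition oriented_integral (a b : R) (f : R -> R) : R :=
  if a <= b then \int[mu]_(y in `[a, b]) f y else - \int[mu]_(y in `[b, a]) f y.

Definition speed th1 (x : R) : R :=
  (vol S th1 x ^+ 2)^-1 *
  expR (oriented_integral (basept S) x
          (fun y => 2 * drift S th1 y / vol S th1 y ^+ 2)).

Definition statdens th1 (x : R) : R :=
  speed th1 x / \int[mu]_(y in inner) speed th1 y.

Definition L2norm2 th1 (f : R -> R) : \bar R :=
  (\int[mu]_(x in inner) (f x ^+ 2 * statdens th1 x)%:E)%E.

Definition inL2 th1 (f : R -> R) : Prop :=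
  measurable_fun (state S) f /\ (L2norm2 th1 f < +oo)%E.

Definition inner_prod th1 (f g : R -> R) : R :=
  \int[mu]_(x in inner) (f x * g x * statdens th1 x).

(* ---- Generator ---- *)

Definition semigroup th1 (t : R) (f : R -> R) (x : R) : R :=
  \int[trans S th1 (t, x)]_(z in state S) f z.

(* The graph of the generator on L^2(q): f is in the domain and G f = h. *)
Definition generator th1 (f h : R -> R) : Prop :=
  [/\ inL2 th1 f, inL2 th1 h &
      L2norm2 th1 (fun x => t^-1 * (semigroup th1 t f x - f x) - h x)
        @[t --> 0^'+] --> 0%E].

Definition diffop th1 (f : R -> R) (x : R) : R :=
  drift S th1 x * derive1 f x + 2^-1 * vol S th1 x ^+ 2 * derive1n 2 f x.

Definition twice_derivable (f : R -> R) : Prop :=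
  forall x, inner x -> derivable f x 1 /\ derivable (derive1 f) x 1.

Definition C2 (f : R -> R) : Prop :=
  twice_derivable f /\ forall x, inner x -> {for x, continuous (derive1n 2 f)}.

Definition compact_support (f : R -> R) : Prop :=
  exists a b, [/\ inner a, inner b & forall x, x \notin `[a, b] -> f x = 0].

(* Real spectral values only: L^2(q) is taken over R. *)
Definition in_resolvent th1 (a : R) : Prop :=
  exists C : R, forall h, inL2 th1 h ->
    (exists f, generator th1 f (fun x => a * f x - h x)) /\
    (forall f, generator th1 f (fun x => a * f x - h x) ->
       (L2norm2 th1 f <= C%:E * L2norm2 th1 h)%E).

Definition spectrum th1 : set R := [set a | ~ in_resolvent th1 a].

(* Since the eigenvalues are strictly decreasing, every point of
   [range (eigval S th1)] is isolated in it; [pds_simple] makes the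
   eigenspaces one-dimensional. *)
Record purely_discrete_spectrum th1 : Prop := {
  pds_spectrum : spectrum th1 = range (eigval S th1);
  pds_eigval0 : eigval S th1 0%N = 0;
  pds_decr : forall m, eigval S th1 m.+1 < eigval S th1 m;
  pds_eigfun0 : forall x, state S x -> eigfun S th1 0%N x = 1;
  pds_eigen : forall m, generator th1 (eigfun S th1 m)
                (fun x => eigval S th1 m * eigfun S th1 m x);
  pds_simple : forall m f, generator th1 f (fun x => eigval S th1 m * f x) ->
    exists c, L2norm2 th1 (fun x => f x - c * eigfun S th1 m x) = 0%E;
  pds_orthonormal : forall m k,
    inner_prod th1 (eigfun S th1 m) (eigfun S th1 k) = (m == k)%:R }.

(* ---- Processes ---- *)

(* The sigma-algebra generated by the Z_u, u \in J. *)
Definition events (Z : R -> Omega -> R) (J : set R) : set (set Omega) :=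
  <<s [set A | exists u B, [/\ J u, measurable B & A = Z u @^-1` B]] >>.

Record transition_function th1 : Prop := {
  tf_state : forall t x, 0 <= t -> state S x ->
    trans S th1 (t, x) (state S) = 1%E;
  tf_init : forall x (B : set R), state S x -> measurable B ->
    trans S th1 (0, x) B = \d_x B;
  tf_chapman_kolmogorov : forall s t x (B : set R),
    0 <= s -> 0 <= t -> state S x -> measurable B ->
    trans S th1 (s + t, x) B
    = (\int[trans S th1 (s, x)]_(z in state S) trans S th1 (t, z) B)%E }.

(* Continuous Markov process in an interval whose generator is
   G f = mu f' + sigma^2 f'' / 2, started from the stationary law. *)
Record diffusion th1 th2 : Prop := {
  df_state : forall t w, 0 <= t -> state S (X S t w);
  df_meas : forall t, 0 <= t -> measurable_fun setT (X S t);
  df_cont : forall w, {within `[0, +oo[, continuous (fun t => X S t w)};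
  df_C2 : C2 (drift S th1) /\ C2 (vol S th1);
  df_pos : forall x, inner x -> 0 < vol S th1 x;
  df_trans : transition_function th1;
  df_markov : forall s t A (B : set R), 0 <= s -> 0 <= t ->
    events (X S) `[0, s] A -> measurable B ->
    prob S th1 th2 (A `&` X S (s + t) @^-1` B)
    = (\int[prob S th1 th2]_(w in A) trans S th1 (t, X S s w) B)%E;
  df_generator_test : forall f, C2 f -> compact_support f ->
    generator th1 f (diffop th1 f);
  df_generator : forall f h, C2 f -> generator th1 f h ->
    L2norm2 th1 (fun x => h x - diffop th1 f x) = 0%E;
  df_speed : (\int[mu]_(x in inner) (speed th1 x)%:E < +oo)%E;
  df_stationary : forall t (B : set R), 0 <= t -> measurable B ->
    (\int[mu]_(x in inner) (trans S th1 (t, x) B * (statdens th1 x)%:E))%E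
    = (\int[mu]_(x in inner `&` B) (statdens th1 x)%:E)%E;
  df_initial : forall B : set R, measurable B ->
    prob S th1 th2 (X S 0 @^-1` B)
    = (\int[mu]_(x in inner `&` B) (statdens th1 x)%:E)%E;
  df_ergodic : forall f : R -> R, measurable_fun (state S) f ->
    (\int[mu]_(x in inner) (`|f x| * statdens th1 x)%:E < +oo)%E ->
    \forall w \ae prob S th1 th2,
      t^-1 * \int[mu]_(s in `[0, t]) f (X S s w) @[t --> +oo]
        --> \int[mu]_(x in inner) (f x * statdens th1 x) }.

Definition increment (s t : R) (w : Omega) : R := T S (s + t) w - T S s w.

(* T_t has left limits automatically, being nondecreasing in t. *)
Record levy_subordinator th1 th2 : Prop := {
  ls_meas : forall t, 0 <= t -> measurable_fun setT (T S t);
  ls_zero : forall w, T S 0 w = 0;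
  ls_nondecreasing : forall w s t, 0 <= s -> s <= t -> T S s w <= T S t w;
  ls_rcont : forall w t, 0 <= t -> T S s w @[s --> t^'+] --> T S t w;
  ls_indep : forall s t A (B : set R), 0 <= s -> 0 <= t ->
    events (T S) `[0, s] A -> measurable B ->
    prob S th1 th2 (A `&` [set w | B (increment s t w)])
    = (prob S th1 th2 A
       * prob S th1 th2 [set w | B (increment s t w)])%E;
  ls_stationary : forall s t (B : set R), 0 <= s -> 0 <= t -> measurable B ->
    prob S th1 th2 [set w | B (increment s t w)]
    = prob S th1 th2 (T S t @^-1` B);
  ls_laplace : forall t lambda, 0 <= t -> 0 <= lambda ->
    'E_(prob S th1 th2)[(fun w => expR (- lambda * T S t w))%R]%E
    = (expR (- laplace S th2 lambda * t))%:E }.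

Record subordinate_diffusion : Prop := {
  sd_ends : (lend S < rend S)%E;
  sd_state : inner `<=` state S /\
    state S `<=` [set x | (lend S <= x%:E <= rend S)%E];
  sd_basept : inner (basept S);
  sd_open : open (Theta1 S) /\ open (Theta2 S);
  sd_diffusion : forall th1 th2, Theta1 S th1 -> Theta2 S th2 ->
    diffusion th1 th2;
  sd_spectrum : forall th1, Theta1 S th1 -> purely_discrete_spectrum th1;
  sd_subordinator : forall th1 th2, Theta1 S th1 -> Theta2 S th2 ->
    levy_subordinator th1 th2;
  sd_indep : forall th1 th2, Theta1 S th1 -> Theta2 S th2 ->
    forall A B, events (X S) `[0, +oo[ A -> events (T S) `[0, +oo[ B ->
    prob S th1 th2 (A `&` B) = (prob S th1 th2 A * prob S th1 th2 B)%E }.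

Variable Delta : R.

(* The observation Y_{t_i} = X_{T_{i Delta}}. *)
Definition Y (i : nat) (w : Omega) : R := X S (T S (i%:R * Delta) w) w.

(* ---- Hansen-Scheinkman moment functions ---- *)

Definition moment_type1 (f : R -> R -> 'cV[R]_p1 -> R) : Prop :=
  exists g : 'cV[R]_p1 -> R -> R,
    (forall th1, Theta1 S th1 ->
       twice_derivable (g th1) /\ generator th1 (g th1) (diffop th1 (g th1))) /\
    ((forall th1 y1 y2, Theta1 S th1 -> inner y1 -> inner y2 ->
        f y1 y2 th1 = diffop th1 (g th1) y1) \/
     (forall th1 y1 y2, Theta1 S th1 -> inner y1 -> inner y2 ->
        f y1 y2 th1 = diffop th1 (g th1) y2)).

Definition bounded_continuous (f : R -> R) : Prop :=
  {within state S, continuous f} /\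
  exists K, forall x, state S x -> `|f x| <= K.

(* [AP] is A Psi (generator in the first variable), [AP'] is A' Psi
   (generator in the second variable). *)
Definition moment_type2 (f : R -> R -> 'cV[R]_p1 -> R) : Prop :=
  exists Psi AP AP' : 'cV[R]_p1 -> R -> R -> R,
    (forall th1, Theta1 S th1 ->
       (forall y, state S y ->
          [/\ bounded_continuous (Psi th1 ^~ y),
              bounded_continuous (AP th1 ^~ y) &
              generator th1 (Psi th1 ^~ y) (AP th1 ^~ y)]) /\
       (forall x, state S x ->
          [/\ bounded_continuous (Psi th1 x),
              bounded_continuous (AP' th1 x) &
              generator th1 (Psi th1 x) (AP' th1 x)])) /\
    (forall th1 y1 y2, Theta1 S th1 -> inner y1 -> inner y2 ->
       f y1 y2 th1 = AP th1 y2 y1 - AP' th1 y2 y1).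

Record moment_function (f1 : R -> R -> 'cV[R]_p1 -> 'cV[R]_p1) : Prop := {
  mf_meas : forall th1 k, Theta1 S th1 ->
    measurable_fun (state S `*` state S)
      (fun z : measurableTypeR R * measurableTypeR R => f1 z.1 z.2 th1 k 0);
  mf_type : forall k,
    moment_type1 (fun y1 y2 th1 => f1 y1 y2 th1 k 0) \/
    moment_type2 (fun y1 y2 th1 => f1 y1 y2 th1 k 0);
  mf_integrable : forall th1 th2, Theta1 S th1 -> Theta2 S th2 ->
    mx_integrable (prob S th1 th2) (fun w => f1 (Y 0 w) (Y 1 w) th1);
  mf_zero : forall th1 th2, Theta1 S th1 -> Theta2 S th2 ->
    Emx (prob S th1 th2) (fun w => f1 (Y 0 w) (Y 1 w) th1) = 0 }.

(* ---- Estimating functions ---- *)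

Variables (M n : nat) (f1 : R -> R -> 'cV[R]_p1 -> 'cV[R]_p1).

(* Row m : 'I_M is the entry V_{m+1}. *)
Definition V (y1 y2 : R) th1 th2 : 'cV[R]_M :=
  \col_(m < M) (eigfun S th1 m.+1 y2
    - expR (- laplace S th2 (- eigval S th1 m.+1) * Delta)
      * eigfun S th1 m.+1 y1).

Definition dV1 (y1 y2 : R) th1 th2 : 'M[R]_(M, p1) :=
  dtheta (fun t => V y1 y2 t th2) th1.

Definition dV2 (y1 y2 : R) th1 th2 : 'M[R]_(M, p2) :=
  dtheta (fun t => V y1 y2 th1 t) th2.

Definition weight := R -> 'cV[R]_p1 -> 'cV[R]_p2 -> 'M[R]_(M, p2).

Definition WV (W : weight) (y1 y2 : R) th1 th2 : 'cV[R]_p2 :=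
  (W y1 th1 th2)^T *m V y1 y2 th1 th2.

(* The estimating functions, as functions of the data y 0, ..., y n. *)
Definition F1 (y : nat -> R) th1 : 'cV[R]_p1 :=
  \sum_(i < n) f1 (y i) (y i.+1) th1.

Definition F2 (W : weight) (y : nat -> R) th1 th2 : 'cV[R]_p2 :=
  \sum_(i < n) WV W (y i) (y i.+1) th1 th2.

Definition Yobs (w : Omega) : nat -> R := fun i => Y i w.

Section AtTheta.
Variables (th1 : 'cV[R]_p1) (th2 : 'cV[R]_p2).
Let P := prob S th1 th2.

Definition dF11 (w : Omega) := dtheta (F1 (Yobs w)) th1.
Definition dF21 (W : weight) (w : Omega) :=
  dtheta (fun t => F2 W (Yobs w) t th2) th1.
Definition dF22 (W : weight) (w : Omega) :=
  dtheta (fun t => F2 W (Yobs w) th1 t) th2.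
Definition F1obs (w : Omega) := F1 (Yobs w) th1.
Definition F2obs (W : weight) (w : Omega) := F2 W (Yobs w) th1 th2.

Definition D11 : 'M[R]_p1 := Emx P dF11.
Definition D21 (W : weight) : 'M[R]_(p2, p1) := Emx P (dF21 W).
Definition D22 (W : weight) : 'M[R]_p2 := Emx P (dF22 W).
Definition S11 : 'M[R]_p1 := Emx P (fun w => F1obs w *m (F1obs w)^T).
Definition S12 (W : weight) : 'M[R]_(p1, p2) :=
  Emx P (fun w => F1obs w *m (F2obs W w)^T).
Definition S21 (W : weight) : 'M[R]_(p2, p1) := (S12 W)^T.
Definition S22 (W : weight) : 'M[R]_p2 :=
  Emx P (fun w => F2obs W w *m (F2obs W w)^T).

(* The class of weighting matrices. The moments of the derivatives of
   F_{n,2} are required to exist term by term ([cw_WV1], [cw_WV2]), which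
   excludes sums that are integrable only by cancellation between
   nonintegrable terms. *)
Record calW (W : weight) : Prop := {
  cw_meas : forall t1 t2 i j, Theta1 S t1 -> Theta2 S t2 ->
    measurable_fun (state S) (fun y => W y t1 t2 i j);
  cw_dF11 : forall y, (forall i, inner (y i)) -> dtheta_exists (F1 y) th1;
  cw_dF21 : forall y, (forall i, inner (y i)) ->
    dtheta_exists (fun t => F2 W y t th2) th1;
  cw_dF22 : forall y, (forall i, inner (y i)) ->
    dtheta_exists (fun t => F2 W y th1 t) th2;
  cw_D11 : mx_integrable P dF11;
  cw_D21 : mx_integrable P (dF21 W);
  cw_D22 : mx_integrable P (dF22 W);
  cw_WV1 : forall i, (i < n)%N -> mx_integrable P
    (fun w => dtheta (fun t => WV W (Y i w) (Y i.+1 w) t th2) th1);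
  cw_WV2 : forall i, (i < n)%N -> mx_integrable P
    (fun w => dtheta (fun t => WV W (Y i w) (Y i.+1 w) th1 t) th2);
  cw_S11 : mx_integrable P (fun w => F1obs w *m (F1obs w)^T);
  cw_S12 : mx_integrable P (fun w => F1obs w *m (F2obs W w)^T);
  cw_S22 : mx_integrable P (fun w => F2obs W w *m (F2obs W w)^T);
  cw_unit : D22 W \in unitmx }.

Definition avar (W : weight) : 'M[R]_p2 :=
  invmx (D22 W)
  *m row_mx (- (D21 W *m invmx D11)) 1%:M
  *m block_mx S11 (S12 W) (S21 W) (S22 W)
  *m col_mx (- (invmx D11^T *m (D21 W)^T)) 1%:M
  *m invmx (D22 W)^T.

Definition optimal (Wstar : weight) : Prop :=
  forall W : weight, calW W -> psd (avar W - avar Wstar).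

(* The random vector whose conditional expectation given (Y_{t_0}, Y_{t_1})
   is \tilde f_1; the index j runs from 0, so n - j + 1 becomes n - j. *)
Definition f1_sum (w : Omega) : 'cV[R]_p1 :=
  \sum_(j < n) (n - j)%:R *: f1 (Y j w) (Y j.+1 w) th1.

End AtTheta.
End Model.

Arguments V {R p1 p2 d Omega} S Delta M y1 y2 th1 th2.
Arguments dV1 {R p1 p2 d Omega} S Delta M y1 y2 th1 th2.
Arguments dV2 {R p1 p2 d Omega} S Delta M y1 y2 th1 th2.

(* Main.v *)
Require Import Defs.
From HB Require Import structures.
From mathcomp Require Import all_boot all_order all_algebra.
From mathcomp Require Import all_classical all_reals all_analysis.
From mathcomp Require Import measurable_realfun ring lra.
Set Implicit Arguments.
Unset Strict Implicit.
Unset Printing Implicit Defensive.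
Import Order.TTheory GRing.Theory Num.Theory.
Import numFieldNormedType.Exports.
Local Open Scope classical_set_scope.
Local Open Scope ring_scope.

(** For a weighting matrix W put G = F2 - D21 D11^-1 F1.  The matrix attached
    to W in the definition of optimality is the second moment E[Z Z'] of
    Z = D22^-1 G.  Suppose that E[G G*'] = D22 for every W, where the star refers
    to the weighting matrix W*.  Then E[Z Z*'] = (D22*')^-1 is the same for all
    W, also for W*, and the difference of the two second moments is
    E[(Z - Z* )(Z - Z* )'], which is positive semi-definite ([psd_EmxB]).

    The supposition is verified with four formulas, in which W and all
    conditional means are taken at Y_0:

      D21 = n E[W' E[dV/dtheta1 | Y_0]],    D22 = n E[W' E[dV/dtheta2 | Y_0]],
      S12' = E[W' E[V f~1' | Y_0]],         E[F2 F2*'] = n E[W' Lambda W*].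

    By the form of W* the last one equals D22 + D21 C2 + n S12' C3, and the
    linear system for C2 and C3 says that D21*' = n D11' C3 and
    S12* = D11 C2 + n S11 C3 ([normal_equations]).  With these values all terms
    of E[G G*'] except D22 cancel ([cross_covariance]).

    The four formulas rest on the following facts.

    The observed process Y is a stationary Markov chain, and the eigenfunctions
    of the diffusion are eigenfunctions of its transition operator, so that
    E[V | Y_0] = 0 and the terms of F2 are martingale differences ([Y_markov],
    [Y_stationary], [Y_eigfun]).  For the diffusion itself the generator
    equation gives, by way of Euler's scheme for u' = lambda u, that
    E[phi (X_t); X_0 in B] is an exponential function of t
    ([eigfun_martingale]).

    Functions of Y_0 may be taken out of a conditional mean given Y_0 if the
    whole expression is integrable, whether or not its terms are
    ([cexp_pullout]), and the terms of a square integrable sum of martingale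
    differences are square integrable ([wterm_L2]).  Hence no moments of W need
    be assumed beyond those that enter the definitions ([E_wsum_wsum]).

    The vectors V (a, b) with b in the interior of the state space span R^M,
    because 1, phi_1, ..., phi_M are orthonormal ([V_spanning]).  So W can be
    recovered from the values of W'V and is differentiable in the parameters
    ([derivable_weight]).  By the product rule, and because E[V | Y_0] = 0, the
    derivative of W does not contribute to D21 and D22 ([E_derive_wsum]).

    In E[F1 F2'] the i-th term of F2 may be multiplied by
    E[F1 | Y_{i-1}, Y_i] instead of F1.  Carried over to the pair (Y_0, Y_1) and
    summed over i, these conditional means give f~1 up to a function of Y_0,
    which E[V | Y_0] = 0 eliminates ([E_fsum_wsum]). *)

(** [L1 P Z]: the real random variable Z is integrable. *)
Local Notation L1 P Z := (P.-integrable setT (EFin \o Z)).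

(** * Integrable random variables *)

Section Expectation.
Context (R : realType) (d : measure_display) (T : measurableType d)
        (P : probability T R).
Implicit Types Z W : T -> R.

Lemma L1_meas Z : L1 P Z -> measurable_fun setT Z.
Proof. by move=> h; apply/measurable_EFinP; exact: (measurable_int P). Qed.

Lemma L1_le Z W : measurable_fun setT Z -> (forall w, `|Z w| <= W w) ->
  L1 P W -> L1 P Z.
Proof.
move=> mZ h; apply: le_integrable => //; first exact/measurable_EFinP.
by move=> w _ /=; rewrite lee_fin (le_trans (h w))// ler_norm.
Qed.

Lemma L1_norm Z : L1 P Z -> L1 P (fun w => `|Z w|).
Proof. by move=> h; exact: integrable_norm. Qed.

Lemma eq_L1 Z W : (forall w, Z w = W w) -> L1 P Z -> L1 P W.
Proof. by move=> /funext ->. Qed.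

Lemma L1_cst (c : R) : L1 P (fun=> c).
Proof. exact: finite_measure_integrable_cst. Qed.

Lemma L1D Z W : L1 P Z -> L1 P W -> L1 P (fun w => Z w + W w).
Proof.
move=> hZ hW; have := integrableD measurableT hZ hW.
by apply: eq_integrable.
Qed.

Lemma L1Z (c : R) Z : L1 P Z -> L1 P (fun w => c * Z w).
Proof.
move=> hZ; have := integrableZl measurableT c hZ.
by apply: eq_integrable.
Qed.

Lemma L1N Z : L1 P Z -> L1 P (fun w => - Z w).
Proof. by move=> /(L1Z (-1)); apply: eq_L1 => w; rewrite mulN1r. Qed.

Lemma L1B Z W : L1 P Z -> L1 P W -> L1 P (fun w => Z w - W w).
Proof. by move=> hZ /L1N; exact: L1D. Qed.

Lemma L1_sum (I : Type) (s : seq I) (Q : pred I) (Z : I -> T -> R) :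
  (forall i, Q i -> L1 P (Z i)) -> L1 P (fun w => \sum_(i <- s | Q i) Z i w).
Proof.
move=> h; elim: s => [|i s ih].
  by apply: (eq_L1 (Z := fun=> 0)) (L1_cst 0) => w; rewrite big_nil.
have [Qi|Qi] := boolP (Q i); last first.
  by apply: eq_L1 ih => w; rewrite big_cons (negbTE Qi).
by apply: eq_L1 (L1D (h i Qi) ih) => w; rewrite big_cons Qi.
Qed.

Lemma L1_bdd (a Z : T -> R) (K : R) : measurable_fun setT a ->
  (forall w, `|a w| <= K) -> L1 P Z -> L1 P (fun w => a w * Z w).
Proof.
move=> ma aK hZ; apply: (@L1_le _ (fun w => K * `|Z w|)).
- by apply: measurable_funM => //; exact: L1_meas.
- by move=> w; rewrite normrM ler_wpM2r.
- by apply: L1Z; exact: L1_norm.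
Qed.

Lemma ED Z W : L1 P Z -> L1 P W ->
  \int[P]_w (Z w + W w) = \int[P]_w Z w + \int[P]_w W w.
Proof. by move=> ? ?; rewrite RintegralD. Qed.

Lemma EB Z W : L1 P Z -> L1 P W ->
  \int[P]_w (Z w - W w) = \int[P]_w Z w - \int[P]_w W w.
Proof. by move=> ? ?; rewrite RintegralB. Qed.

Lemma EZ c Z : L1 P Z -> \int[P]_w (c * Z w) = c * \int[P]_w Z w.
Proof. by move=> ?; rewrite RintegralZl. Qed.

Lemma eq_E Z W : (forall w, Z w = W w) -> \int[P]_w Z w = \int[P]_w W w.
Proof. by move=> h; apply: eq_Rintegral => w _. Qed.

Lemma E_cst (c : R) : \int[P]_w c = c.
Proof. by rewrite Rintegral_cst//; have /= -> := @probability_setT _ _ _ P; rewrite mulr1. Qed.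

Lemma E_sum (I : Type) (s : seq I) (Q : pred I) (Z : I -> T -> R) :
  (forall i, Q i -> L1 P (Z i)) ->
  \int[P]_w (\sum_(i <- s | Q i) Z i w) = \sum_(i <- s | Q i) \int[P]_w Z i w.
Proof.
move=> h; elim: s => [|i s ih].
  under eq_E do rewrite big_nil.
  by rewrite big_nil E_cst.
under eq_E do rewrite big_cons.
rewrite big_cons; case: ifPn => [Qi|_]; last exact: ih.
by rewrite ED ?ih//; [exact: h|exact: L1_sum].
Qed.

Lemma E_le Z W : L1 P Z -> L1 P W -> (forall w, Z w <= W w) ->
  \int[P]_w Z w <= \int[P]_w W w.
Proof. by move=> ? ? h; apply: le_Rintegral => // w _; exact: h. Qed.

Lemma E_norm Z : L1 P Z -> `|\int[P]_w Z w| <= \int[P]_w `|Z w|.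
Proof. by move=> ?; exact: le_normr_Rintegral. Qed.

Lemma L1_E Z : L1 P Z -> (\int[P]_w (Z w)%:E)%E = (\int[P]_w Z w)%:E.
Proof. by move=> h; rewrite fineK//; exact: integrable_fin_num. Qed.

Lemma E_ae Z W : measurable_fun setT Z -> measurable_fun setT W ->
  {ae P, forall w, Z w = W w} -> \int[P]_w Z w = \int[P]_w W w.
Proof.
move=> mZ mW h; rewrite /Rintegral; congr fine; apply: ae_eq_integral => //.
- exact/measurable_EFinP.
- exact/measurable_EFinP.
- by apply: filterS h => w -> _.
Qed.

Lemma L1_ae Z W : measurable_fun setT W ->
  {ae P, forall w, Z w = W w} -> L1 P Z -> L1 P W.
Proof.
move=> mW h hZ; apply/integrableP; split; first exact/measurable_EFinP.
have /integrableP[mZ] := hZ; congr (_ < _)%E; apply: ge0_ae_eq_integral => //.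
- exact: measurableT_comp.
- by apply: measurableT_comp => //; exact/measurable_EFinP.
- by apply: filterS h => w /= -> _.
Qed.

Lemma L1_ge0 Z : measurable_fun setT Z -> (forall w, 0 <= Z w) ->
  (\int[P]_w (Z w)%:E < +oo)%E -> L1 P Z.
Proof.
move=> mZ Z0 h; apply/integrableP; split; first exact/measurable_EFinP.
by under eq_integral do rewrite gee0_abs ?lee_fin//.
Qed.

(** A nonnegative variable with bounded truncated means is integrable. *)
Lemma L1_truncation (Z : T -> R) (A : nat -> set T) (c : R) :
  measurable_fun setT Z -> (forall w, 0 <= Z w) ->
  (forall k, measurable (A k)) ->
  (forall k, A k `<=` A k.+1) -> {ae P, forall w, exists k, A k w} ->
  (forall k, L1 P (fun w => \1_(A k) w * Z w)) ->
  (forall k, \int[P]_w (\1_(A k) w * Z w) <= c) -> L1 P Z.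
Proof.
move=> mZ Z0 mA AS Acov hL hc.
pose g k w := (\1_(A k) w * Z w)%:E.
have A_homo : {homo A : m n / (m <= n)%N >-> m `<=` n}.
  apply: (@homo_leq _ _ (fun X Y : set T => X `<=` Y)) => // [B|B C D].
    exact: subset_refl.
  exact: subset_trans.
have nd w : nondecreasing_seq (g ^~ w).
  move=> m n mn; rewrite /g lee_fin ler_wpM2r// !indicE.
  case: (boolP (w \in A m)) => // /set_mem Am.
  by rewrite mem_set//; exact: A_homo Am.
have mg k : measurable_fun setT (g k).
  apply/measurable_EFinP; apply: measurable_funM => //.
have gZ : {ae P, forall w, limn (g ^~ w) = (Z w)%:E}.
  apply: filterS Acov => w [k Ak]; apply/cvg_lim => //.
  apply: cvg_near_cst.
  near=> n; rewrite /g indicE mem_set ?mul1r//.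
  by apply: A_homo Ak; near: n; exact: nbhs_infty_ge.
apply: L1_ge0 => //.
have -> : (\int[P]_w (Z w)%:E = \int[P]_w (limn (g ^~ w)))%E.
  apply: ge0_ae_eq_integral => //.
  - exact/measurable_EFinP.
  - apply: (emeasurable_fun_cvg _ _ mg) => // w _.
    exact: ereal_nondecreasing_is_cvgn.
  - by move=> w _; rewrite lee_fin.
  - move=> w _; apply: lime_ge; first exact: ereal_nondecreasing_is_cvgn.
    by apply: nearW => n; rewrite lee_fin mulr_ge0.
  - by apply: filterS gZ => w <- _.
rewrite monotone_convergence//; last first.
- by move=> n w _; rewrite lee_fin mulr_ge0.
apply: (@le_lt_trans _ _ c%:E); last exact: ltry.
apply: lime_le.
  apply: ereal_nondecreasing_is_cvgn => m n mn; apply: ge0_le_integral => //.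
  - by move=> w _; rewrite lee_fin mulr_ge0.
  - by move=> w _; exact: nd.
by apply: nearW => n; rewrite /g (L1_E (hL n)) lee_fin.
Unshelve. all: by end_near. Qed.

(** Truncation along sets that exhaust the space does not change means in the
    limit. *)
Lemma E_truncation (Z : T -> R) (A : nat -> set T) :
  L1 P Z -> (forall k, measurable (A k)) ->
  (forall k, A k `<=` A k.+1) -> {ae P, forall w, exists k, A k w} ->
  (fun k => \int[P]_w (\1_(A k) w * Z w)) @ \oo --> \int[P]_w Z w.
Proof.
move=> hZ mA AS Acov.
have A_homo : {homo A : m n / (m <= n)%N >-> m `<=` n}.
  apply: (@homo_leq _ _ (fun X Y : set T => X `<=` Y)) => // [B|B C D].
    exact: subset_refl.
  exact: subset_trans.
have mZ := L1_meas hZ.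
have hk k : L1 P (fun w => \1_(A k) w * Z w).
  apply: (@L1_bdd _ _ 1) => // w.
  by rewrite ger0_norm// indicE lern1 leq_b1.
have [] := @dominated_convergence _ _ _ P setT measurableT
  (fun k w => (\1_(A k) w * Z w)%:E) (EFin \o Z) (fun w => (`|Z w|)%:E).
- by move=> k; apply/measurable_EFinP; exact: L1_meas (hk k).
- exact/measurable_EFinP.
- apply: filterS Acov => w [k Ak] _.
  apply: cvg_near_cst.
  near=> n; rewrite indicE mem_set ?mul1r//.
  by apply: A_homo Ak; near: n; exact: nbhs_infty_ge.
- exact: L1_norm.
- apply: nearW => w n _; rewrite /= lee_fin normrM ger0_norm//.
  by rewrite ler_piMl// indicE lern1 leq_b1.
move=> _ _; rewrite (L1_E hZ).
under eq_fun do rewrite (L1_E (hk _)).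
by move/fine_cvgP => [_].
Unshelve. all: by end_near. Qed.

Lemma L1_mul Z W : measurable_fun setT Z -> measurable_fun setT W ->
  L1 P (fun w => Z w ^+ 2) -> L1 P (fun w => W w ^+ 2) ->
  L1 P (fun w => Z w * W w).
Proof.
move=> mZ mW LZ LW.
apply: (L1_le (W := fun w => Z w ^+ 2 + W w ^+ 2)); last exact: L1D.
  exact: measurable_funM.
by move=> w; rewrite ler_norml; nra.
Qed.

End Expectation.

(** * Mixtures of measures *)

Section Mixture.
Context (R : realType) (d d' : measure_display) (T : measurableType d)
        (U : measurableType d').
Variables (mu : {measure set T -> \bar R}) (A : set T) (mA : measurable A).
Variable k : T -> {measure set U -> \bar R}.
Hypothesis mk : forall B, measurable B -> measurable_fun A (fun w => k w B).
Variable nu : {measure set U -> \bar R}.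
Hypothesis nuE : forall B, measurable B -> nu B = (\int[mu]_(w in A) k w B)%E.
Variable f : U -> \bar R.
Hypotheses (f0 : forall u, (0 <= f u)%E) (mf : measurable_fun setT f).

Local Open Scope ereal_scope.
Import HBNNSimple.

Let g := nnsfun_approx measurableT mf.

Let g0 n w : A w -> 0 <= \int[k w]_u (g n u)%:E.
Proof. by move=> _; apply: integral_ge0 => u _; rewrite lee_fin. Qed.

Let intg w n : \int[k w]_u (g n u)%:E =
  \sum_(x \in range (g n)) x%:E * k w (g n @^-1` [set x]).
Proof. by rewrite integralT_nnsfun sintegralE. Qed.

Let mg n : measurable_fun A (fun w => \int[k w]_u (g n u)%:E).
Proof.
under eq_fun do rewrite intg.
apply: emeasurable_fsum => // r.
by apply: measurable_funeM; apply: mk; exact: measurable_sfunP.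
Qed.

Let glim w : \int[k w]_u f u = limn (fun n => \int[k w]_u (g n u)%:E).
Proof.
rewrite -monotone_convergence//.
- by apply: eq_integral => u _; apply/esym/cvg_lim => //; exact: cvg_nnsfun_approx.
- by move=> n; exact/measurable_EFinP.
- by move=> n u _; rewrite lee_fin.
- by move=> u _ m n mn; rewrite lee_fin; exact/lefP/nd_nnsfun_approx.
Qed.

Let gnd w : nondecreasing_seq (fun n => \int[k w]_u (g n u)%:E).
Proof.
move=> m n mn; apply: ge0_le_integral => //.
- by move=> u _; rewrite lee_fin.
- exact/measurable_EFinP.
- exact/measurable_EFinP.
- by move=> u _; rewrite lee_fin; exact/lefP/nd_nnsfun_approx.
Qed.

Lemma measurable_mixture : measurable_fun A (fun w => \int[k w]_u f u).
Proof.
under eq_fun do rewrite glim.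
apply: (emeasurable_fun_cvg _ _ mg) => w _.
exact: ereal_nondecreasing_is_cvgn.
Qed.

(** Integrating against a mixture of measures is iterated integration. *)
Lemma ge0_integral_mixture :
  \int[nu]_u f u = \int[mu]_(w in A) \int[k w]_u f u.
Proof.
under [RHS]eq_integral do rewrite glim.
rewrite (monotone_convergence mu mA mg g0 (fun w _ => @gnd w)).
rewrite [LHS](_ : _ = limn (fun n => \int[nu]_u (g n u)%:E)); last first.
  rewrite -monotone_convergence//.
  - by apply: eq_integral => u _; apply/esym/cvg_lim => //; exact: cvg_nnsfun_approx.
  - by move=> n; exact/measurable_EFinP.
  - by move=> n u _; rewrite lee_fin.
  - by move=> u _ m n mn; rewrite lee_fin; exact/lefP/nd_nnsfun_approx.
congr (limn _); apply/funext => n.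
rewrite integralT_nnsfun sintegralE.
under [RHS]eq_integral do rewrite intg.
rewrite ge0_integral_fsum//; last 2 first.
- by move=> r; apply: measurable_funeM; apply: mk; exact: measurable_sfunP.
- move=> r w _; have [r0|r0] := leP 0%R r; first by rewrite mule_ge0.
  by rewrite preimage_nnfun0// measure0 mule0.
apply: eq_fsbigr => r _; rewrite nuE; last exact: measurable_sfunP.
have [r0|r0] := leP 0%R r.
  by rewrite ge0_integralZl//; apply: mk; exact: measurable_sfunP.
rewrite !integral0_eq ?mule0// => w _; by rewrite preimage_nnfun0// measure0 ?mule0.
Qed.

End Mixture.

Section Law.
Context (R : realType) (d d1 d' : measure_display) (T : measurableType d)
        (T1 : measurableType d1) (U : measurableType d').
Variables (mu : {measure set T -> \bar R}) (A : set T) (mA : measurable A).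
Variables (eta : T -> U) (meta : measurable_fun setT eta).
Variables (mu1 : {measure set T1 -> \bar R}) (A1 : set T1) (mA1 : measurable A1).
Variable k : T1 -> {measure set U -> \bar R}.
Hypothesis mk : forall B, measurable B -> measurable_fun A1 (fun w => k w B).
Hypothesis etaE : forall B, measurable B ->
  mu (A `&` eta @^-1` B) = (\int[mu1]_(w in A1) k w B)%E.
Local Open Scope ereal_scope.

Let nu : {measure set U -> \bar R} :=
  measure_function_pushforward__canonical__measure_function_Measure
    (mrestr mu mA) meta.

(** The case in which a random element eta has, on the event A, a mixture of
    the measures k w as its law; the Markov property is of this form. *)
Lemma ge0_integral_law (f : U -> \bar R) :
  (forall u, 0 <= f u) -> measurable_fun setT f ->
  \int[mu]_(w in A) f (eta w) = \int[mu1]_(w in A1) \int[k w]_u f u.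
Proof.
move=> f0 mf.
have dE B : (fun w => \d_(eta w) B) = (fun w => (\1_(eta @^-1` B) w)%:E) :> (_ -> \bar R).
  by apply/funext => w; rewrite /= diracE indicE.
rewrite -(ge0_integral_mixture mA1 mk (nu := nu))//; last first.
  by move=> B mB; rewrite -etaE// /nu /= /pushforward /mrestr setIC.
rewrite (ge0_integral_mixture (mu := mu) (A := A) (k := fun w => \d_(eta w)) mA)//.
- by apply: eq_integral => w _; rewrite integral_dirac// diracT mul1e.
- move=> B mB; apply: measurable_funTS; rewrite dE; apply/measurable_EFinP.
  by apply: measurable_indic; rewrite -[X in measurable X]setTI; exact: meta.
- move=> B mB; rewrite /nu /= /pushforward /mrestr dE integral_indic//.
  by rewrite -[X in measurable X]setTI; exact: meta.
Qed.

End Law.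

(** * Equality in law *)

Lemma E_set (R : realType) (d : measure_display) (T : measurableType d)
    (P : probability T R) (D : set T) (Z : T -> R) :
  \int[P]_(w in D) Z w = \int[P]_w (\1_D w * Z w).
Proof.
rewrite Rintegral_mkcond; apply: eq_E => w; rewrite /patch indicE.
by case: (w \in D); rewrite ?mul1r ?mul0r.
Qed.

Section EqualLaws.
Context (R : realType) (d d1 d' : measure_display) (T : measurableType d)
        (T1 : measurableType d1) (U : measurableType d').
Variables (P : probability T R) (P1 : probability T1 R).
Variables (D : set T) (mD : measurable D) (D1 : set T1) (mD1 : measurable D1).
Variables (xi : T -> U) (mxi : measurable_fun setT xi).
Variables (eta : T1 -> U) (meta : measurable_fun setT eta).
(* On the events D and D1, xi and eta have the same law. *)
Hypothesis law : forall B, measurable B ->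
  P (D `&` xi @^-1` B) = P1 (D1 `&` eta @^-1` B).

Lemma ge0_integral_eqlaw (f : U -> \bar R) :
  (forall u, (0 <= f u)%E) -> measurable_fun setT f ->
  (\int[P]_(w in D) f (xi w) = \int[P1]_(w in D1) f (eta w))%E.
Proof.
move=> f0 mf.
have pre B : measurable B -> measurable (eta @^-1` B).
  by move=> mB; rewrite -[X in measurable X]setTI; exact: meta.
have dE B : (fun w => \d_(eta w) B) = (fun w => (\1_(eta @^-1` B) w)%:E)
   :> (_ -> \bar R).
  by apply/funext => w; rewrite /= diracE indicE.
rewrite (ge0_integral_law mD mxi (mu1 := P1) (A1 := D1)
  (k := fun w => \d_(eta w)) mD1)//.
- by apply: eq_integral => w _; rewrite integral_dirac// diracT mul1e.
- move=> B mB; apply: measurable_funTS; rewrite dE.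
  by apply/measurable_EFinP; apply: measurable_indic; exact: pre.
- move=> B mB; rewrite dE integral_indic//; last exact: pre.
  by rewrite [in RHS]setIC; exact: law.
Qed.

Variable h : U -> R.
Hypothesis mh : measurable_fun setT h.

Let mhx : measurable_fun setT (h \o xi). Proof. exact: measurableT_comp. Qed.
Let mhe : measurable_fun setT (h \o eta). Proof. exact: measurableT_comp. Qed.

Lemma L1_eqlaw :
  L1 P (fun w => \1_D w * h (xi w)) -> L1 P1 (fun w => \1_D1 w * h (eta w)).
Proof.
move=> /integrableP[_ hfin]; apply/integrableP; split.
  by apply/measurable_EFinP; apply: measurable_funM.
have aE d0 (T0 : measurableType d0) (P0 : probability T0 R) (D0 : set T0)
    (Z : T0 -> R) :
  (\int[P0]_w `|(\1_D0 w * Z w)%:E| = \int[P0]_(w in D0) (`|Z w|)%:E)%E.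
  rewrite [RHS]integral_mkcond; apply: eq_integral => w _.
  rewrite /patch indicE; case: (w \in D0); rewrite ?mul1r ?mul0r//.
  by rewrite abse0.
rewrite /= aE in hfin; rewrite /= aE.
rewrite -(ge0_integral_eqlaw (f := fun u => (`|h u|)%:E))//.
by apply/measurable_EFinP; exact: measurableT_comp.
Qed.

Lemma E_eqlaw :
  \int[P]_w (\1_D w * h (xi w)) = \int[P1]_w (\1_D1 w * h (eta w)).
Proof.
rewrite -!E_set /Rintegral; congr fine.
rewrite [LHS]integralE [RHS]integralE; congr (_ - _)%E.
  rewrite unlock.
  apply: (ge0_integral_eqlaw (f := fun u => maxe (h u)%:E 0%E)).
    by move=> u; rewrite le_max lexx orbT.
  by apply: measurable_maxe => //; exact/measurable_EFinP.
rewrite unlock.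
apply: (ge0_integral_eqlaw (f := fun u => maxe (- (h u)%:E)%E 0%E)).
  by move=> u; rewrite le_max lexx orbT.
apply: measurable_maxe => //; apply/measurable_EFinP.
exact: measurable_funN.
Qed.

End EqualLaws.

(** * Conditional expectations *)

Section CondExp.
Context (R : realType) (d d' : measure_display) (T : measurableType d)
        (U : measurableType d') (P : probability T R).
Variables (xi : T -> U) (mxi : measurable_fun setT xi).
Implicit Types (Z : T -> R) (g a : U -> R).

(** [cexp Z g] says that [g] is a version of u |-> E[Z | xi = u], for a real
    random variable [Z]. *)
Record cexp Z g : Prop := {
  ce_L1 : L1 P Z;
  ce_meas : measurable_fun setT g;
  ce_L1g : L1 P (g \o xi);
  ce_eq : forall A, measurable A ->
    \int[P]_w (\1_A (xi w) * Z w) = \int[P]_w (\1_A (xi w) * g (xi w)) }.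

Lemma indic_L1 (A : set U) Z : measurable A -> L1 P Z ->
  L1 P (fun w => \1_A (xi w) * Z w).
Proof.
move=> mA; apply: (@L1_bdd _ _ _ _ _ _ 1).
  exact: measurableT_comp (measurable_indic mA) mxi.
by move=> w; rewrite ger0_norm// indicE lern1 leq_b1.
Qed.

Lemma cexp_E Z g : cexp Z g -> \int[P]_w Z w = \int[P]_w g (xi w).
Proof.
move=> [_ _ _ /(_ setT measurableT)].
by under eq_E do rewrite indicT mul1r; under [in X in _ = X -> _]eq_E do rewrite indicT mul1r.
Qed.

Lemma cexp_D Z g Z' g' : cexp Z g -> cexp Z' g' ->
  cexp (fun w => Z w + Z' w) (fun u => g u + g' u).
Proof.
move=> [a1 b1 c1 d1] [a2 b2 c2 d2]; split.
- exact: L1D.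
- exact: measurable_funD.
- exact: L1D.
- move=> A mA.
  under eq_E do rewrite mulrDr.
  rewrite (ED (indic_L1 mA a1) (indic_L1 mA a2)) d1// d2//.
  rewrite -(ED (indic_L1 mA c1) (indic_L1 mA c2)).
  by apply: eq_E => w; rewrite mulrDr.
Qed.

Lemma cexp_Z (c : R) Z g : cexp Z g -> cexp (fun w => c * Z w) (fun u => c * g u).
Proof.
move=> [a1 b1 c1 d1]; split.
- exact: L1Z.
- exact: measurable_funM.
- exact: (L1Z c c1).
- move=> A mA.
  under eq_E do rewrite mulrCA.
  rewrite (EZ _ (indic_L1 mA a1)) d1// -(EZ _ (indic_L1 mA c1)).
  by apply: eq_E => w; rewrite mulrCA.
Qed.

Lemma cexp_self g : measurable_fun setT g -> L1 P (g \o xi) ->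
  cexp (fun w => g (xi w)) g.
Proof. by move=> mg hg; split. Qed.

Import HBNNSimple.

Let cexp_nnsfun Z g (h : {nnsfun U >-> R}) : cexp Z g ->
  \int[P]_w (h (xi w) * Z w) = \int[P]_w (h (xi w) * g (xi w)).
Proof.
move=> [a1 b1 c1 d1].
have hE Y : L1 P Y -> \int[P]_w (h (xi w) * Y w) =
   \sum_(x <- finmap.enum_fset (fset_set (range h)))
     x * \int[P]_w (\1_(h @^-1` [set x]) (xi w) * Y w).
  move=> LY; transitivity (\int[P]_w (\sum_(x <- finmap.enum_fset (fset_set (range h)))
      x * (\1_(h @^-1` [set x]) (xi w) * Y w))).
    apply: eq_E => w; rewrite (fimfunE h (xi w)) fsbig_finite//= mulr_suml.
    by apply: eq_bigr => x _; rewrite mulrA.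
  rewrite E_sum; last by move=> x _; apply: L1Z; apply: indic_L1.
  by apply: eq_bigr => x _; rewrite EZ//; apply: indic_L1.
rewrite hE// (hE (g \o xi))//; apply: eq_bigr => x _.
by rewrite d1.
Qed.

(** Bounded functions of xi may be taken out: simple ones by linearity, the
    others by dominated convergence. *)
Lemma cexp_bdd Z g a (K : R) : cexp Z g -> measurable_fun setT a ->
  (forall u, `|a u| <= K) ->
  \int[P]_w (a (xi w) * Z w) = \int[P]_w (a (xi w) * g (xi w)).
Proof.
move=> hZ ma aK; have [a1 b1 c1 d1] := hZ.
(* a + K is nonnegative, and therefore a limit of simple functions. *)
pose b u := a u + K.
have b0 u : 0 <= b u by rewrite /b -lerBlDr sub0r; have := aK u; rewrite ler_norml => /andP[].
have mb : measurable_fun setT b by exact: measurable_funD.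
have mbE : measurable_fun setT (EFin \o b) by exact/measurable_EFinP.
pose f := nnsfun_approx measurableT mbE.
have fb n u : f n u <= b u.
  rewrite -lee_fin nnsfun_approxE.
  by apply: (le_approx (f := EFin \o b)) => // v _ /=; rewrite lee_fin.
have bK u : b u <= K + K.
  by rewrite /b lerD2r; have := aK u; rewrite ler_norml => /andP[].
have limb Y : L1 P Y -> (fun n => \int[P]_w (f n (xi w) * Y w)) @ \oo -->
    \int[P]_w (b (xi w) * Y w).
  move=> LY.
  have hk n : L1 P (fun w => f n (xi w) * Y w).
    apply: (@L1_bdd _ _ _ _ _ _ (K + K)) => //.
      exact: measurableT_comp.
    move=> w; rewrite ger0_norm//; apply: le_trans (fb _ _) (bK _).
  have hb : L1 P (fun w => b (xi w) * Y w).
    apply: (@L1_bdd _ _ _ _ _ _ (K + K)) => //.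
      exact: measurableT_comp.
    by move=> w; rewrite ger0_norm.
  have [] := @dominated_convergence _ _ _ P setT measurableT
    (fun n w => (f n (xi w) * Y w)%:E) (fun w => (b (xi w) * Y w)%:E)
    (fun w => ((K + K) * `|Y w|)%:E).
  - by move=> n; exact: (measurable_int P (hk n)).
  - exact: (measurable_int P hb).
  - apply: nearW => w _; apply: cvg_EFin; first by apply: nearW.
    apply: cvgMr_tmp.
    have := cvg_nnsfun_approx measurableT mbE (fun u _ => b0 u) (x := xi w) Logic.I.
    by move/fine_cvgP => [].
  - by apply: L1Z; exact: L1_norm.
  - apply: nearW => w n _; rewrite /= lee_fin normrM ler_wpM2r// ger0_norm//.
    by apply: le_trans (fb _ _) (bK _).
  move=> _ _; rewrite (L1_E hb).
  under eq_fun do rewrite (L1_E (hk _)).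
  by move/fine_cvgP => [_].
have : \int[P]_w (b (xi w) * Z w) = \int[P]_w (b (xi w) * g (xi w)).
  have Ef : (fun n => \int[P]_w (f n (xi w) * Z w)) =
            (fun n => \int[P]_w (f n (xi w) * g (xi w))).
    by apply/funext => n; exact: cexp_nnsfun.
  have := limb _ a1; rewrite Ef => /cvg_lim <- //.
  by have /cvg_lim -> := limb _ c1.
have La Y : L1 P Y -> L1 P (fun w => a (xi w) * Y w).
  move=> LY; apply: (@L1_bdd _ _ _ _ _ _ K) => //.
  exact: measurableT_comp.
have split Y : L1 P Y -> \int[P]_w (b (xi w) * Y w) =
   \int[P]_w (a (xi w) * Y w) + K * \int[P]_w Y w.
  move=> LY; rewrite -EZ// -ED//; [|exact: La|exact: L1Z].
  by apply: eq_E => w; rewrite mulrDl.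
by rewrite (split _ a1) (split _ c1) (cexp_E hZ) => /addIr.
Qed.

End CondExp.

Section PullOut.
Context (R : realType) (d d' : measure_display) (T : measurableType d)
        (U : measurableType d') (P : probability T R).
Variables (xi : T -> U) (mxi : measurable_fun setT xi).
Local Notation cexp := (cexp P xi).

Lemma preimage_measurable (B : set U) : measurable B -> measurable (xi @^-1` B).
Proof. by move=> mB; rewrite -[X in measurable X]setTI; exact: mxi. Qed.

Lemma measurable_xi (a : U -> R) : measurable_fun setT a ->
  measurable_fun setT (fun w => a (xi w)).
Proof. by move=> ma; exact: measurableT_comp. Qed.

(** The means of |h (xi)| on {h >= 0} and on its complement vanish. *)
Lemma mean0_ae (h : U -> R) : measurable_fun setT h -> L1 P (h \o xi) ->
  (forall A, measurable A -> \int[P]_w (\1_A (xi w) * h (xi w)) = 0) ->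
  {ae P, forall w, h (xi w) = 0}.
Proof.
move=> mh Lh h0.
pose A := [set u | 0 <= h u].
have mA : measurable A.
  rewrite (_ : A = h @^-1` `[0, +oo[); last first.
    by apply/seteqP; split => u /=; rewrite in_itv/= andbT.
  by rewrite -[X in measurable X]setTI; exact: mh.
have Eabs : \int[P]_w `|h (xi w)| = 0.
  have -> : \int[P]_w `|h (xi w)| =
      \int[P]_w (\1_A (xi w) * h (xi w) - \1_(~` A) (xi w) * h (xi w)).
    apply: eq_E => w; rewrite !indicE in_setC.
    case: (boolP (xi w \in A)) => [/set_mem /= h_ge|/negP hA] /=.
      by rewrite mul1r mul0r subr0 ger0_norm.
    rewrite mul0r mul1r sub0r ltr0_norm// ltNge; apply/negP => h_ge.
    by apply: hA; rewrite inE.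
  rewrite EB ?h0 ?subrr//; [exact: measurableC| |].
    exact: (indic_L1 mxi mA Lh).
  exact: (indic_L1 mxi (measurableC mA) Lh).
have : (\int[P]_w `|(h (xi w))%:E| = 0)%E.
  by rewrite (L1_E (L1_norm Lh)) Eabs.
move=> h1; have [+ _] := ae_eq_integral_abs P measurableT
  (measurable_int P Lh : measurable_fun setT (fun w => (h (xi w))%:E)).
by move=> /(_ h1); apply: filterS => w /(_ Logic.I) /= [].
Qed.

Lemma cexp_uniq Z g g' : cexp Z g -> cexp Z g' ->
  {ae P, forall w, g (xi w) = g' (xi w)}.
Proof.
move=> [a1 b1 c1 d1] [a2 b2 c2 d2].
have := @mean0_ae (fun u => g u - g' u).
case=> //.
- exact: measurable_funB.
- exact: (L1B c1 c2).
- move=> A mA; under eq_E do rewrite mulrBr.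
  rewrite (EB (indic_L1 mxi mA c1) (indic_L1 mxi mA c2)) -d1// -d2// subrr//.
move=> N [mN N0 hN]; exists N; split => // w /= hw; apply: hN => /= h.
by apply: hw; apply/eqP; rewrite -subr_eq0 h.
Qed.

(** Coefficients that are functions of xi may be taken out of a conditional
    expectation as soon as the total is integrable: the terms need not be.  One
    works on the sets where all the coefficients are bounded by k, and lets k
    tend to infinity. *)
Lemma cexp_pullout (I : finType) (a : I -> U -> R) (Y : I -> T -> R)
    (y : I -> U -> R) :
  (forall i, measurable_fun setT (a i)) -> (forall i, cexp (Y i) (y i)) ->
  L1 P (fun w => \sum_i a i (xi w) * Y i w) ->
  cexp (fun w => \sum_i a i (xi w) * Y i w) (fun u => \sum_i a i u * y i u).
Proof.
move=> ma hY; set Z := (fun w => _); set G := (fun u => _) => LZ.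
pose b u := \sum_i `|a i u|.
have mb : measurable_fun setT b.
  by apply: measurable_sum => i; exact: measurableT_comp.
pose A k := [set u | b u <= k%:R].
have mA k : measurable (A k).
  rewrite (_ : A k = b @^-1` `]-oo, k%:R]); last first.
    by apply/seteqP; split => u /=; rewrite in_itv/=.
  by rewrite -[X in measurable X]setTI; exact: mb.
have mG : measurable_fun setT G.
  by apply: measurable_sum => i; apply: measurable_funM => //; exact: ce_meas (hY i).
have aA k u i : \1_(A k) u * `|a i u| <= k%:R.
  rewrite indicE; case: (boolP (u \in A k)) => [/set_mem/= bu|_]; last by rewrite mul0r.
  rewrite mul1r (le_trans _ bu)// /b (bigD1 i)//= lerDl.
  by apply: sumr_ge0 => j _.
have cA (c : U -> R) k i u : (forall u, `|c u| <= 1) ->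
    `|\1_(A k) u * c u * a i u| <= k%:R.
  move=> c1; rewrite !normrM ger0_norm// mulrAC.
  apply: le_trans (aA k u i); rewrite ler_piMr// mulr_ge0//.
have mc (c : U -> R) k i : measurable_fun setT c ->
    measurable_fun setT (fun u => \1_(A k) u * c u * a i u).
  by move=> mc; apply: measurable_funM => //; apply: measurable_funM.
have key (c : U -> R) k : measurable_fun setT c -> (forall u, `|c u| <= 1) ->
    L1 P (fun w => \1_(A k) (xi w) * c (xi w) * G (xi w)) /\
    \int[P]_w (\1_(A k) (xi w) * c (xi w) * Z w) =
    \int[P]_w (\1_(A k) (xi w) * c (xi w) * G (xi w)).
  move=> m_c c1.
  have LG i : L1 P (fun w => \1_(A k) (xi w) * c (xi w) * a i (xi w) * y i (xi w)).
    apply: (@L1_bdd _ _ _ _ (fun w => \1_(A k) (xi w) * c (xi w) * a i (xi w)) _ k%:R).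
    - exact: (measurable_xi (mc c k i m_c)).
    - by move=> w; exact: cA.
    - exact: ce_L1g (hY i).
  have LY i : L1 P (fun w => \1_(A k) (xi w) * c (xi w) * a i (xi w) * Y i w).
    apply: (@L1_bdd _ _ _ _ (fun w => \1_(A k) (xi w) * c (xi w) * a i (xi w)) _ k%:R).
    - exact: (measurable_xi (mc c k i m_c)).
    - by move=> w; exact: cA.
    - exact: ce_L1 (hY i).
  split.
    apply: (@eq_L1 _ _ _ _ (fun w => \sum_i
        (\1_(A k) (xi w) * c (xi w) * a i (xi w) * y i (xi w)))).
      by move=> w; rewrite mulr_sumr; apply: eq_bigr => i _; rewrite !mulrA.
    by apply: L1_sum => i _; exact: LG.
  transitivity (\sum_i \int[P]_w (\1_(A k) (xi w) * c (xi w) * a i (xi w) * Y i w)).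
    rewrite -E_sum//; apply: eq_E => w.
    by rewrite mulr_sumr; apply: eq_bigr => i _; rewrite !mulrA.
  transitivity (\sum_i \int[P]_w
      (\1_(A k) (xi w) * c (xi w) * a i (xi w) * y i (xi w))).
    apply: eq_bigr => i _.
    exact: (cexp_bdd mxi (hY i) (mc c k i m_c) (fun u => cA c k i u c1)).
  rewrite -E_sum//; apply: eq_E => w.
  by rewrite mulr_sumr; apply: eq_bigr => i _; rewrite !mulrA.
have mAx k : measurable (xi @^-1` A k) by exact: preimage_measurable.
have Asub k : xi @^-1` A k `<=` xi @^-1` A k.+1.
  by move=> w /= h; rewrite /A/= (le_trans h)// ler_nat.
have Acov : {ae P, forall w, exists k, (xi @^-1` A k) w}.
  apply: nearW => w; exists (Num.truncn (b (xi w))).+1.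
  rewrite /A/=; apply/ltW/truncnS_gt.
have iE k w : \1_(xi @^-1` A k) w = \1_(A k) (xi w) :> R by rewrite !indicE.
pose C := [set u | 0 <= G u].
have mC : measurable C.
  rewrite (_ : C = G @^-1` `[0, +oo[); last first.
    by apply/seteqP; split => u /=; rewrite in_itv/= andbT.
  by rewrite -[X in measurable X]setTI; exact: mG.
(* With the sign sg of G, the truncated means of |G (xi)| are means of Z, and so
   they are bounded by E|Z|. *)
pose sg u : R := \1_C u - \1_(~` C) u.
have msg : measurable_fun setT sg.
  by apply: measurable_funB => //; apply: measurable_indic; exact: measurableC.
have sg1 u : `|sg u| <= 1.
  rewrite /sg !indicE in_setC; case: (u \in C); first by rewrite subr0 normr1.
  by rewrite sub0r normrN1.
have sgE u : sg u * G u = `|G u|.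
  rewrite /sg !indicE in_setC.
  case: (boolP (u \in C)) => [/set_mem /= G0|/negP G0].
    by rewrite subr0 mul1r ger0_norm.
  rewrite sub0r mulN1r ltr0_norm// ltNge; apply/negP => h.
  by apply: G0; rewrite inE.
have LG : L1 P (G \o xi).
  have LnG : L1 P (fun w => `|G (xi w)|).
    apply: (@L1_truncation _ _ _ _ _ _ (\int[P]_w `|Z w|) _ _ mAx Asub Acov) => //.
    + by apply: measurableT_comp => //; exact: measurable_xi.
    + move=> k; have [h _] := key _ k msg sg1; apply: eq_L1 h => w.
      by rewrite -mulrA sgE iE.
    + move=> k; have [_ h] := key _ k msg sg1.
      have -> : \int[P]_w (\1_(xi @^-1` A k) w * `|G (xi w)|) =
          \int[P]_w (\1_(A k) (xi w) * sg (xi w) * G (xi w)).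
        by apply: eq_E => w; rewrite -mulrA sgE iE.
      rewrite -h; apply: E_le; [|exact: L1_norm|].
        apply: (@L1_bdd _ _ _ _ (fun w => \1_(A k) (xi w) * sg (xi w)) _ 1) => //.
          apply: (@measurable_xi (fun u => \1_(A k) u * sg u)).
          by apply: measurable_funM => //; exact: measurable_indic.
        by move=> w; rewrite normrM mulr_ile1// ger0_norm// indicE lern1 leq_b1.
      move=> w; apply: le_trans (ler_norm _) _; rewrite normrM ler_piMl//.
      by rewrite normrM mulr_ile1// ger0_norm// indicE lern1 leq_b1.
  apply: L1_le LnG => //; exact: measurable_xi.
split => // B mB.
have mBi : measurable_fun setT (\1_B : U -> R) by exact: measurable_indic.
have B1 u : `|\1_B u : R| <= 1 by rewrite ger0_norm// indicE lern1 leq_b1.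
have LZB := indic_L1 mxi mB LZ.
have LGB := indic_L1 mxi mB LG.
have Ef : (fun k => \int[P]_w (\1_(xi @^-1` A k) w * (\1_B (xi w) * Z w))) =
          (fun k => \int[P]_w (\1_(xi @^-1` A k) w * (\1_B (xi w) * G (xi w)))).
  apply/funext => k; have [_ h] := key _ k mBi B1.
  transitivity (\int[P]_w (\1_(A k) (xi w) * \1_B (xi w) * Z w)).
    by apply: eq_E => w; rewrite iE mulrA.
  by rewrite h; apply: eq_E => w; rewrite iE mulrA.
have := E_truncation LZB mAx Asub Acov; rewrite Ef => /cvg_lim <- //.
by have /cvg_lim -> := E_truncation LGB mAx Asub Acov.
Qed.

End PullOut.

Lemma E_preimage (R : realType) (d : measure_display) (T : measurableType d)
    (U : Type) (P : probability T R) (xi : T -> U) (A : set U) (Z : T -> R) :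
  \int[P]_(w in xi @^-1` A) Z w = \int[P]_w (\1_A (xi w) * Z w).
Proof. by rewrite E_set; apply: eq_E => w; rewrite !indicE. Qed.

Section CondExpExistence.
Context (R : realType) (d d' : measure_display) (T : measurableType d)
        (U : measurableType d') (P : probability T R).
Variables (xi : T -> U) (mxi : measurable_fun setT xi).
Variables (Z : T -> R) (LZ : L1 P Z).

Let law : {sigma_finite_measure set U -> \bar R} :=
  distribution P (mfun_Sub (mem_set mxi)).
Let nu : {charge set U -> \bar R} :=
  measure_function_pushforward__canonical__charge_Charge
    (induced_charge LZ) mxi.

(** The conditional mean is the density, with respect to the law of xi, of the
    image under xi of the charge with density Z. *)
Lemma cexp_exists : exists g, cexp P xi Z g.
Proof.
have dom : nu `<< law.
  apply: dominates_pushforward => //; apply/null_content_dominatesP => A mA PA.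
  apply: null_set_integral => //.
  exact/measurable_funTS/(measurable_int P LZ).
have intg := Radon_Nikodym_integrable dom.
pose g u := fine (Radon_Nikodym nu law u).
have gE u : (g u)%:E = Radon_Nikodym nu law u.
  by rewrite fineK//; exact: Radon_Nikodym_fin_num.
have gEE : EFin \o g = Radon_Nikodym nu law by apply/funext.
have mg : measurable_fun setT g.
  by apply/measurable_EFinP; rewrite gEE; exact: (measurable_int law intg).
have Lg : L1 P (g \o xi).
  apply/integrableP; split.
    by apply/measurable_EFinP; exact: measurableT_comp.
  have /integrableP[_] := intg; rewrite -gEE ge0_integral_pushforward//.
  by do 2 apply: measurableT_comp => //.
exists g; split => // A mA.
rewrite -!E_preimage /Rintegral; congr fine.
have := Radon_Nikodym_integral dom mA; rewrite -gEE integral_pushforward//.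
- exact/measurable_EFinP.
- apply: (integrableS measurableT) => //.
  exact: (preimage_measurable mxi mA).
Qed.

End CondExpExistence.

Lemma cexp_pullout1 (R : realType) (d d' : measure_display)
    (T : measurableType d) (U : measurableType d') (P : probability T R)
    (xi : T -> U) (a : U -> R) (Z : T -> R) (z : U -> R) :
  measurable_fun setT xi -> measurable_fun setT a -> cexp P xi Z z ->
  L1 P (fun w => a (xi w) * Z w) ->
  cexp P xi (fun w => a (xi w) * Z w) (fun u => a u * z u).
Proof.
move=> mxi ma hZ LaZ.
have := @cexp_pullout _ _ _ _ _ P xi mxi 'I_1 (fun=> a) (fun=> Z) (fun=> z)
  (fun=> ma) (fun=> hZ).
have -> : (fun w => \sum_(i < 1) a (xi w) * Z w) = (fun w => a (xi w) * Z w).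
  by apply/funext => w; rewrite big_ord1.
have -> : (fun u => \sum_(i < 1) a u * z u) = (fun u => a u * z u).
  by apply/funext => u; rewrite big_ord1.
exact.
Qed.

(** * Means under a conditional law *)

Section KernelMean.
Context (R : realType) (d d' : measure_display) (T : measurableType d)
        (U : measurableType d').
Variables (P : probability T R) (A : set T) (mA : measurable A).
Variables (eta : T -> U) (meta : measurable_fun setT eta).
Variable k : T -> {measure set U -> \bar R}.
Hypothesis mk : forall B, measurable B -> measurable_fun setT (fun w => k w B).
(* On A, the conditional law of eta is k. *)
Hypothesis etaE : forall B, measurable B ->
  P (A `&` eta @^-1` B) = (\int[P]_(w in A) k w B)%E.
Variables (h : U -> R) (mh : measurable_fun setT h) (Lh : L1 P (h \o eta)).

Let mkA B : measurable B -> measurable_fun A (fun w => k w B).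
Proof. by move=> mB; apply: measurable_funTS; exact: mk. Qed.

Let Kp w := (\int[k w]_u (EFin \o h)^\+%E u)%E.
Let Kn w := (\int[k w]_u (EFin \o h)^\-%E u)%E.
Let mhE : measurable_fun setT (EFin \o h). Proof. exact/measurable_EFinP. Qed.
Let mhp : measurable_fun setT ((EFin \o h)^\+%E).
Proof. exact: measurable_funepos. Qed.
Let mhn : measurable_fun setT ((EFin \o h)^\-%E).
Proof. exact: measurable_funeneg. Qed.
Let Kp0 w : (0 <= Kp w)%E. Proof. exact: integral_ge0. Qed.
Let Kn0 w : (0 <= Kn w)%E. Proof. exact: integral_ge0. Qed.
Let mKp : measurable_fun setT Kp.
Proof. exact: (measurable_mixture mk). Qed.
Let mKn : measurable_fun setT Kn.
Proof. exact: (measurable_mixture mk). Qed.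

Let intp : (\int[P]_(w in A) (EFin \o (h \o eta))^\+%E w = \int[P]_(w in A) Kp w)%E.
Proof.
have <- := ge0_integral_law mA meta mA mkA etaE (fun u => funepos_ge0 _ u) mhp.
by apply: eq_integral => w _; rewrite !unlock.
Qed.

Let intn : (\int[P]_(w in A) (EFin \o (h \o eta))^\-%E w = \int[P]_(w in A) Kn w)%E.
Proof.
have <- := ge0_integral_law mA meta mA mkA etaE (fun u => funeneg_ge0 _ u) mhn.
by apply: eq_integral => w _; rewrite !unlock.
Qed.

Let LA : P.-integrable A (EFin \o (h \o eta)).
Proof. exact: integrableS Lh. Qed.

Let LKp : P.-integrable A Kp.
Proof.
apply/integrableP; split; first exact: measurable_funTS.
under eq_integral do rewrite gee0_abs//.
rewrite -intp; exact: integral_funepos_lt_pinfty.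
Qed.

Let LKn : P.-integrable A Kn.
Proof.
apply/integrableP; split; first exact: measurable_funTS.
under eq_integral do rewrite gee0_abs//.
rewrite -intn; exact: integral_funeneg_lt_pinfty.
Qed.

Let kE w : \int[k w]_u h u = fine (Kp w - Kn w)%E.
Proof. by rewrite /Rintegral integralE. Qed.

Lemma measurable_kernel_mean : measurable_fun setT (fun w => \int[k w]_u h u).
Proof.
rewrite (_ : (fun w => _) = fine \o (fun w => Kp w - Kn w)%E); last exact/funext.
by apply: measurableT_comp => //; exact: emeasurable_funB.
Qed.

(* For w outside a null set only are both means finite, and is the mean of h
   under k w the difference of the two. *)
Let Kfin : {ae P, forall w, A w -> Kp w \is a fin_num /\ Kn w \is a fin_num}.
Proof.
have := integrable_ae mA LKp; have := integrable_ae mA LKn.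
by apply: filterS2 => w h1 h2 Aw; split; [exact: h2|exact: h1].
Qed.

Lemma kernel_mean :
  L1 P (fun w => \1_A w * \int[k w]_u h u) /\
  \int[P]_w (\1_A w * h (eta w)) = \int[P]_w (\1_A w * \int[k w]_u h u).
Proof.
have mKD : measurable_fun A (fun w => \int[k w]_u h u).
  by apply: measurable_funTS; exact: measurable_kernel_mean.
have aeE : ae_eq P A (fun w => (\int[k w]_u h u)%:E) (Kp \- Kn)%E.
  apply: filterS Kfin => w /[swap] Aw /(_ Aw)[fp fn].
  by rewrite kE fineK// fin_numB fp fn.
have LK : P.-integrable A (Kp \- Kn)%E by exact: integrableB.
have mKpn : measurable_fun A (Kp \- Kn)%E by exact: (measurable_int P LK).
have L : P.-integrable A (fun w => (\int[k w]_u h u)%:E).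
  apply/integrableP; split; first exact/measurable_EFinP.
  have /integrableP[_] := LK; congr (_ < _)%E; apply: ge0_ae_eq_integral => //.
  - exact: measurableT_comp.
  - by apply: measurableT_comp => //; exact/measurable_EFinP.
  - by apply: filterS aeE => w /[swap] Aw /(_ Aw) hw; congr abse.
split.
  have := (integrable_mkcond (mu := P) (fun w => (\int[k w]_u h u)%:E) mA).1 L.
  congr (P.-integrable _ _); apply/funext => w.
  by rewrite /patch/= indicE; case: (w \in A); rewrite ?mul1r ?mul0r.
rewrite -!E_set /Rintegral; congr fine.
have -> : (\int[P]_(w in A) (\int[k w]_u h u)%:E = \int[P]_(w in A) (Kp \- Kn) w)%E.
  by apply: ae_eq_integral => //; exact/measurable_EFinP.
by rewrite integralB// -intp -intn [LHS]integralE.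
Qed.

End KernelMean.

(** * Independent maps *)

(** The joint law of two independent maps is the product of their laws, so a
    mean over the common sample space may be taken over independent copies. *)
Section IndependentCopies.
Context (R : realType) (d d1 d2 : measure_display) (T : measurableType d)
        (U : measurableType d1) (V : measurableType d2) (P : probability T R).
Variables (a : T -> U) (ma : measurable_fun setT a).
Variables (b : T -> V) (mb : measurable_fun setT b).
Hypothesis ind : forall A B, measurable A -> measurable B ->
  P (a @^-1` A `&` b @^-1` B) = (P (a @^-1` A) * P (b @^-1` B))%E.

Let la : probability U R := distribution P (mfun_Sub (mem_set ma)).
Let lb : probability V R := distribution P (mfun_Sub (mem_set mb)).
Let mab : measurable_fun setT (fun w => (a w, b w)).
Proof. by apply/measurable_fun_pairP; split. Qed.
Let lab : probability (U * V)%type R := distribution P (mfun_Sub (mem_set mab)).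

Let labE C : measurable C -> (la \x lb)%E C = lab C.
Proof.
by move=> mC; apply: product_measure_unique => // A B mA mB; exact: ind.
Qed.

Section Nonnegative.
Variable F : U * V -> \bar R.
Hypotheses (F0 : forall z, (0 <= F z)%E) (mF : measurable_fun setT F).

Let start : (\int[P]_w F (a w, b w) = \int[la \x lb]_z F z)%E.
Proof.
transitivity (\int[lab]_z F z)%E.
  by rewrite ge0_integral_pushforward.
by apply: eq_measure_integral => C mC _; exact: esym (labE mC).
Qed.

Lemma integral_indep1 :
  (\int[P]_w F (a w, b w) = \int[P]_w \int[P]_w' F (a w, b w'))%E.
Proof.
rewrite start fubini_tonelli1// /fubini_F ge0_integral_pushforward//.
- apply: eq_integral => w _ /=; rewrite ge0_integral_pushforward//.
  by apply: measurableT_comp => //; exact: pair1_measurable.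
- by apply: measurable_fun_fubini_tonelli_F.
- by move=> u _; exact: integral_ge0.
Qed.

Lemma integral_indep2 :
  (\int[P]_w F (a w, b w) = \int[P]_w' \int[P]_w F (a w, b w'))%E.
Proof.
rewrite start fubini_tonelli2// /fubini_G ge0_integral_pushforward//.
- apply: eq_integral => w _ /=; rewrite ge0_integral_pushforward//.
  by apply: measurableT_comp => //; exact: pair2_measurable.
- by apply: measurable_fun_fubini_tonelli_G.
- by move=> u _; exact: integral_ge0.
Qed.

End Nonnegative.

(** For a real function the mean over the first copy is supplied as g. *)
Lemma E_indep2 (F : U * V -> R) (g : V -> R) : measurable_fun setT F ->
  L1 P (fun w => F (a w, b w)) -> measurable_fun setT g -> L1 P (g \o b) ->
  (forall v, L1 P (fun w => F (a w, v))) ->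
  (forall v, \int[P]_w F (a w, v) = g v) ->
  \int[P]_w F (a w, b w) = \int[P]_w g (b w).
Proof.
move=> mF LF mg Lg LFv FvE.
have mFE : measurable_fun setT (EFin \o F) by exact/measurable_EFinP.
have mgE : measurable_fun setT (EFin \o g) by exact/measurable_EFinP.
have LFE : (la \x lb)%E.-integrable setT (EFin \o F).
  apply/integrableP; split => //.
  have /integrableP[_] := LF; congr (_ < _)%E.
  have mA : measurable_fun setT (fun z => `|(EFin \o F) z|)%E by exact: measurableT_comp.
  transitivity (\int[lab]_z (fun z => `|(EFin \o F) z|) z)%E.
    by rewrite ge0_integral_pushforward.
  by apply: eq_measure_integral => C mC _; exact: esym (labE mC).
rewrite /Rintegral; congr fine.
transitivity (\int[lab]_z (EFin \o F) z)%E.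
  by rewrite integral_pushforward.
transitivity (\int[la \x lb]_z (EFin \o F) z)%E.
  by apply: eq_measure_integral => C mC _; exact: esym (labE mC).
rewrite -(integral21_prod_meas1 LFE) /fubini_G.
transitivity (\int[lb]_v (EFin \o g) v)%E.
  apply: eq_integral => v _.
  rewrite integral_pushforward//; first by rewrite (L1_E (LFv v)) FvE.
    by apply: measurableT_comp => //; exact: pair2_measurable.
  exact: LFv.
exact: (integral_pushforward mb mgE Lg measurableT).
Qed.

End IndependentCopies.

(** * Measures on a product *)

Section MixtureMeasure.
Context (R : realType) (d d' : measure_display) (T : measurableType d)
        (U : measurableType d').
Variables (mu : {measure set T -> \bar R}) (A : set T) (mA : measurable A).
Variable k : T -> {measure set U -> \bar R}.
Hypothesis mk : forall B, measurable B -> measurable_fun A (fun w => k w B).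
Local Open Scope ereal_scope.

(** The measure with value int_A k w B mu(dw) at B. *)
Definition mixture (B : set U) : \bar R := \int[mu]_(w in A) k w B.

Let mixture0 : mixture set0 = 0.
Proof. by rewrite /mixture integral0_eq// => w _; rewrite measure0. Qed.

Let mixture_ge0 B : 0 <= mixture B.
Proof. by apply: integral_ge0 => w _. Qed.

Let mixture_additive : semi_sigma_additive mixture.
Proof.
move=> F mF tF mUF.
rewrite (_ : mixture (\bigcup_n F n) = \sum_(n <oo) mixture (F n)).
  by apply: is_cvg_ereal_nneg_natsum => n _; exact: mixture_ge0.
rewrite /mixture -integral_nneseries//; last by move=> n; exact: mk.
apply: eq_integral => w _; rewrite measure_bigcup//.
by apply: eq_eseriesl => i; rewrite in_setT.
Qed.

HB.instance Definition _ := isMeasure.Build _ _ _ mixture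
  mixture0 mixture_ge0 mixture_additive.

Definition mixture_measure : {measure set U -> \bar R} := mixture.

End MixtureMeasure.

(** Finite measures on a product are determined by the rectangles. *)
Lemma eq_measure_prod (R : realType) (d d' : measure_display)
    (T : measurableType d) (U : measurableType d')
    (m1 m2 : {measure set (T * U) -> \bar R}) :
  (m1 setT < +oo)%E ->
  (forall A B, measurable A -> measurable B -> m1 (A `*` B) = m2 (A `*` B)) ->
  forall C, measurable C -> m1 C = m2 C.
Proof.
move=> m1T m12.
pose G : set (set (T * U)) :=
  [set C | exists A, measurable A /\ exists B, measurable B /\ C = A `*` B].
have CI : setI_closed G.
  move=> /= _ _ [X1 [mX1 [X2 [mX2 ->]]]] [Y1 [mY1 [Y2 [mY2 ->]]]].
  rewrite -setXI; exists (X1 `&` Y1); split; first exact: measurableI.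
  by exists (X2 `&` Y2); split => //; exact: measurableI.
move=> X mX; apply: (measure_unique G (fun=> setT)) => //.
- rewrite measurable_prod_measurableType //; congr (<<s _ >>).
  rewrite predeqE => C; split => [[A mA [B mB <-]]|[A [mA [B [mB ->]]]]].
    by exists A; split => //; exists B.
  by exists A => //; exists B.
- by move=> n; exists setT; split => //; exists setT; split => //; rewrite setXTT.
- by rewrite bigcup_const.
- by move=> A [A1 [mA1 [A2 [mA2 ->]]]]; rewrite m12.
Qed.

(** * Euler's scheme for a linear equation *)

Lemma expR_quadratic (R : realType) (x : R) : x <= 0 ->
  `|expR x - (1 + x)| <= x ^+ 2.
Proof.
move=> x0; have e1 := expR_ge1Dx x.
rewrite ger0_norm ?subr_ge0//.
have h : expR x * (1 - x) <= 1.
  rewrite -[leRHS](expRxMexpNx_1 x) ler_wpM2l ?expR_ge0//; exact: expR_ge1Dx.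
have x1 : 1 <= 1 - x by rewrite lerDl oppr_ge0.
have ele : expR x <= 1 by rewrite -[leRHS]expR0 ler_expR.
nra.
Qed.

(** A function that follows Euler's scheme for u' = lam * u, with an error that
    is o(h) uniformly in time, is an exponential. *)
Lemma euler_exponential (R : realType) (u : R -> R) (lam : R) : lam <= 0 ->
  (forall e, 0 < e -> exists2 eta, 0 < eta & forall h, 0 < h < eta ->
     forall t, 0 <= t -> `|u (t + h) - (1 + lam * h) * u t| <= e * h) ->
  forall t, 0 <= t -> u t = expR (lam * t) * u 0.
Proof.
move=> lam0 Hu t t0.
have [->|tn0] := eqVneq t 0; first by rewrite mulr0 expR0 mul1r.
have tp : 0 < t by rewrite lt0r tn0.
apply/eqP; rewrite -subr_eq0 -normr_le0; apply/ler_addgt0Pr => e' e'0.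
rewrite add0r.
pose c := t * (1 + `|u 0|).
have c0 : 0 < c by rewrite mulr_gt0// ltr_pwDl.
pose e := e' / c.
have e0 : 0 < e by rewrite divr_gt0.
have [eta eta0 He] := Hu _ e0.
(* The length h = t / N of a step is less than eta, and such that
   (lam * h)^2 <= e * h and 0 <= 1 + lam * h. *)
pose N := (Num.truncn (t / eta) + Num.truncn (t * (lam ^+ 2) / e) + Num.truncn (t * - lam)).+1.
have N0 : 0 < N%:R :> R by rewrite ltr0n.
pose h := t / N%:R.
have h0 : 0 < h by rewrite divr_gt0.
have trunc (x : R) n : (Num.truncn x <= n)%N -> x < n.+1%:R.
  move=> xn; apply: lt_le_trans (truncnS_gt x) _; by rewrite ler_nat ltnS.
have heta : h < eta.
  rewrite /h ltr_pdivrMr// mulrC -ltr_pdivrMr//; apply: trunc.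
  by rewrite -addnA leq_addr.
have hlam2 : (lam * h) ^+ 2 <= e * h.
  have hl : lam ^+ 2 * h <= e.
    rewrite /h mulrA ler_pdivrMr// -ler_pdivrMl// [_^-1 * _]mulrC [_ * t]mulrC.
    by apply/ltW/trunc; rewrite addnAC leq_addl.
  rewrite (_ : (lam * h) ^+ 2 = lam ^+ 2 * h * h); last by ring.
  by rewrite ler_pM2r.
have hlam : 0 <= 1 + lam * h.
  have hl : - lam * h <= 1.
    rewrite /h mulrA ler_pdivrMr// mul1r mulrC; apply/ltW/trunc; exact: leq_addl.
  by lra.
have hlam1 : 1 + lam * h <= 1 by rewrite gerDl mulr_le0_ge0// ltW.
(* The error after k steps. It grows by the error of the scheme at u, and by
   that of the scheme at the exponential, while 1 + lam * h <= 1. *)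
pose D k := u (h *+ k) - expR (lam * (h *+ k)) * u 0.
have step k : `|D k| <= (e * h * (1 + `|u 0|)) *+ k.
  elim: k => [|k ih]; first by rewrite /D mulr0n mulr0 expR0 mul1r subrr normr0.
  have -> : D k.+1 = (u (h *+ k + h) - (1 + lam * h) * u (h *+ k))
     + (1 + lam * h) * D k
     - expR (lam * (h *+ k)) * u 0 * (expR (lam * h) - (1 + lam * h)).
    by rewrite /D mulrSr mulrDr expRD; ring.
  rewrite mulrSr; apply: le_trans (ler_normB _ _) _.
  have hk0 : 0 <= h *+ k by rewrite mulrn_wge0// ltW.
  have b1 : `|u (h *+ k + h) - (1 + lam * h) * u (h *+ k)| <= e * h.
    by apply: He; rewrite ?h0.
  have b2 : `|(1 + lam * h) * D k| <= (e * h * (1 + `|u 0|)) *+ k.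
    by rewrite normrM (ger0_norm hlam) (le_trans _ ih)// ler_piMl.
  have b3 : `|expR (lam * (h *+ k)) * u 0 * (expR (lam * h) - (1 + lam * h))| <= `|u 0| * (e * h).
    rewrite !normrM; apply: ler_pM => //.
      rewrite ler_piMl// ger0_norm ?expR_ge0// -[leRHS]expR0 ler_expR.
      by rewrite mulr_le0_ge0.
    by apply: le_trans hlam2; apply: expR_quadratic; rewrite mulr_le0_ge0// ltW.
  apply: le_trans (lerD (le_trans (ler_normD _ _) (lerD b1 b2)) b3) _.
  by rewrite mulrDr mulr1 [`|u 0| * _]mulrC; lra.
have := step N; rewrite /D /h -mulr_natr divfK ?gt_eqF//.
move/le_trans; apply.
rewrite -[in leLHS]mulr_natr.
rewrite (_ : _ * N%:R = e * c); last by rewrite /c; field; rewrite gt_eqF.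
by rewrite /e divfK// gt_eqF.
Qed.

(** * Joint measurability of a continuous process *)

Lemma truncn_between (R : realType) (x : R) : 0 <= x ->
  (Num.truncn x)%:R <= x < (Num.truncn x).+1%:R.
Proof. by move=> x0; rewrite truncn_le x0 truncnS_gt. Qed.

Section JointMeasurability.
Context (R : realType) (d : measure_display) (O : measurableType d).
Variable Z : R -> O -> R.
Hypothesis mZ : forall t, 0 <= t -> measurable_fun setT (Z t).
Hypothesis cZ : forall w, {within `[0, +oo[, continuous (fun t => Z t w)}.

(* The first multiple of 1 / (k + 1) beyond t. *)
Let up k (t : R) : R := (Num.truncn (k.+1%:R * t)).+1%:R / k.+1%:R.

Let up_gt k t : t < up k t.
Proof.
rewrite /up ltr_pdivlMr ?ltr0n// mulrC; exact: truncnS_gt.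
Qed.

Let up_le k t : 0 <= t -> up k t <= t + k.+1%:R^-1.
Proof.
move=> t0; rewrite /up ler_pdivrMr ?ltr0n// mulrDl mulVf ?pnatr_eq0// -natr1.
rewrite lerD2r [t * _]mulrC.
by have /andP[] := truncn_between (mulr_ge0 (ler0n R k.+1) t0).
Qed.

Let up_cvg t : 0 <= t -> up k t @[k --> \oo] --> t.
Proof.
move=> t0; apply: (@squeeze_cvgr _ _ _ _ (fun=> t) (fun k => t + k.+1%:R^-1)).
- by apply: nearW => k; rewrite (ltW (up_gt k t)) up_le.
- exact: cvg_cst.
- rewrite -[X in _ --> X]addr0; apply: cvgD; first exact: cvg_cst.
  exact: cvg_harmonic.
Qed.

(** A process with continuous paths is jointly measurable in time and outcome:
    it is the limit of its right-endpoint discretizations. *)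
Lemma joint_measurable :
  measurable_fun setT (fun z : O * measurableTypeR R => Z (Num.max z.2 0) z.1).
Proof.
have m0 (z : O * measurableTypeR R) : 0 <= Num.max z.2 0 by rewrite le_max lexx orbT.
apply: (@measurable_fun_cvg _ _ _ _
  (fun k (z : O * measurableTypeR R) => Z (up k (Num.max z.2 0)) z.1)).
- move=> k _ B mB; rewrite setTI.
  pose C j := [set t : measurableTypeR R | Num.truncn (k.+1%:R * Num.max t 0) = j].
  have mC j : measurable (C j).
    pose f (t : R) := k.+1%:R * Num.max t 0.
    have mf : measurable_fun setT f.
      apply: measurable_funM => //; exact: measurable_maxr.
    have -> : C j = f @^-1` `[j%:R, j.+1%:R[.
      apply/seteqP; split => t /=; rewrite in_itv/= /f.
        move=> <-; apply: truncn_between; rewrite mulr_ge0//.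
        by rewrite le_max lexx orbT.
      by move=> h; exact: truncn_def.
    by rewrite -[X in measurable X]setTI; exact: mf.
  have -> : (fun z : O * measurableTypeR R => Z (up k (Num.max z.2 0)) z.1) @^-1` B =
      \bigcup_j ((Z (j.+1%:R / k.+1%:R) @^-1` B) `*` C j).
    apply/seteqP; split => [[w t] /= h|[w t] /= [j _ [/= h1 h2]]].
      by exists (Num.truncn (k.+1%:R * Num.max t 0)).
    by rewrite /up h2.
  apply: bigcup_measurable => j _; apply: measurableX => //.
  rewrite -[X in measurable X]setTI; apply: mZ => //.
- move=> [w t] _ /=; set s := Num.max t 0.
  have s0 : 0 <= s by exact: (m0 (w, t)).
  have /subspace_continuousP/(_ s) cw := @cZ w.
  have sI : `[0, +oo[%classic s by rewrite /= in_itv/= s0.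
  have := cw sI => {}cw.
  apply: cvg_comp cw => A [e /= e0 He].
  have H : \forall k \near \oo, ball s e (up k s).
    exact: up_cvg s0 _ (nbhsx_ballx s e e0).
  have : \forall k \near \oo, A (up k s).
    apply: filterS H => k /He; apply.
    by rewrite in_itv/= andbT; exact: le_trans s0 (ltW (up_gt k s)).
  exact.
Qed.

End JointMeasurability.

(** * Derivatives in a parameter *)

Section DirectionalDerivatives.
Context (R : realType) (E : normedModType R).
Implicit Types (f : E -> R) (x v : E).

(** The function f along the line through x with direction v. *)
Definition line f x v (h : R) : R := f (h *: v + x).

Lemma derivable_line f x v : derivable f x v <-> derivable (line f x v) 0 1.
Proof.
rewrite /derivable.
have -> : (fun h => h^-1 *: ((f \o shift x) (h *: v) - f x)) =
          (fun h => h^-1 *: ((line f x v \o shift 0) (h *: (1 : R)) - line f x v 0)).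
  by apply/funext => h; rewrite /line/= scale0r add0r addr0 [_ *: 1]mulr1.
by [].
Qed.

(** A derivative in a parameter is a limit of difference quotients, and so it
    is measurable in the variables that the function is measurable in. *)
Lemma measurable_derive (d : measure_display) (U : measurableType d) (D : set U)
    (f : U -> E -> R) (Th : set E) x v : measurable D -> open Th -> Th x ->
  (forall t, Th t -> measurable_fun D (fun u => f u t)) ->
  (forall u, D u -> derivable (f u) x v) ->
  measurable_fun D (fun u => 'D_v (f u) x).
Proof.
move=> mD oT Tx mf df.
have : \forall h \near (0 : R), Th (h *: v + x).
  have c : (fun h : R => h *: v + x) @ (0 : R) --> x.
    rewrite -[X in _ --> X]add0r -[X in _ --> X + _](scale0r v).
    by apply: cvgD; [apply: cvgZr_tmp; exact: cvg_id|exact: cvg_cst].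
  by apply: c; exact: open_nbhs_nbhs.
move=> [e /= e0 He].
pose h k : R := e / k.+2%:R.
have h0 k : 0 < h k by rewrite divr_gt0.
have hT k : Th (h k *: v + x).
  apply: He; rewrite /ball_/= sub0r normrN gtr0_norm// /h ltr_pdivrMr//.
  by rewrite ltr_pMr// ltr1n.
have hc : h k @[k --> \oo] --> 0.
  rewrite -(mulr0 e); apply: cvgMl_tmp.
  have := @cvg_harmonic R; rewrite -(cvg_shiftS (@harmonic R)); exact.
apply: (@measurable_fun_cvg _ _ _ _ (fun k u => (h k)^-1 * (f u (h k *: v + x) - f u x))).
  by move=> k; apply: measurable_funM => //; apply: measurable_funB; exact: mf.
move=> u Du; have := df u Du; rewrite /derivable => /cvg_ex[l hl].
rewrite /derive (cvg_lim _ hl)//.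
have : h k @[k --> \oo] --> (0 : R)^'.
  move=> A [r /= r0 Ar].
  have : \forall k \near \oo, ball 0 r (h k) by exact: hc _ (nbhsx_ballx 0 r r0).
  by apply: filterS => k hk; apply: Ar => //; rewrite gt_eqF.
by move=> hc'; exact: (cvg_comp _ _ hc' hl).
Qed.

Lemma derivable_sum_seq (I : Type) (s : seq I) (F : I -> E -> R) x v :
  (forall i, derivable (F i) x v) -> derivable (fun t => \sum_(i <- s) F i t) x v.
Proof.
move=> dF; elim: s => [|i s ih].
  rewrite (_ : (fun t => _) = cst 0); first exact: derivable_cst.
  by apply/funext => t; rewrite big_nil.
rewrite (_ : (fun t => _) = F i + (fun t => \sum_(j <- s) F j t)); first exact: derivableD.
by apply/funext => t; rewrite big_cons.
Qed.

Lemma derivable_prod_seq (I : Type) (s : seq I) (F : I -> E -> R) x v :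
  (forall i, derivable (F i) x v) -> derivable (fun t => \prod_(i <- s) F i t) x v.
Proof.
move=> dF; elim: s => [|i s ih].
  rewrite (_ : (fun t => _) = cst 1); first exact: derivable_cst.
  by apply/funext => t; rewrite big_nil.
rewrite (_ : (fun t => _) = F i * (fun t => \prod_(j <- s) F j t)); first exact: derivableM.
by apply/funext => t; rewrite big_cons.
Qed.

Lemma derivable_det n (N : E -> 'M[R]_n) x v :
  (forall i j, derivable (fun t => N t i j) x v) ->
  derivable (fun t => \det (N t)) x v.
Proof.
move=> dN; apply: derivable_sum_seq => /= s; pose p : perm.perm_type 'I_n := s.
rewrite (_ : (fun t => _) = cst ((-1) ^+ perm.odd_perm p) *
    (fun t => \prod_i N t i (perm.fun_of_perm p i))).
  by apply: derivableM; [exact: derivable_cst|exact: derivable_prod_seq].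
by apply/funext.
Qed.

Lemma derive_dot (I : finType) (W V : I -> E -> R) x v :
  (forall i, derivable (W i) x v) -> (forall i, derivable (V i) x v) ->
  'D_v (fun t => \sum_i W i t * V i t) x =
  \sum_i (W i x * 'D_v (V i) x + 'D_v (W i) x * V i x).
Proof.
move=> dW dV.
have dWV i : derivable (W i * V i) x v by exact: derivableM.
suff H (s : seq I) : 'D_v (fun t => \sum_(i <- s) W i t * V i t) x =
  \sum_(i <- s) (W i x * 'D_v (V i) x + 'D_v (W i) x * V i x) by exact: H.
elim: s => [|i s ih].
  rewrite (_ : (fun t => _) = cst 0) ?derive_cst ?big_nil//.
  by apply/funext => t; rewrite big_nil.
rewrite (_ : (fun t => _) = W i * V i + (fun t => \sum_(j <- s) W j t * V j t)); last first.
  by apply/funext => t; rewrite big_cons.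
rewrite deriveD//; last by apply: derivable_sum_seq => j; exact: dWV.
by rewrite ih big_cons deriveM// [_ *: 'D_v (W i) x]mulrC.
Qed.

End DirectionalDerivatives.

(** If the values of a linear form at M independent vectors, and the vectors,
    are differentiable functions of a parameter, then so is the form. *)
Lemma derivable_coefficients (R : realType) (E : normedModType R) M
    (W : 'I_M -> E -> R) (N : E -> 'M[R]_M) (x v : E) :
  (forall k m, derivable (fun t => N t k m) x v) ->
  (forall k, derivable (fun t => \sum_m W m t * N t k m) x v) ->
  N x \in unitmx -> forall m, derivable (W m) x v.
Proof.
move=> dN dG Nx m; apply/derivable_line.
pose N' h := N (h *: v + x); pose W' h : 'cV[R]_M := \col_m W m (h *: v + x).
pose G h : 'cV[R]_M := N' h *m W' h.
have dN' k l : derivable (fun h => N' h k l) 0 1.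
  exact: (derivable_line (fun t => N t k l) x v).1 (dN k l).
have dG' k : derivable (fun h : R => G h k 0 : R) (0 : R) (1 : R).
  have := (derivable_line _ x v).1 (dG k).
  rewrite (_ : line _ x v = (fun h : R => G h k 0))//.
  apply/funext => h; rewrite /line /G mxE; apply: eq_bigr => l _.
  by rewrite mxE mulrC.
have ddet : derivable (fun h : R => \det (N' h) : R) (0 : R) (1 : R) by exact: derivable_det.
have det0 : \det (N' 0) != 0.
  by rewrite /N' scale0r add0r -unitfE -unitmxE.
have cdet : {for 0, continuous (fun h => \det (N' h))}.
  exact/differentiable_continuous/derivable1_diffP.
have near0 : \forall h \near (0 : R), \det (N' h) != 0.
  by have := cdet; move/cvgr_neq0; apply.
(* Where N' h is invertible, Cramer's formula expresses W' h by N' h and G h. *)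
pose Q h := (\sum_k \adj (N' h) m k * G h k 0) * (\det (N' h))^-1.
apply: (@near_eq_derivable _ _ _ Q); rewrite ?oner_neq0//.
  apply: filterS near0 => h hN.
  have uN : N' h \in unitmx by rewrite unitmxE unitfE.
  have : W' h = (\det (N' h))^-1 *: (\adj (N' h) *m G h).
    rewrite /G mulmxA mul_adj_mx mul_scalar_mx scalerA mulVf// scale1r//.
  move=> /matrixP /(_ m 0); rewrite !mxE /Q /line => ->.
  by rewrite mulrC.
apply: derivableM; last first.
  by apply: derivableV.
apply: derivable_sum_seq => k; apply: derivableM => //.
rewrite (_ : (fun h => _) = cst ((-1) ^+ (k + m)) * (fun h => \det (row' k (col' m (N' h))))).
  apply: derivableM; first exact: derivable_cst.
  apply: derivable_det => i j.
  rewrite (_ : (fun h => _) = (fun h => N' h (lift k i) (lift m j))) => //.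
  by apply/funext => h; rewrite !mxE.
by apply/funext => h; rewrite mxE /cofactor.
Qed.

(** If no nonzero linear form vanishes at all the vectors g b, then M of them
    are the rows of an invertible matrix. *)
Lemma spanning_unitmx (K : fieldType) (A : Type) (D : A -> Prop) M
    (g : A -> 'I_M -> K) :
  (forall c : 'I_M -> K, (forall b, D b -> \sum_m c m * g b m = 0) ->
     forall m, c m = 0) ->
  exists b : 'I_M -> A, (forall k, D (b k)) /\ \matrix_(k, m) g (b k) m \in unitmx.
Proof.
move=> Hg.
suff H r : (r <= M)%N -> exists b : 'I_r -> A, (forall k, D (b k)) /\
    row_free (\matrix_(k < r, m < M) g (b k) m).
  have [b [Db fb]] := H M (leqnn M).
  by exists b; split => //; rewrite -row_free_unit.
elim: r => [_|r ih rM].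
  have b0 : 'I_0 -> A by case.
  exists b0; split; first by case.
  apply: inj_row_free => u _; by apply/rowP; case.
have [b [Db fb]] := ih (ltnW rM).
set N := \matrix_(k, m) _ in fb.
(* Some linear form c vanishes at the r < M vectors found so far; a vector at
   which it does not vanish is added. *)
have : cokermx N != 0.
  rewrite -mxrank_eq0 mxrank_coker (eqP fb) subn_eq0 -ltnNge//.
move=> /matrix0Pn[i0 [j0 cij]].
pose c m := cokermx N m j0.
have [b0 Db0 cb0] : exists2 b0, D b0 & \sum_m c m * g b0 m != 0.
  apply: contrapT => H; move/eqP: cij; apply; apply: (Hg c) => b1 Db1.
  by apply/eqP/negPn/negP => cb1; apply: H; exists b1.
have Nc k : \sum_m g (b k) m * c m = 0.
  have := mulmx_coker N => /matrixP /(_ k j0).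
  rewrite [RHS]mxE [LHS]mxE => Nk; rewrite -[RHS]Nk.
  by apply: eq_bigr => m _; rewrite [X in _ = X * _]mxE.
pose b' (k : 'I_r.+1) := if unlift ord_max k is Some k' then b k' else b0.
have b'w k : b' (widen_ord (leqnSn r) k) = b k.
  rewrite /b' (_ : widen_ord _ k = lift ord_max k) ?liftK//.
  by apply/val_inj; rewrite /= /bump leqNgt ltn_ord.
have b'm : b' ord_max = b0 by rewrite /b' unlift_none.
exists b'; split.
  by move=> k; rewrite /b'; case: unlift.
apply: inj_row_free => u uN.
have uE m : \sum_(k < r) u 0 (widen_ord (leqnSn r) k) * g (b k) m + u 0 ord_max * g b0 m = 0.
  have /matrixP/(_ 0 m) := uN; rewrite !mxE big_ord_recr/= mxE b'm => Um; rewrite -[RHS]Um.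
  by congr (_ + _); apply: eq_bigr => k _; rewrite mxE b'w.
have um0 : u 0 ord_max = 0.
  have : \sum_m (\sum_(k < r) u 0 (widen_ord (leqnSn r) k) * g (b k) m +
      u 0 ord_max * g b0 m) * c m = 0.
    by rewrite big1// => m _; rewrite uE mul0r.
  under eq_bigr do rewrite mulrDl mulr_suml.
  rewrite big_split/= exchange_big/= big1 ?add0r; last first.
    move=> k _; under eq_bigr do rewrite -mulrA.
    by rewrite -mulr_sumr Nc mulr0.
  under eq_bigr do rewrite -mulrA [g b0 _ * _]mulrC.
  by rewrite -mulr_sumr => /eqP; rewrite mulf_eq0 (negbTE cb0) orbF => /eqP.
pose u' : 'rV[K]_r := \row_k u 0 (widen_ord (leqnSn r) k).
have u'0 : u' = 0.
  apply: (row_free_inj fb); rewrite mul0mx; apply/rowP => m; rewrite !mxE.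
  have Um := uE m; rewrite um0 mul0r addr0 in Um; rewrite -[RHS]Um.
  by apply: eq_bigr => k _; rewrite !mxE.
apply/rowP => k; rewrite mxE; case: (unliftP ord_max k) => [k' ->|->//].
have /rowP/(_ k') := u'0; rewrite !mxE => U; rewrite -[RHS]U; congr (u 0 _); apply/val_inj.
by rewrite /= /bump leqNgt ltn_ord.
Qed.

(** * Stationary Markov chains *)

(** The lag k occurs n - k times among the pairs i <= j < n.  This is where the
    weights n - j + 1 in the definition of f~1 come from; they read n - j here,
    as j counts from 0. *)
Lemma sum_lags (R : pzRingType) (phi : nat -> R) n :
  \sum_(i < n) \sum_(j < n | (i <= j)%N) phi (j - i)%N =
  \sum_(j < n) (n - j)%:R * phi j.
Proof.
elim: n => [|n ih]; first by rewrite !big_ord0.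
have h1 : \sum_(j < n.+1 | (n <= j)%N) phi (j - n)%N = phi 0%N.
  rewrite big_mkcond big_ord_recr/= leqnn subnn big1 ?add0r// => j _.
  by rewrite leqNgt ltn_ord.
have h2 (i : 'I_n) : \sum_(j < n.+1 | (i <= j)%N) phi (j - i)%N =
    \sum_(j < n | (i <= j)%N) phi (j - i)%N + phi (n - i)%N.
  by rewrite big_mkcond big_ord_recr/= -big_mkcond/= ltnW.
rewrite big_ord_recr/= h1 (eq_bigr _ (fun i _ => h2 i)) big_split/= ih -addrA.
have -> : \sum_(i < n) phi (n - i)%N + phi 0%N = \sum_(j < n.+1) phi j.
  rewrite [RHS](reindex_inj rev_ord_inj) [RHS]big_ord_recr/= subnn.
  by congr (_ + _); apply: eq_bigr => i _; rewrite subSS.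
rewrite [X in _ + X]big_ord_recr [RHS]big_ord_recr/= subSnn mul1r addrA.
rewrite -big_split/=; congr (_ + _); apply: eq_bigr => j _.
by rewrite subSn 1?ltnW// -natr1 mulrDl mul1r.
Qed.

Section MarkovChain.
Context (R : realType) (d d' : measure_display) (T : measurableType d)
        (U : measurableType d') (P : probability T R).
Variable Y : nat -> T -> U.
Hypothesis mY : forall i, measurable_fun setT (Y i).
Variable K : R.-pker U ~> U.

(** The events determined by Y_0, ..., Y_i are the measurable sets of the
    measurable space [past i], whose carrier is the sample space itself. *)
Definition past_gen (i : nat) : set (set T) :=
  [set A | exists j B, [/\ (j <= i)%N, measurable B & A = Y j @^-1` B]].

Definition past i := g_sigma_algebraType (past_gen i).

Hypothesis markov : forall i (A : set (past i)) (B : set U),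
  measurable A -> measurable B ->
  P (A `&` Y i.+1 @^-1` B) = (\int[P]_(w in A) K (Y i w) B)%E.
Hypothesis stationary : forall i (B : set U), measurable B ->
  P (Y i @^-1` B) = P (Y 0 @^-1` B).
Local Notation pair i := (fun w => (Y i w, Y i.+1 w)).

Lemma past_gen_measurable i : past_gen i `<=` measurable.
Proof.
move=> _ [j [B [_ mB ->]]].
by rewrite -[X in measurable X]setTI; exact: mY.
Qed.

Lemma past_measurable i (A : set (past i)) :
  measurable A -> measurable (A : set T).
Proof. exact: (smallest_sub (@sigma_algebra_measurable _ T) (@past_gen_measurable i)). Qed.

Lemma past_le i j (A : set (past i)) : (i <= j)%N -> measurable A ->
  measurable (A : set (past j)).
Proof.
move=> ij; apply: (@sub_sigma_algebra2 _ setT _ (past_gen i)).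
move=> _ [l [B [li mB ->]]].
by exists l, B; split => //; exact: leq_trans ij.
Qed.

Lemma past_id i : measurable_fun setT (fun w : T => (w : past i)).
Proof. by move=> _ A mA; rewrite setTI; exact: past_measurable mA. Qed.

Lemma measurable_past i j : (j <= i)%N ->
  measurable_fun setT (Y j : past i -> U).
Proof.
move=> ji _ B mB; rewrite setTI; apply: sub_sigma_algebra.
by rewrite /past_gen/=; exists j, B.
Qed.

Lemma markov_integral i (A : set (past i)) (f : U -> \bar R) :
  measurable A -> (forall u, (0 <= f u)%E) -> measurable_fun setT f ->
  (\int[P]_(w in A) f (Y i.+1 w) = \int[P]_(w in A) \int[K (Y i w)]_u f u)%E.
Proof.
move=> mA f0 mf.
rewrite (ge0_integral_law (past_measurable mA) (mY i.+1) (mu1 := P)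
  (past_measurable mA) (k := fun w => K (Y i w)))//.
- move=> B mB; apply: measurable_funTS.
  exact: measurableT_comp (measurable_kernel K B mB) (mY i).
- by move=> B mB; exact: markov.
Qed.

(** The law of (y, Y_1) for the chain started at y. *)
Definition Kpair (y : U) : {measure set (U * U) -> \bar R} :=
  measure_function_pushforward__canonical__measure_function_Measure
    (K y) (pair1_measurable y).

Lemma measurable_Kint (f : U * U -> \bar R) :
  (forall u, (0 <= f u)%E) -> measurable_fun setT f ->
  measurable_fun setT (fun y => \int[K y]_z f (y, z))%E.
Proof. by move=> f0 mf; exact: measurable_fun_integral_finite_kernel. Qed.

Lemma measurable_Kpair C : measurable C -> measurable_fun setT (fun y => Kpair y C).
Proof.
move=> mC.
have h : measurable_fun setT (fun y => \int[K y]_z (\1_C (y, z))%:E)%E.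
  apply: (measurable_Kint (f := fun u => (\1_C u)%:E)).
    by move=> u; rewrite lee_fin.
  by apply/measurable_EFinP; exact: measurable_indic.
apply: eq_measurable_fun h => y _; rewrite /Kpair/= /pushforward.
rewrite (_ : (fun z => _) = (fun z => (\1_((fun z => (y, z)) @^-1` C) z)%:E)); last first.
  by apply/funext => z; rewrite !indicE.
rewrite integral_indic ?setIT//.
by rewrite -[X in measurable X]setTI; exact: pair1_measurable.
Qed.

Lemma mY2 i j : measurable_fun setT (fun w => (Y i w, Y j w)).
Proof. by apply/measurable_fun_pairP; split; exact: mY. Qed.

(** The Markov property for pairs of consecutive values. *)
Lemma markov_pair i (A : set (past i)) (C : set (U * U)) :
  measurable A -> measurable C ->
  P (A `&` (pair i) @^-1` C) =
  (\int[P]_(w in A) Kpair (Y i w) C)%E.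
Proof.
move=> mA mC; have mA' := past_measurable mA.
have mk B : measurable B -> measurable_fun (A : set T) (fun w => Kpair (Y i w) B).
  move=> mB; apply: measurable_funTS.
  exact: (measurableT_comp (measurable_Kpair mB) (mY i)).
pose m1 : {measure set (U * U) -> \bar R} :=
  measure_function_pushforward__canonical__measure_function_Measure
    (mrestr P mA') (mY2 i i.+1).
suff H B : measurable B -> m1 B = mixture_measure P mA' mk B.
  by have := H C mC; rewrite /m1/= /pushforward/mrestr setIC.
apply: eq_measure_prod.
  by rewrite /m1/= /pushforward/mrestr preimage_setT setTI ltey_eq fin_num_measure.
move=> B1 B2 mB1 mB2.
rewrite /m1/= /pushforward/mrestr /mixture.
have -> : (pair i) @^-1` (B1 `*` B2) `&` A =
   (A `&` Y i @^-1` B1) `&` Y i.+1 @^-1` B2.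
  by apply/seteqP; split => w /=; tauto.
have mB1' : measurable (Y i @^-1` B1 : set (past i)).
  rewrite -[X in measurable X]setTI; exact: measurable_past.
rewrite markov//; last exact: measurableI.
rewrite [LHS]integral_mkcondr; apply: eq_integral => w _.
rewrite /patch/pushforward; case: ifPn => [/set_mem wB|/negP wB].
  by congr (K _ _); apply/seteqP; split => z //= [].
have nB : ~ B1 (Y i w) by move=> h; apply: wB; rewrite inE.
rewrite -[LHS](measure0 (K (Y i w))); congr (K _ _).
by apply/seteqP; split => z //= [].
Qed.

Lemma markov_integral2 i (A : set (past i)) (f : U * U -> \bar R) :
  measurable A -> (forall u, (0 <= f u)%E) -> measurable_fun setT f ->
  (\int[P]_(w in A) f (Y i w, Y i.+1 w) =
   \int[P]_(w in A) \int[K (Y i w)]_z f (Y i w, z))%E.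
Proof.
move=> mA f0 mf; have mA' := past_measurable mA.
rewrite (ge0_integral_law mA' (mY2 i i.+1) (mu1 := P) mA'
  (k := fun w => Kpair (Y i w)))//.
- by apply: eq_integral => w _; rewrite ge0_integral_pushforward.
- move=> B mB; apply: measurable_funTS.
  exact: (measurableT_comp (measurable_Kpair mB) (mY i)).
- by move=> B mB; exact: markov_pair.
Qed.

Lemma stationary_integral i (f : U -> \bar R) :
  (forall u, (0 <= f u)%E) -> measurable_fun setT f ->
  (\int[P]_w f (Y i w) = \int[P]_w f (Y 0 w))%E.
Proof.
move=> f0 mf; apply: ge0_integral_eqlaw => // B mB.
by rewrite !setTI; exact: stationary.
Qed.

Lemma pair_event_past i (B : set (U * U)) : measurable B ->
  measurable ((pair i) @^-1` B : set (past i.+1)).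
Proof.
move=> mB; rewrite -[X in measurable X]setTI.
have h : measurable_fun setT (fun w : past i.+1 => (Y i w, Y i.+1 w)).
  by apply/measurable_fun_pairP; split; exact: measurable_past.
exact: h.
Qed.

(** The transition operator, on nonnegative functions. *)
Definition Kop (G : U -> \bar R) (y : U) : \bar R := (\int[K y]_z G z)%E.

Lemma Kop_ge0 G : (forall u, (0 <= G u)%E) -> forall u, (0 <= Kop G u)%E.
Proof. by move=> G0 u; exact: integral_ge0. Qed.

Lemma measurable_Kop G : (forall u, (0 <= G u)%E) -> measurable_fun setT G ->
  measurable_fun setT (Kop G).
Proof.
move=> G0 mG; apply: (measurable_Kint (f := fun u => G u.2)) => //.
exact: measurableT_comp.
Qed.

Lemma iter_Kop k G : (forall u, (0 <= G u)%E) -> measurable_fun setT G ->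
  (forall u, (0 <= iter k Kop G u)%E) /\ measurable_fun setT (iter k Kop G).
Proof.
move=> G0 mG; elim: k => [//|k [h1 h2]]; split => /=.
  exact: Kop_ge0.
exact: measurable_Kop.
Qed.

Lemma markov_iter k i (A : set (past i)) (G : U -> \bar R) :
  measurable A -> (forall u, (0 <= G u)%E) -> measurable_fun setT G ->
  (\int[P]_(w in A) G (Y (i + k) w) = \int[P]_(w in A) iter k Kop G (Y i w))%E.
Proof.
elim: k G => [|k ih] G mA G0 mG; first by rewrite addn0.
rewrite addnS (markov_integral (past_le (leq_addr k i) mA) G0 mG).
by rewrite iterSr -ih//; [exact: Kop_ge0|exact: measurable_Kop].
Qed.

(** The joint law of two pairs of consecutive values depends on their distance
    in time only. *)
Lemma pair_stationary i k (B B' : set (U * U)) : measurable B -> measurable B' ->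
  P ((pair i) @^-1` B `&`
     (pair (i + k)) @^-1` B') =
  P ((pair 0) @^-1` B `&`
     (pair k) @^-1` B').
Proof.
move=> mB mB'.
have ind0 (C : set (U * U)) u : (0 <= (\1_C u)%:E :> \bar R)%E.
  by rewrite lee_fin.
have ipre (f : T -> U * U) C w : \1_(f @^-1` C) w = \1_C (f w) :> R by rewrite !indicE.
have mind (C : set (U * U)) : measurable C ->
    measurable_fun setT (fun u => (\1_C u)%:E : \bar R).
  by move=> mC; apply/measurable_EFinP; exact: measurable_indic.
have pre j (C : set (U * U)) : measurable C ->
    measurable ((pair j) @^-1` C).
  by move=> mC; rewrite -[X in measurable X]setTI; exact: mY2.
have mBB := measurableI _ _ mB mB'.
(* At distance 0 the two events concern the same pair.  At distance k + 1 the
   conditional probability of the second event is a function G of Y_{i+1}. *)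
case: k => [|k].
  rewrite addn0.
  have stat j : P ((pair j) @^-1` B `&`
                   (pair j) @^-1` B') =
      (\int[P]_w \int[K (Y 0 w)]_z (\1_(B `&` B') (Y 0 w, z))%:E)%E.
    rewrite -[in LHS](setIT (_ `&` _)) -integral_indic//.
      2: exact: measurableI (pre j _ mB) (pre j _ mB').
    transitivity (\int[P]_w (\1_(B `&` B') (Y j w, Y j.+1 w))%:E)%E.
      apply: eq_integral => w _.
      exact: (congr1 EFin (ipre (pair j) (B `&` B') w)).
    rewrite (@markov_integral2 j setT (fun u => (\1_(B `&` B') u)%:E)
      measurableT (ind0 _) (mind _ mBB)).
    apply: (@stationary_integral j (fun y => \int[K y]_z (\1_(B `&` B') (y, z))%:E)%E).
      by move=> u; exact: integral_ge0.
    by apply: (measurable_Kint (f := fun u => (\1_(B `&` B') u)%:E)) => //; exact: mind mBB.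
  by rewrite !stat.
pose G0 y := (\int[K y]_z (\1_B' (y, z))%:E)%E.
have G00 y : (0 <= G0 y)%E by exact: integral_ge0.
have mG0 : measurable_fun setT G0 by exact: (measurable_Kint (ind0 B') (mind _ mB')).
pose G := iter k Kop G0.
have [Gk0 mGk] := iter_Kop k G00 mG0; rewrite -/G in Gk0 mGk.
pose f (u : U * U) := ((\1_B u)%:E * G u.2)%E.
have f0 u : (0 <= f u)%E by rewrite mule_ge0.
have mf : measurable_fun setT f.
  apply: emeasurable_funM; first exact: mind.
  exact: measurableT_comp.
suff stat j : P ((pair j) @^-1` B `&`
     (pair (j.+1 + k)) @^-1` B') =
     (\int[P]_w \int[K (Y 0 w)]_z f (Y 0 w, z))%E.
  by rewrite -addSnnS (stat i); exact: esym (stat 0%N).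
set A := _ @^-1` B.
have mA : measurable (A : set (past j.+1)) by exact: pair_event_past.
rewrite setIC -integral_indic; [|exact: past_measurable mA|exact: pre].
transitivity (\int[P]_(w in A) (\1_B' (Y (j.+1 + k) w, Y (j.+1 + k).+1 w))%:E)%E.
  by apply: eq_integral => w _; rewrite ipre.
rewrite (markov_integral2 (past_le (leq_addr k j.+1) mA) (ind0 B') (mind _ mB')).
rewrite (markov_iter k mA G00 mG0) -/G.
rewrite integral_mkcond.
transitivity (\int[P]_w f (Y j w, Y j.+1 w))%E.
  apply: eq_integral => w _; rewrite /patch /f/=.
  rewrite -(ipre (pair j)) -/A indicE.
  by case: (w \in A); rewrite ?mul1e ?mul0e.
rewrite (markov_integral2 (i := j) measurableT f0 mf).
apply: (@stationary_integral j (fun y => \int[K y]_z f (y, z))%E).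
  by move=> u; exact: integral_ge0.
exact: measurable_Kint.
Qed.

Let mpair i : measurable_fun setT (pair i). Proof. exact: mY2. Qed.

Lemma L1_shift (h : U * U -> R) i j : measurable_fun setT h ->
  L1 P (fun w => h (pair i w)) -> L1 P (fun w => h (pair j w)).
Proof.
move=> mh Lh.
suff : L1 P (fun w => \1_setT w * h (pair j w)).
  by apply: eq_L1 => w; rewrite indicT mul1r.
apply: (@L1_eqlaw _ _ _ _ _ _ _ P P setT measurableT setT measurableT _
  (mpair i) _ (mpair j) _ h mh); last by apply: eq_L1 Lh => w; rewrite indicT mul1r.
move=> B mB; rewrite !setTI.
have H l := pair_stationary l 0 measurableT mB.
by move: (H i) (H j); rewrite !preimage_setT !setTI !addn0 => -> ->.
Qed.

Lemma E_shift2 (h : U * U -> R) i k (B : set (U * U)) : measurable B ->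
  measurable_fun setT h ->
  \int[P]_w (\1_B (Y i w, Y i.+1 w) * h (Y (i + k) w, Y (i + k).+1 w)) =
  \int[P]_w (\1_B (Y 0 w, Y 1 w) * h (Y k w, Y k.+1 w)).
Proof.
move=> mB mh.
have pre j : measurable (pair j @^-1` B) by exact: preimage_measurable.
have := @E_eqlaw _ _ _ _ _ _ _ P P (pair i @^-1` B) (pre i) (pair 0 @^-1` B)
  (pre 0%N) _ (mpair (i + k)) _ (mpair k) _ h mh.
move=> H; transitivity (\int[P]_w (\1_(pair i @^-1` B) w * h (Y (i + k) w, Y (i + k).+1 w))).
  by apply: eq_E => w; rewrite !indicE.
rewrite H; last by move=> B' mB'; exact: (pair_stationary).
by apply: eq_E => w; rewrite !indicE.
Qed.

Lemma E_shift (h : U * U -> R) i : measurable_fun setT h ->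
  \int[P]_w h (Y i w, Y i.+1 w) = \int[P]_w h (Y 0 w, Y 1 w).
Proof.
move=> mh; have := E_shift2 i 0 measurableT mh; rewrite addn0.
by under eq_E do rewrite indicT mul1r; under [in X in _ = X -> _]eq_E do rewrite indicT mul1r.
Qed.

Lemma ae_shift (N : set U) i : measurable N -> P (Y 0 @^-1` N) = 0%E ->
  {ae P, forall w, ~ N (Y i w)}.
Proof.
move=> mN N0; exists (Y i @^-1` N); split.
- by rewrite -[X in measurable X]setTI; exact: mY.
- by rewrite stationary.
- by move=> w /= /contrapT.
Qed.

(** Conditioning a function of (Y_i, Y_{i+1}) on the past of Y up to time i
    amounts to conditioning it on Y_i, and the result does not depend on i. *)
Lemma cexp_past (h : U * U -> R) (g : U -> R) i : measurable_fun setT h ->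
  cexp P (Y 0) (fun w => h (Y 0 w, Y 1 w)) g ->
  cexp P (fun w : T => (w : past i)) (fun w => h (Y i w, Y i.+1 w))
    (g \o Y i).
Proof.
move=> mh hg.
pose H y := \int[Kpair y]_u h u.
have mH : measurable_fun setT H by exact: (measurable_kernel_mean measurable_Kpair).
have Lh j : L1 P (fun w => h (pair j w)) by exact: L1_shift (ce_L1 hg).
have Lg j : L1 P (fun w => g (Y j w)).
  apply: (@L1_shift (g \o fst) 0) (ce_L1g hg) => //.
  exact: (measurableT_comp (ce_meas hg)).
have HE j (A : set (past j)) : measurable A ->
    L1 P (fun w => \1_A w * H (Y j w)) /\
    \int[P]_w (\1_A w * h (pair j w)) = \int[P]_w (\1_A w * H (Y j w)).
  move=> mA; apply: (@kernel_mean _ _ _ _ _ P (A : set T) (past_measurable mA)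
    (pair j) (mpair j) (fun w => Kpair (Y j w)) _ _ h mh (Lh j)) => C mC.
    exact: (measurableT_comp (measurable_Kpair mC) (mY j)).
  exact: markov_pair.
(* H (Y_j) is the conditional mean for every j; at j = 0 it agrees with
   g (Y_0), and then by stationarity at j = i. *)
have hH : cexp P (Y 0) (fun w => h (pair 0 w)) H.
  split => //.
    have [LH _] := HE 0%N setT measurableT.
    by apply: eq_L1 LH => w; rewrite indicT mul1r.
  move=> A mA; have mYA : measurable (Y 0 @^-1` A : set (past 0)).
    rewrite -[X in measurable X]setTI; exact: (measurable_past (leqnn 0)).
  have [_ E] := HE 0%N _ mYA.
  have iE w : \1_A (Y 0 w) = \1_(Y 0 @^-1` A) w :> R by rewrite !indicE.
  transitivity (\int[P]_w (\1_(Y 0 @^-1` A) w * h (pair 0 w))).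
    by apply: eq_E => w; rewrite iE.
  by rewrite E; apply: eq_E => w; rewrite iE.
pose N := [set y | g y - H y != 0].
have mN : measurable N.
  have -> : N = (fun y => g y - H y) @^-1` (~` [set 0]).
    by apply/seteqP; split => y /= /eqP.
  have mgH : measurable_fun setT (fun y => g y - H y).
    by apply: measurable_funB => //; exact: ce_meas hg.
  by rewrite -[X in measurable X]setTI; apply: mgH => //; exact: measurableC.
have N0 : P (Y 0 @^-1` N) = 0%E.
  apply/negligibleP; first exact: preimage_measurable.
  apply: negligibleS (cexp_uniq (mY 0) hg hH) => w /=.
  by rewrite /N/= subr_eq0 => /eqP.
have gH : {ae P, forall w, g (Y i w) = H (Y i w)}.
  apply: filterS (ae_shift i mN N0) => w /negP.
  by rewrite negbK subr_eq0 => /eqP.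
split => //; [|exact: Lg|].
  exact: (measurableT_comp (ce_meas hg) (measurable_past (leqnn i))).
move=> A mA; have mA' : measurable (A : set T) := past_measurable mA.
rewrite (HE i A mA).2; apply: E_ae.
- apply: measurable_funM; first exact: measurable_indic.
  exact: (measurableT_comp mH (mY i)).
- apply: measurable_funM; first exact: measurable_indic.
  exact: (measurableT_comp (ce_meas hg) (mY i)).
- by apply: filterS gH => w /= ->.
Qed.

(** Given Y_i, the past up to time i is independent of Y_{i+1}. *)
Lemma cexp_pair i (Z : T -> R) (b : U -> R) :
  measurable_fun setT (Z : past i -> R) -> cexp P (Y i) Z b ->
  cexp P (fun w => (Y i w, Y i.+1 w)) Z (b \o fst).
Proof.
move=> mZ hZ; have [a1 b1 c1 d1] := hZ.
split => //.
  exact: measurableT_comp.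
move=> B mB.
pose h : U * U -> R := \1_B.
have mh : measurable_fun setT h by exact: measurable_indic.
have Lh : L1 P (fun w => h (Y 0 w, Y 1 w)).
  apply: eq_L1 (indic_L1 (mY2 0%N 1%N) mB (L1_cst P 1)) => w.
  by rewrite mulr1.
have [g hg] := cexp_exists (mY 0%N) Lh.
have hi := cexp_past i mh hg.
have LZ : L1 P (fun w => Z w * h (Y i w, Y i.+1 w)).
  apply: eq_L1 (indic_L1 (mY2 i i.+1) mB a1) => w.
  by rewrite mulrC.
have LB : L1 P (fun w => b (Y i w) * h (Y i w, Y i.+1 w)).
  apply: eq_L1 (indic_L1 (mY2 i i.+1) mB c1) => w.
  by rewrite mulrC.
have e1 := cexp_pullout1 (@past_id i) mZ hi LZ.
have mb : measurable_fun setT (b \o Y i : past i -> R).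
  apply: measurableT_comp => //; exact: measurable_past.
have e2 := cexp_pullout1 (@past_id i) mb hi LB.
have mg := ce_meas hg.
have L3 : L1 P (fun w => g (Y i w) * Z w).
  by apply: eq_L1 (ce_L1g e1) => w; rewrite /= mulrC.
have e3 := cexp_pullout1 (mY i) mg hZ L3.
transitivity (\int[P]_w (Z w * h (Y i w, Y i.+1 w))).
  by apply: eq_E => w; rewrite mulrC.
rewrite (cexp_E e1) /=.
transitivity (\int[P]_w (g (Y i w) * Z w)).
  by apply: (@eq_E _ _ T P) => w; rewrite mulrC.
rewrite (cexp_E e3).
transitivity (\int[P]_w (b (Y i w) * h (Y i w, Y i.+1 w))); last first.
  by apply: eq_E => w; rewrite mulrC.
rewrite (cexp_E e2) /=.
by apply: (@eq_E _ _ T P) => w; rewrite mulrC.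
Qed.

(** * Martingale estimating functions *)

Section MartingaleEstimatingFunctions.
Variable M : nat.
Variable v : 'I_M -> U * U -> R.
Hypothesis mv : forall m, measurable_fun setT (v m).
Hypothesis v0 : forall m, cexp P (Y 0) (fun w => v m (pair 0 w)) (fun=> 0).
Variable Lam : 'I_M -> 'I_M -> U -> R.
Hypothesis vv : forall m k,
  cexp P (Y 0) (fun w => v m (pair 0 w) * v k (pair 0 w)) (Lam m k).

Lemma cexp_v_past i m :
  cexp P (fun w : T => (w : past i)) (fun w => v m (pair i w)) (fun=> 0).
Proof. exact: (cexp_past i (mv m) (v0 m)). Qed.

Lemma measurable_pair_past i j (h : U * U -> R) : (i < j)%N ->
  measurable_fun setT h -> measurable_fun setT (fun w : past j => h (pair i w)).
Proof.
move=> ij mh; apply: (measurableT_comp mh).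
by apply/measurable_fun_pairP; split; apply: measurable_past => //; exact: ltnW.
Qed.

(** The term W'v of an estimating function at the pair u of consecutive values,
    for a column W of a weighting matrix. *)
Definition wterm (W : 'I_M -> U -> R) (u : U * U) : R :=
  \sum_m W m u.1 * v m u.

Lemma measurable_wterm W : (forall m, measurable_fun setT (W m)) ->
  measurable_fun setT (wterm W).
Proof.
move=> mW; apply: measurable_sum => m; apply: measurable_funM => //.
exact: (measurableT_comp (mW m) measurable_fst).
Qed.

(** A past variable times a term of the estimating function has mean zero. *)
Lemma E_past_wterm W i (Z : past i -> R) :
  (forall m, measurable_fun setT (W m)) -> measurable_fun setT Z ->
  L1 P (fun w => Z w * wterm W (pair i w)) ->
  \int[P]_w (Z w * wterm W (pair i w)) = 0.
Proof.
move=> mW mZ LZ.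
have mYi := measurable_past (leqnn i).
have ma m : measurable_fun setT (fun w : past i => Z w * W m (Y i w)).
  by apply: measurable_funM => //; exact: (measurableT_comp (mW m) mYi).
have E w : Z w * wterm W (pair i w) =
    \sum_m (Z w * W m (Y i w)) * v m (pair i w).
  by rewrite mulr_sumr; apply: eq_bigr => m _; rewrite mulrA.
have LZ' : L1 P (fun w => \sum_m (Z w * W m (Y i w)) * v m (pair i w)).
  by apply: eq_L1 LZ => w; rewrite E.
have C := cexp_pullout (@past_id i) ma (fun m => cexp_v_past i m) LZ'.
rewrite (eq_E (W := fun w => _) P E) (cexp_E C).
rewrite -[RHS](E_cst P 0); apply: (@eq_E _ _ T P) => w.
by rewrite big1// => m _; rewrite mulr0.
Qed.

Section SquareIntegrable.
Variable W : 'I_M -> U -> R.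
Hypothesis mW : forall m, measurable_fun setT (W m).

Let past_sum n (w : past n) : R := \sum_(i < n) wterm W (pair i w).

Let measurable_past_sum n : measurable_fun setT (@past_sum n).
Proof.
apply: measurable_sum => i; apply: measurable_pair_past => //.
exact: measurable_wterm.
Qed.

(** If a sum of martingale differences is square integrable, then so are its
    terms.  The last term X and the sum S of the others satisfy
    E[X^2 ; A] <= E[(S + X)^2] on every past event A on which S and the
    weights are bounded. *)
Lemma wterm_L2 n : L1 P (fun w => (\sum_(i < n.+1) wterm W (pair i w)) ^+ 2) ->
  forall i, L1 P (fun w => wterm W (pair i w) ^+ 2).
Proof.
move=> LF i.
have mw := measurable_wterm mW.
have mw2 : measurable_fun setT (fun u => wterm W u ^+ 2) by exact: measurable_funX.
apply: (@L1_shift (fun u => wterm W u ^+ 2) 0 i mw2).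
apply: (@L1_shift (fun u => wterm W u ^+ 2) n 0 mw2).
pose X w := wterm W (pair n w).
pose Sn (w : past n) : R := past_sum w.
have mSn : measurable_fun setT Sn := @measurable_past_sum n.
have mYn := measurable_past (leqnn n).
pose b (w : past n) : R := `|Sn w| + \sum_m `|W m (Y n w)|.
have mb : measurable_fun setT b.
  apply: measurable_funD; first exact: measurableT_comp.
  apply: measurable_sum => m.
  have mWm : measurable_fun setT (fun w : past n => W m (Y n w)).
    exact: (measurableT_comp (mW m) mYn).
  exact: measurableT_comp mWm.
pose A k : set (past n) := [set w | b w <= k%:R].
have mA k : measurable (A k).
  rewrite (_ : A k = b @^-1` `]-oo, k%:R]); last first.
    by apply/seteqP; split => w /=; rewrite in_itv/=.
  by rewrite -[X in measurable X]setTI; exact: mb.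
have mA' k : measurable (A k : set T) by exact: past_measurable (mA k).
have mX : measurable_fun setT X by exact: (measurableT_comp mw (mpair n)).
have mSnT : measurable_fun setT (Sn : T -> R) by exact: (measurableT_comp mSn (@past_id n)).
have bS k w : \1_(A k) w * `|Sn w| <= k%:R.
  rewrite indicE; case: (boolP (w \in A k)) => [/set_mem/= h|_]; last by rewrite mul0r.
  by rewrite mul1r (le_trans _ h)// /b lerDl sumr_ge0.
have bW k w m : \1_(A k) w * `|W m (Y n w)| <= k%:R.
  rewrite indicE; case: (boolP (w \in A k)) => [/set_mem/= h|_]; last by rewrite mul0r.
  rewrite mul1r (le_trans _ h)// /b (bigD1 m)//= addrCA lerDl addr_ge0// sumr_ge0//.
have ii k w : \1_(A k) w * \1_(A k) w = \1_(A k) w :> R.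
  by rewrite indicE -natrM mulnb andbb.
have i0 k w : `|\1_(A k) w : R| = \1_(A k) w by rewrite ger0_norm.
have mWY m : measurable_fun setT (fun w => W m (Y n w)).
  exact: (measurableT_comp (mW m) (mY n)).
have Lv m : L1 P (fun w => v m (pair n w)).
  exact: (L1_shift n (mv m) (ce_L1 (v0 m))).
have Lvv m k : L1 P (fun w => v m (pair n w) * v k (pair n w)).
  apply: (L1_shift (h := fun u => v m u * v k u) (i := 0) n) (ce_L1 (vv m k)).
  exact: measurable_funM.
have LX2 k : L1 P (fun w => \1_(A k) w * X w ^+ 2).
  have L1s : L1 P (fun w => \sum_m \sum_l
      (\1_(A k) w * W m (Y n w) * (\1_(A k) w * W l (Y n w))) *
      (v m (pair n w) * v l (pair n w))).
    apply: L1_sum => m _; apply: L1_sum => l _.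
    apply: (@L1_bdd _ _ _ _ _ _ (k%:R * k%:R)) => //.
      by apply: measurable_funM; apply: measurable_funM => //; exact: measurable_indic.
    by move=> w; rewrite !normrM !i0; apply: ler_pM; rewrite ?mulr_ge0//.
  apply: eq_L1 L1s => w; rewrite /X /wterm expr2 big_distrlr/= mulr_sumr.
  apply: eq_bigr => m _; rewrite mulr_sumr; apply: eq_bigr => l _.
  rewrite -[in RHS](ii k w); ring.
have LS2 k : L1 P (fun w => \1_(A k) w * Sn w ^+ 2).
  apply: (L1_le (W := fun=> k%:R * k%:R)); last exact: L1_cst.
    by apply: measurable_funM; [exact: measurable_indic|exact: measurable_funX].
  move=> w; rewrite normrM normrX i0 -(ii k w) expr2 mulrACA.
  by apply: ler_pM; rewrite ?mulr_ge0//.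
have LSX k : L1 P (fun w => (\1_(A k) w * Sn w) * X w).
  have L1s : L1 P (fun w => \sum_m
      ((\1_(A k) w * Sn w) * (\1_(A k) w * W m (Y n w))) * v m (pair n w)).
    apply: L1_sum => m _.
    apply: (@L1_bdd _ _ _ _ _ _ (k%:R * k%:R)) => //.
      by apply: measurable_funM; apply: measurable_funM => //; exact: measurable_indic.
    by move=> w; rewrite !normrM !i0; apply: ler_pM; rewrite ?mulr_ge0//.
  apply: eq_L1 L1s => w; rewrite /X /wterm [RHS]mulr_sumr; apply: eq_bigr => m _.
  rewrite -[in RHS](ii k w); ring.
have ESX k : \int[P]_w ((\1_(A k) w * Sn w) * X w) = 0.
  apply: (E_past_wterm (Z := fun w : past n => \1_(A k) w * Sn w) mW _ (LSX k)).
  by apply: measurable_funM => //; exact: measurable_indic.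
apply: (@L1_truncation _ _ _ P _ (fun k => A k : set T)
  (\int[P]_w ((\sum_(i < n.+1) wterm W (pair i w)) ^+ 2))) => //.
- exact: measurable_funX.
- by move=> w; exact: sqr_ge0.
- by move=> k w /= h; rewrite /A/= (le_trans h)// ler_nat.
- apply: nearW => w; exists (Num.truncn (b w)).+1.
  by rewrite /A/=; apply/ltW/truncnS_gt.
- move=> k.
  have ZE w : \1_(A k) w * (\sum_(i < n.+1) wterm W (pair i w)) ^+ 2 =
     \1_(A k) w * Sn w ^+ 2 + 2 * ((\1_(A k) w * Sn w) * X w) + \1_(A k) w * X w ^+ 2.
    have -> : \sum_(i < n.+1) wterm W (pair i w) = Sn w + X w by rewrite big_ord_recr.
    by ring.
  have LZ : L1 P (fun w => \1_(A k) w * (\sum_(i < n.+1) wterm W (pair i w)) ^+ 2).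
    apply: (@L1_bdd _ _ _ _ _ _ 1) => //.
    by move=> w; rewrite i0 indicE lern1 leq_b1.
  have EZk : \int[P]_w (\1_(A k) w * (\sum_(i < n.+1) wterm W (pair i w)) ^+ 2) =
     \int[P]_w (\1_(A k) w * Sn w ^+ 2) + \int[P]_w (\1_(A k) w * X w ^+ 2).
    under eq_E do rewrite ZE.
    rewrite (ED (L1D (LS2 k) (L1Z 2 (LSX k))) (LX2 k)) (ED (LS2 k) (L1Z 2 (LSX k))).
    by rewrite (EZ _ (LSX k)) ESX mulr0 addr0.
  apply: (@le_trans _ _ (\int[P]_w (\1_(A k) w * (\sum_(i < n.+1) wterm W (pair i w)) ^+ 2))).
    by rewrite EZk lerDr; apply: Rintegral_ge0 => w _; rewrite mulr_ge0// sqr_ge0.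
  by apply: E_le => // w; rewrite ler_piMl ?sqr_ge0// indicE lern1 leq_b1.
Qed.

End SquareIntegrable.
(** Second moments of two estimating functions of this kind: cross terms vanish
    and the diagonal terms are all alike. *)
Lemma E_wsum_wsum (W W' : 'I_M -> U -> R) n :
  (forall m, measurable_fun setT (W m)) -> (forall m, measurable_fun setT (W' m)) ->
  L1 P (fun w => (\sum_(i < n.+1) wterm W (pair i w)) ^+ 2) ->
  L1 P (fun w => (\sum_(i < n.+1) wterm W' (pair i w)) ^+ 2) ->
  L1 P (fun w => \sum_m \sum_k W m (Y 0 w) * W' k (Y 0 w) * Lam m k (Y 0 w)) /\
  \int[P]_w ((\sum_(i < n.+1) wterm W (pair i w)) *
             (\sum_(i < n.+1) wterm W' (pair i w))) =
  n.+1%:R * \int[P]_w (\sum_m \sum_k W m (Y 0 w) * W' k (Y 0 w) * Lam m k (Y 0 w)).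
Proof.
move=> mW mW' LF LF'.
have mw := measurable_wterm mW; have mw' := measurable_wterm mW'.
have L2 := wterm_L2 mW LF; have L2' := wterm_L2 mW' LF'.
have mX i : measurable_fun setT (fun w => wterm W (pair i w)).
  exact: (measurableT_comp mw (mpair i)).
have mX' i : measurable_fun setT (fun w => wterm W' (pair i w)).
  exact: (measurableT_comp mw' (mpair i)).
have LXX i j : L1 P (fun w => wterm W (pair i w) * wterm W' (pair j w)).
  exact: L1_mul (mX i) (mX' j) (L2 i) (L2' j).
have L0 : L1 P (fun w => \sum_(z : 'I_M * 'I_M)
    (W z.1 (Y 0 w) * W' z.2 (Y 0 w)) * (v z.1 (pair 0 w) * v z.2 (pair 0 w))).
  apply: eq_L1 (LXX 0%N 0%N) => w; rewrite /wterm big_distrlr/= pair_bigA/=.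
  by apply: eq_bigr => z _; rewrite mulrACA.
have ma (z : 'I_M * 'I_M) : measurable_fun setT (fun u => W z.1 u * W' z.2 u).
  exact: measurable_funM.
have C := cexp_pullout (mY 0%N) ma (fun z => vv z.1 z.2) L0.
split.
  apply: eq_L1 (ce_L1g C) => w; rewrite /= pair_bigA/=.
  by apply: eq_bigr => z _.
have E0 : \int[P]_w (wterm W (pair 0 w) * wterm W' (pair 0 w)) =
   \int[P]_w (\sum_m \sum_k W m (Y 0 w) * W' k (Y 0 w) * Lam m k (Y 0 w)).
  transitivity (\int[P]_w (\sum_(z : 'I_M * 'I_M)
    (W z.1 (Y 0 w) * W' z.2 (Y 0 w)) * (v z.1 (pair 0 w) * v z.2 (pair 0 w)))).
    apply: eq_E => w; rewrite /wterm big_distrlr/= pair_bigA/=.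
    by apply: eq_bigr => z _; rewrite mulrACA.
  rewrite (cexp_E C); apply: eq_E => w; rewrite pair_bigA/=.
  by apply: eq_bigr.
transitivity (\int[P]_w (\sum_(i < n.+1) \sum_(j < n.+1)
    wterm W (pair i w) * wterm W' (pair j w))).
  by apply: eq_E => w; rewrite big_distrlr.
rewrite E_sum; last by move=> i _; apply: L1_sum => j _; exact: LXX.
rewrite (eq_bigr (fun=> \int[P]_w (wterm W (pair 0 w) * wterm W' (pair 0 w)))).
  by rewrite sumr_const card_ord E0 -[LHS]mulr_natl.
move=> i _; rewrite E_sum; last by move=> j _; exact: LXX.
rewrite (bigD1 i)//= big1 ?addr0.
  rewrite (E_shift (h := fun u => wterm W u * wterm W' u))//.
  exact: measurable_funM.
move=> j ji; have [ij|ij|ij] := ltngtP i j.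
- have := LXX i j; have := measurable_pair_past (h := wterm W) ij mw.
  exact: E_past_wterm.
- have mp := measurable_pair_past (h := wterm W') ij mw'.
  have LL : L1 P (fun w => wterm W' (pair j w) * wterm W (pair i w)).
    by apply: eq_L1 (LXX i j) => w; rewrite mulrC.
  rewrite -(E_past_wterm mW mp LL); apply: (@eq_E _ _ T P) => w.
  by rewrite mulrC.
- by move: ji; rewrite (val_inj ij) eqxx.
Qed.

(** Here f stands for a component of f1, F1 for the sum of its values along the
    data, and ft for the corresponding component of f~1. *)
Section CrossMoment.
Variables (f : U * U -> R) (mf : measurable_fun setT f).
Hypothesis Lf : L1 P (fun w => f (pair 0 w)).
Variable n : nat.
Variables (ft : U * U -> R) (Vf : 'I_M -> U -> R).
Hypothesis ftE : cexp P (pair 0)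
  (fun w => \sum_(j < n) (n - j)%:R * f (pair j w)) ft.
Hypothesis VfE : forall m,
  cexp P (Y 0) (fun w => v m (pair 0 w) * ft (pair 0 w)) (Vf m).

Let F1 w := \sum_(j < n) f (pair j w).

Let Lfj j : L1 P (fun w => f (pair j w)).
Proof. exact: (L1_shift j mf Lf). Qed.

Let LF1 : L1 P F1. Proof. by apply: L1_sum. Qed.

Let Fp i w := \sum_(j < n | (j < i)%N) f (pair j w).

(** The conditional means of the sum of the f given the pairs (Y_i, Y_{i+1}),
    carried over to (Y_0, Y_1) and summed over i, give ft up to a function of
    Y_0. The latter comes from the values of f before time i. *)
Let decompose : exists2 h : nat -> U * U -> R,
  (forall i, cexp P (pair i) F1 (h i)) &
  exists2 b : U -> R, measurable_fun setT b &
   {ae P, forall w, \sum_(i < n) h i (pair 0 w) = b (Y 0 w) + ft (pair 0 w)}.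
Proof.
have /choice[h Hh] : forall i, exists g, cexp P (pair i) F1 g.
  by move=> i; exact: cexp_exists.
have LFp i : L1 P (Fp i) by apply: L1_sum.
have /choice[b Hb] : forall i, exists g, cexp P (Y i) (Fp i) g.
  by move=> i; exact: cexp_exists.
exists h => //; exists (fun y => \sum_(i < n) b i y).
  by apply: measurable_sum => i; exact: ce_meas (Hb i).
have Lb i : L1 P (fun w => b i (Y 0 w)).
  apply: (L1_shift (i := i) (h := b i \o fst) 0).
    exact: (measurableT_comp (ce_meas (Hb i)) measurable_fst).
  exact: ce_L1g (Hb i).
have Lh i : L1 P (fun w => h i (pair 0 w)).
  apply: (L1_shift (i := i) 0); first exact: ce_meas (Hh i).
  exact: ce_L1g (Hh i).
have Hbp i : cexp P (pair i) (Fp i) (b i \o fst).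
  apply: (cexp_pair) => //.
  rewrite (_ : Fp i = (fun w => \sum_(j < n) if (j < i)%N then f (pair j w) else 0)); last first.
    by apply/funext => w; exact: big_mkcond.
  apply: measurable_sum => j; case: (boolP (j < i)%N) => ji; last exact: measurable_cst.
  exact: (measurable_pair_past ji mf).
pose D (u : U * U) := \sum_(i < n) h i u - (\sum_(i < n) b i u.1 + ft u).
have mD : measurable_fun setT D.
  apply: measurable_funB; first by apply: measurable_sum => i; exact: ce_meas (Hh i).
  apply: measurable_funD; last exact: ce_meas ftE.
  apply: measurable_sum => i.
  exact: (measurableT_comp (ce_meas (Hb i)) measurable_fst).
have Lsh : L1 P (fun w => \sum_(i < n) h i (pair 0 w)) by apply: L1_sum.
have Lsb : L1 P (fun w => \sum_(i < n) b i (Y 0 w)) by apply: L1_sum.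
have Lft := ce_L1g ftE.
have LD : L1 P (D \o pair 0) by exact: L1B Lsh (L1D Lsb Lft).
suff : {ae P, forall w, D (pair 0 w) = 0}.
  by apply: filterS => w /eqP; rewrite subr_eq0 => /eqP.
apply: (mean0_ae (mpair 0) mD LD) => B mB.
have IL Z : L1 P Z -> L1 P (fun w => \1_B (pair 0 w) * Z w) by exact: indic_L1.
have IS (Z : 'I_n -> T -> R) : (forall i, L1 P (Z i)) ->
   \int[P]_w (\1_B (pair 0 w) * \sum_(i < n) Z i w) =
   \sum_(i < n) \int[P]_w (\1_B (pair 0 w) * Z i w).
  move=> LZ; rewrite -E_sum; last by move=> i _; exact: IL.
  by apply: eq_E => w; rewrite mulr_sumr.
under eq_E do rewrite mulrBr mulrDr.
rewrite (EB (IL _ Lsh) (L1D (IL _ Lsb) (IL _ Lft))) (ED (IL _ Lsb) (IL _ Lft)).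
apply/eqP; rewrite subr_eq0; apply/eqP.
rewrite (IS (fun i w => h i (pair 0 w)))// (IS (fun i w => b i (Y 0 w)))//.
rewrite -(ce_eq ftE mB) (IS (fun j w => (n - j)%:R * f (pair j w))); last first.
  by move=> j; apply: L1Z.
pose phi k := \int[P]_w (\1_B (pair 0 w) * f (pair k w)).
have key i : \int[P]_w (\1_B (pair 0 w) * h i (pair 0 w)) =
   \int[P]_w (\1_B (pair 0 w) * b i (Y 0 w)) + \sum_(j < n | (i <= j)%N) phi (j - i)%N.
  have ILi Z : L1 P Z -> L1 P (fun w => \1_B (pair i w) * Z w).
    by apply: indic_L1 => //; exact: mpair.
  have s1 := E_shift2 i 0 mB (ce_meas (Hh i)).
  rewrite !addn0 in s1; rewrite -s1 -(ce_eq (Hh i) mB).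
  have mbf : measurable_fun setT (b i \o fst : U * U -> R).
    exact: (measurableT_comp (ce_meas (Hb i)) measurable_fst).
  have s2 := E_shift2 i 0 mB mbf.
  rewrite !addn0/= in s2; rewrite -s2 -(ce_eq (Hbp i) mB).
  have LFf : L1 P (fun w => \sum_(j < n | (i <= j)%N) f (pair j w)) by apply: L1_sum.
  transitivity (\int[P]_w (\1_B (pair i w) * Fp i w +
     \1_B (pair i w) * \sum_(j < n | (i <= j)%N) f (pair j w))).
    apply: eq_E => w; rewrite -mulrDr /F1 /Fp (bigID (fun j : 'I_n => (j < i)%N))/=.
    by under [in X in _ + X]eq_bigl do rewrite -leqNgt.
  rewrite (ED (ILi _ (LFp i)) (ILi _ LFf)); congr (_ + _).
  transitivity (\int[P]_w (\sum_(j < n | (i <= j)%N) \1_B (pair i w) * f (pair j w))).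
    by apply: eq_E => w; rewrite mulr_sumr.
  rewrite E_sum; last by move=> j _; exact: ILi.
  apply: eq_bigr => j ij; rewrite /phi -(E_shift2 i (j - i) mB mf).
  by rewrite subnKC.
under eq_bigr do rewrite key.
rewrite big_split/=; congr (_ + _).
transitivity (\sum_(j < n) (n - j)%:R * phi j); last first.
  apply: eq_bigr => j _; rewrite /phi -EZ; last exact: IL.
  by apply: eq_E => w; rewrite mulrCA.
exact: sum_lags.
Qed.

Variable W : 'I_M -> U -> R.
Hypothesis mW : forall m, measurable_fun setT (W m).
Hypothesis LX : forall i, L1 P (fun w => wterm W (pair i w) ^+ 2).
Hypothesis LF2 : L1 P (fun w => F1 w ^+ 2).

(** As v has conditional mean 0 given Y_0, the function b in the decomposition
    does not contribute. *)
Lemma E_fsum_wsum :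
  L1 P (fun w => \sum_m W m (Y 0 w) * Vf m (Y 0 w)) /\
  \int[P]_w (F1 w * \sum_(i < n) wterm W (pair i w)) =
  \int[P]_w (\sum_m W m (Y 0 w) * Vf m (Y 0 w)).
Proof.
have [h Hh [b mb hb]] := decompose.
have mw := measurable_wterm mW.
have mF1 := L1_meas LF1.
have mX i : measurable_fun setT (fun w => wterm W (pair i w)).
  exact: (measurableT_comp mw (mpair i)).
have LXF i : L1 P (fun w => wterm W (pair i w) * F1 w).
  exact: L1_mul (mX i) mF1 (LX i) LF2.
have C i := cexp_pullout1 (mpair i) mw (Hh i) (LXF i).
have mwh i : measurable_fun setT (fun u => wterm W u * h i u).
  apply: measurable_funM => //; exact: ce_meas (Hh i).
have Lwh i : L1 P (fun w => wterm W (pair 0 w) * h i (pair 0 w)).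
  apply: (L1_shift (i := i) 0 (mwh i)).
  exact: ce_L1g (C i).
pose Z w := wterm W (pair 0 w) * \sum_(i < n) h i (pair 0 w).
have LZ : L1 P Z.
  apply: (@eq_L1 _ _ _ P (fun w => \sum_(i < n) wterm W (pair 0 w) * h i (pair 0 w))).
    by move=> w; rewrite /Z mulr_sumr.
  by apply: L1_sum => i _; exact: Lwh.
have EZ0 : \int[P]_w (F1 w * \sum_(i < n) wterm W (pair i w)) = \int[P]_w Z w.
  transitivity (\int[P]_w (\sum_(i < n) wterm W (pair i w) * F1 w)).
    by apply: eq_E => w; rewrite mulrC mulr_suml.
  rewrite E_sum//.
  transitivity (\sum_(i < n) \int[P]_w (wterm W (pair 0 w) * h i (pair 0 w))).
    apply: eq_bigr => i _; rewrite (cexp_E (C i)).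
    exact: (E_shift i (mwh i)).
  rewrite -E_sum//; apply: eq_E => w; by rewrite /Z mulr_sumr.
pose a (z : 'I_M + 'I_M) (y : U) : R :=
  match z with inl m => W m y * b y | inr m => W m y end.
pose A (z : 'I_M + 'I_M) (w : T) : R :=
  match z with inl m => v m (pair 0 w) | inr m => v m (pair 0 w) * ft (pair 0 w) end.
pose g (z : 'I_M + 'I_M) (y : U) : R :=
  match z with inl m => 0 | inr m => Vf m y end.
have ma z : measurable_fun setT (a z).
  by case: z => m; [exact: measurable_funM|exact: mW].
have cg z : cexp P (Y 0) (A z) (g z).
  by case: z => m; [exact: v0|exact: VfE].
pose Z' w := \sum_z a z (Y 0 w) * A z w.
have Z'E w : Z' w = wterm W (pair 0 w) * (b (Y 0 w) + ft (pair 0 w)).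
  rewrite /Z' big_sumType/= /wterm mulrDr !mulr_suml; congr (_ + _);
  by apply: eq_bigr => m _ /=; ring.
have ZZ' : {ae P, forall w, Z w = Z' w}.
  by apply: filterS hb => w hw; rewrite Z'E /Z hw.
have mZ' : measurable_fun setT Z'.
  apply: measurable_sum => z; apply: measurable_funM.
    exact: (measurableT_comp (ma z) (mY 0%N)).
  exact: L1_meas (ce_L1 (cg z)).
have LZ' : L1 P Z' := L1_ae mZ' ZZ' LZ.
have C' := cexp_pullout (mY 0%N) ma cg LZ'.
have gE w : \sum_z a z (Y 0 w) * g z (Y 0 w) = \sum_m W m (Y 0 w) * Vf m (Y 0 w).
  rewrite big_sumType/= [X in X + _]big1 ?add0r// => m _.
  by rewrite mulr0.
split; first by apply: eq_L1 (ce_L1g C') => w /=; rewrite gE.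
rewrite EZ0 (E_ae (L1_meas LZ) mZ' ZZ') (cexp_E C').
by apply: eq_E => w; rewrite gE.
Qed.

End CrossMoment.
End MartingaleEstimatingFunctions.

(** * The mean derivative of an estimating function *)

(** D is a set in which Y stays almost surely; the weights w and the functions v depend
    on a parameter in the open set Th, and x is its true value. *)
Section DerivativeOfEstimatingFunction.
Variables (D : set U) (mD : measurable D).
Hypothesis YD : forall i, {ae P, forall w, D (Y i w)}.

Context (E : normedModType R).
Variables (Th : set E) (oTh : open Th) (x e : E) (Thx : Th x).
Variables (M n : nat) (w : 'I_M -> U -> E -> R) (v : 'I_M -> U * U -> E -> R).
Hypothesis mw : forall m t, Th t -> measurable_fun D (fun y => w m y t).
Hypothesis mv : forall m t, Th t -> measurable_fun (D `*` D) (fun u => v m u t).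
Hypothesis dv : forall m u, (D `*` D) u -> derivable (v m u) x e.

Let g (u : U * U) (t : E) : R := \sum_m w m u.1 t * v m u t.

Hypothesis dF : forall y : nat -> U, (forall i, D (y i)) ->
  derivable (fun t => \sum_(i < n.+1) g (y i, y i.+1) t) x e.
Hypothesis span : forall a, D a -> exists b : 'I_M -> U,
  (forall k, D (b k)) /\ \matrix_(k, m) v m (a, b k) x \in unitmx.

(* In the data (a, ..., a, b) all terms but the last are equal to g (a, a),
   which is found from the constant data. *)
Let dg a b : D a -> D b -> derivable (g (a, b)) x e.
Proof.
move=> Da Db.
pose y i := if (i <= n)%N then a else b.
have dy : derivable (fun t => \sum_(i < n.+1) g (y i, y i.+1) t) x e.
  by apply: dF => i; rewrite /y; case: ifP.
have dc := dF (y := fun=> a) (fun=> Da).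
rewrite (_ : g (a, b) = (fun t => \sum_(i < n.+1) g (y i, y i.+1) t) -
    cst (n%:R / n.+1%:R) * (fun t => \sum_(i < n.+1) g (a, a) t)).
  apply: (derivableB dy); apply: derivableM; [exact: derivable_cst|exact: dc].
apply/funext => t; rewrite -[RHS]/(_ - _ * _) big_ord_recr/=.
rewrite sumr_const card_ord (_ : \sum_(i < n) _ = g (a, a) t *+ n); last first.
  rewrite (eq_bigr (fun=> g (a, a) t)) ?sumr_const ?card_ord// => i _.
  by rewrite /y (ltnW (ltn_ord i)) ltn_ord.
rewrite /y leqnn ltnn -[g (a, a) t *+ n.+1]mulr_natr.
rewrite [X in X - _]addrC -addrA -[g (a, a) t *+ n]mulr_natr.
rewrite [n%:R / _ * _]mulrC -mulrA [n.+1%:R * _]mulrC divfK ?pnatr_eq0//.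
by rewrite subrr addr0.
Qed.

(** The weights at a are the coefficients of a linear form that is known at M
    independent vectors v (a, b). *)
Lemma derivable_weight m a : D a -> derivable (w m a) x e.
Proof.
move=> Da; have [b [Db ub]] := span Da.
apply: (@derivable_coefficients _ _ _ (fun m => w m a)
  (fun t => \matrix_(k, m) v m (a, b k) t)) => // [k l|k].
  rewrite (_ : (fun t => _) = v l (a, b k)); first by apply: dv; split => //=; exact: Db.
  by apply/funext => t; rewrite mxE.
rewrite (_ : (fun t => _) = g (a, b k)); first exact: dg.
by apply/funext => t; apply: eq_bigr => l _; rewrite mxE.
Qed.

Let deriveg u : (D `*` D) u -> 'D_e (g u) x =
  \sum_m (w m u.1 x * 'D_e (v m u) x + 'D_e (w m u.1) x * v m u x).
Proof.
move=> Du; apply: derive_dot => m; last exact: dv.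
by apply: derivable_weight; case: Du.
Qed.

Variables (W Edv : 'I_M -> U -> R).
Hypothesis mW : forall m, measurable_fun setT (W m).
Hypothesis WE : forall m y, D y -> W m y = w m y x.
Hypothesis v0 : forall m, cexp P (Y 0) (fun o => v m (pair 0 o) x) (fun=> 0).
Hypothesis dvE : forall m,
  cexp P (Y 0) (fun o => 'D_e (v m (pair 0 o)) x) (Edv m).
Hypothesis Lg : forall i, (i < n.+1)%N ->
  L1 P (fun o => 'D_e (g (pair i o)) x).
Hypothesis LF : L1 P
  (fun o => 'D_e (fun t => \sum_(i < n.+1) g (pair i o) t) x).

Let mg t : Th t -> measurable_fun (D `*` D) (fun u => g u t).
Proof.
move=> Tt; apply: measurable_sum => m; apply: measurable_funM; last exact: mv.
apply: (@measurable_comp _ _ _ _ _ _ D (fun y => w m y t) (D `*` D) fst mD).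
- by move=> _ [u [Du _] <-].
- exact: mw.
- by apply: measurable_funTS; exact: measurable_fst.
Qed.

Let H := (fun u => 'D_e (g u) x) \_ (D `*` D).

Let mDD : measurable (D `*` D). Proof. exact: measurableX. Qed.

Let mH : measurable_fun setT H.
Proof.
apply: (measurable_restrictT _ mDD).1; apply: (measurable_derive mDD oTh Thx).
  exact: mg.
by move=> [a b] [/= Da Db]; exact: dg.
Qed.

Let dW m := (fun y => 'D_e (w m y) x) \_ D.

Let mdW m : measurable_fun setT (dW m).
Proof.
apply: (measurable_restrictT _ mD).1; apply: (measurable_derive mD oTh Thx).
  by move=> t; exact: mw.
by move=> a; exact: derivable_weight.
Qed.

(** The conditional means of the V being zero, the derivative of the weights
    does not contribute to the mean derivative. *)
Lemma E_derive_wsum :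
  L1 P (fun o => \sum_m W m (Y 0 o) * Edv m (Y 0 o)) /\
  \int[P]_o 'D_e (fun t => \sum_(i < n.+1) g (pair i o) t) x =
  n.+1%:R * \int[P]_o (\sum_m W m (Y 0 o) * Edv m (Y 0 o)).
Proof.
have HE i : (i < n.+1)%N -> L1 P (fun o => H (pair i o)) /\
    \int[P]_o 'D_e (g (pair i o)) x = \int[P]_o H (pair i o).
  move=> ni.
  have mHi : measurable_fun setT (fun o => H (pair i o)).
    by apply: (measurableT_comp mH); apply/measurable_fun_pairP; split; exact: mY.
  have h : {ae P, forall o, 'D_e (g (pair i o)) x = H (pair i o)}.
    apply: filterS2 (YD i) (YD i.+1) => o a b.
    by rewrite /H patchE mem_set.
  split; first exact: (L1_ae mHi h (Lg ni)).
  by apply: E_ae => //; exact: L1_meas (Lg ni).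
have [LH0 EH0] := HE 0%N (ltn0Sn n).
pose a (i : 'I_M + 'I_M) := match i with inl m => W m | inr m => dW m end.
pose Z (i : 'I_M + 'I_M) o := match i with
  inl m => 'D_e (v m (pair 0 o)) x | inr m => v m (pair 0 o) x end.
pose z (i : 'I_M + 'I_M) := match i with inl m => Edv m | inr m => fun=> 0 end.
have ma i : measurable_fun setT (a i) by case: i.
have hZ i : cexp P (Y 0) (Z i) (z i) by case: i.
have ZE : {ae P, forall o, H (pair 0 o) = \sum_i a i (Y 0 o) * Z i o}.
  apply: filterS2 (YD 0) (YD 1) => o Da Db.
  rewrite /H patchE mem_set// deriveg// big_sumType/= -big_split/=.
  by apply: eq_bigr => m _; rewrite WE// /dW patchE mem_set.
have mZ : measurable_fun setT (fun o => \sum_i a i (Y 0 o) * Z i o).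
  apply: measurable_sum => i; apply: measurable_funM; last exact: L1_meas (ce_L1 (hZ i)).
  exact: (measurableT_comp (ma i)).
have LZ := L1_ae mZ ZE LH0.
have hc := cexp_pullout (mY 0) ma hZ LZ.
have cE y : \sum_i a i y * z i y = \sum_m W m y * Edv m y.
  rewrite big_sumType/= [X in _ + X]big1 ?addr0// => m _.
  by rewrite mulr0.
split; first by apply: eq_L1 (ce_L1g hc) => o; rewrite /= cE.
transitivity (\int[P]_o (\sum_(i < n.+1) H (pair i o))).
  apply: E_ae; first exact: L1_meas LF.
    by apply: measurable_sum => i; exact: L1_meas (HE i (ltn_ord i)).1.
  have YDall : {ae P, forall o, forall i, D (Y i o)} by exact: ae_foralln.
  apply: filterS YDall => o Do.
  have dgi (i : 'I_n.+1) : derivable (g (pair i o)) x e by exact: dg.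
  rewrite (_ : (fun t => _) = \sum_(i < n.+1) g (pair i o)); last first.
    by apply/funext => t; rewrite fct_sumE.
  rewrite derive_sum//; apply: eq_bigr => i _.
  by rewrite /H patchE mem_set//; split => /=; exact: Do.
rewrite E_sum; last by move=> i _; exact: (HE i (ltn_ord i)).1.
transitivity (\sum_(i < n.+1) \int[P]_o H (pair 0 o)).
  apply: eq_bigr => i _; exact: (E_shift i mH).
rewrite sumr_const card_ord mulr_natl; congr (_ *+ _).
transitivity (\int[P]_o (\sum_i a i (Y 0 o) * Z i o)).
  by apply: E_ae => //; exact: L1_meas LH0.
by rewrite (cexp_E hc); apply: eq_E => o; rewrite cE.
Qed.

End DerivativeOfEstimatingFunction.

End MarkovChain.

(** * The stationary diffusion *)

Section SubordinateDiffusion.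
Context (R : realType) (p1 p2 : nat) (d : measure_display)
        (Omega : measurableType d) (S : model R p1 p2 Omega).
Variables (th1 : 'cV[R]_p1) (th2 : 'cV[R]_p2).
Hypothesis HS : subordinate_diffusion S.
Hypotheses (Hth1 : Theta1 S th1) (Hth2 : Theta2 S th2).
Local Notation P := (prob S th1 th2).
Local Notation mu := (@lebesgue_measure R).
Local Notation q := (statdens S th1).
Local Notation RT := (measurableTypeR R).
Local Notation Xt t := (X S t : Omega -> RT).

Let HD : diffusion S th1 th2. Proof. exact: sd_diffusion. Qed.
Let HP : purely_discrete_spectrum S th1. Proof. exact: sd_spectrum. Qed.

Lemma innerE : inner S = [set x | (lend S < x%:E)%E] `&` [set x | (x%:E < rend S)%E].
Proof. by apply/seteqP; split => x; rewrite /inner/= => /andP. Qed.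

Lemma open_inner : open (inner S).
Proof.
rewrite innerE; apply: openI.
  case: (lend S) => [l| |].
  - rewrite (_ : [set x | _] = [set x | l < x]); first exact: open_gt.
    by apply/seteqP; split => x /=; rewrite lte_fin.
  - rewrite (_ : [set x | _] = set0); first exact: open0.
    by apply/seteqP; split => x.
  - rewrite (_ : [set x | _] = setT); first exact: openT.
    by apply/seteqP; split => x //= _; exact: ltNyr.
case: (rend S) => [l| |].
- rewrite (_ : [set x | _] = [set x | x < l]); first exact: open_lt.
  by apply/seteqP; split => x /=; rewrite lte_fin.
- rewrite (_ : [set x | _] = setT); first exact: openT.
  by apply/seteqP; split => x //= _; exact: ltry.
- rewrite (_ : [set x | _] = set0); first exact: open0.
  by apply/seteqP; split => x.
Qed.

Lemma measurable_inner : measurable (inner S).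
Proof. exact: open_measurable open_inner. Qed.

Lemma inner_itv a b x : inner S a -> inner S b -> a <= x <= b -> inner S x.
Proof.
move=> /andP[la _] /andP[_ br] /andP[ax xb]; apply/andP; split.
  by apply: (lt_le_trans la); rewrite lee_fin.
by apply: le_lt_trans br; rewrite lee_fin.
Qed.

Lemma inner_ex_lt x : inner S x -> exists2 a, inner S a & a < x.
Proof.
move=> xS; have := open_inner; rewrite openE => /(_ x xS).
move=> [e /= e0 he]; exists (x - e / 2); last by rewrite ltrBlDr ltrDl divr_gt0.
apply: he; rewrite /ball_/= opprB addrCA subrr addr0 gtr0_norm ?divr_gt0//.
by rewrite ltr_pdivrMr// ltr_pMr// ltr1n.
Qed.

Lemma inner_ex_gt x : inner S x -> exists2 b, inner S b & x < b.
Proof.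
move=> xS; have := open_inner; rewrite openE => /(_ x xS).
move=> [e /= e0 he]; exists (x + e / 2); last by rewrite ltrDl divr_gt0.
apply: he; rewrite /ball_/= opprD addrA subrr sub0r normrN gtr0_norm ?divr_gt0//.
by rewrite ltr_pdivrMr// ltr_pMr// ltr1n.
Qed.

Lemma measurable_state : measurable (state S).
Proof.
have [iS Si] := sd_state HS.
apply: is_interval_measurable => x y xS yS z /andP[xz zy].
have [->//|zx] := eqVneq z x; have [->//|zy'] := eqVneq z y.
apply: iS; apply/andP; split.
  have /andP[+ _] := Si _ xS; move/le_lt_trans; apply.
  by rewrite lte_fin lt_neqAle eq_sym zx.
have /andP[_] := Si _ yS; apply: lt_le_trans.
by rewrite lte_fin lt_neqAle zy'.
Qed.

Lemma C2_continuous (f : R -> R) x : C2 S f -> inner S x -> {for x, continuous f}.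
Proof.
move=> [fd _] xS; apply: differentiable_continuous.
exact/derivable1_diffP/(fd x xS).1.
Qed.

Lemma oriented_integral_continuous (f : R -> R) c x :
  (forall y, inner S y -> {for y, continuous f}) -> inner S c -> inner S x ->
  {for x, continuous (fun y => oriented_integral c y f)}.
Proof.
move=> cf cS xS.
have [a aS ac] : exists2 a, inner S a & a < Num.min c x.
  by apply: inner_ex_lt; rewrite minEle; case: ifP.
have [b bS bc] : exists2 b, inner S b & Num.max c x < b.
  by apply: inner_ex_gt; rewrite maxEle; case: ifP.
move: ac bc; rewrite lt_min gt_max => /andP[ac ax] /andP[cb xb].
have ab : a < b by exact: lt_trans ac cb.
have intf u v : inner S u -> inner S v -> mu.-integrable `[u, v] (EFin \o f).
  move=> uS vS; apply: continuous_compact_integrable; first exact: segment_compact.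
  apply: continuous_in_subspaceT => y; rewrite inE/= in_itv/= => uyv.
  by apply: cf; exact: inner_itv uyv.
have cG := parameterized_integral_continuous (ltW ab) (intf a b aS bS).
pose G y := parameterized_integral mu a y f.
have GE y : a < y < b -> oriented_integral c y f = G y - G c.
  have sub u v : a < u -> u <= v -> v < b ->
      \int[mu]_(t in `[u, v]) f t = G v - G u.
    move=> au uv vb.
    have uS : inner S u by apply: (inner_itv aS bS); rewrite !ltW//= (le_lt_trans uv).
    have vS : inner S v 
      by apply: (inner_itv aS bS); rewrite (ltW vb) (ltW (lt_le_trans au uv)).
    rewrite /G/parameterized_integral Rintegral_itvB//.
    - rewrite Rintegral_itv_obnd_cbnd//.
      apply: integrableS (intf u v uS vS) => //.
      by apply: subset_itvr; rewrite bnd_simp.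
    - exact: intf.
    - by rewrite bnd_simp ltW.
  move=> /andP[ay yb]; rewrite /oriented_integral; case: ifPn => cy.
    exact: sub.
  by rewrite sub ?opprB// ltW// ltNge.
have xab : x \in `]a, b[ by rewrite in_itv/= ax xb.
have cGx : {for x, continuous G} by exact: (within_continuous_continuous ab cG xab).
have cGc : {for x, continuous (fun y => G y - G c)}.
  by apply: continuousB => //; exact: cst_continuous.
suff : (fun y => oriented_integral c y f) @ x --> oriented_integral c x f by [].
rewrite (GE x) ?ax//.
apply: cvg_trans cGc; apply: near_eq_cvg.
near=> y; rewrite GE//; have : y \in `]a, b[ by near: y; exact: near_in_itvoo.
by rewrite in_itv.
Unshelve. all: by end_near. Qed.

Lemma measurable_statdens : measurable_fun (inner S) q.
Proof.
apply: open_continuous_measurable_fun; first exact: open_inner.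
move=> x; rewrite inE => xS.
have [C2m C2v] := df_C2 HD.
have v0 y : inner S y -> vol S th1 y ^+ 2 != 0.
  by move=> yS; rewrite expf_neq0// gt_eqF// (df_pos HD).
have cv y : inner S y -> {for y, continuous (fun y => (vol S th1 y ^+ 2)^-1)}.
  move=> yS; apply: continuousV; first exact: v0.
  by apply: continuousM; exact: C2_continuous.
apply: continuousM; last exact: cst_continuous.
apply: continuousM; first exact: cv.
apply: (@continuous_comp _ _ _ _ (@expR R)); last exact: continuous_expR.
apply: oriented_integral_continuous => //; last exact: sd_basept.
move=> y yS; apply: continuousM; last exact: cv.
apply: continuousM; first exact: cst_continuous.
exact: C2_continuous.
Qed.

Lemma statdens_ge0 x : 0 <= q x.
Proof.
rewrite /statdens divr_ge0//; last apply: Rintegral_ge0 => y _;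
by rewrite mulr_ge0// ?invr_ge0 ?sqr_ge0// expR_ge0.
Qed.

Lemma measurable_X t : 0 <= t -> measurable_fun setT (Xt t).
Proof. by move=> t0; exact: (df_meas HD). Qed.

(** X_0 has the density q on the interior of the state space. *)
Lemma integral_X0 (f : R -> \bar R) : (forall x, (0 <= f x)%E) ->
  measurable_fun setT f ->
  (\int[P]_w f (X S 0 w) = \int[mu]_(x in inner S) (f x * (q x)%:E))%E.
Proof.
move=> f0 mf.
pose nq x : {nonneg R} := NngNum (statdens_ge0 x).
pose k x : {measure set RT -> \bar R} := mscale (nq x) (\d_ (x : RT)).
have kE x B : k x B = (q x * \1_B x)%:E.
  by rewrite /k/= /mscale/= diracE indicE.
have mq := measurable_statdens.
have mqE : measurable_fun (inner S) (EFin \o q) by exact/measurable_EFinP.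
rewrite (@ge0_integral_law _ _ _ _ _ _ _ P setT measurableT (Xt 0)
  (measurable_X (lexx 0)) mu (inner S) measurable_inner k)//.
- apply: eq_integral => x _; rewrite ge0_integral_mscale//.
  by rewrite integral_dirac// diracT mul1e muleC.
- move=> B mB; under eq_fun do rewrite kE.
  apply/measurable_EFinP; apply: measurable_funM; first exact: mq.
  by apply: measurable_funTS; exact: measurable_indic.
- move=> B mB; rewrite setTI.
  transitivity (\int[mu]_(x in inner S `&` B) (q x)%:E)%E.
    exact: (df_initial HD).
  rewrite integral_mkcondr; apply: eq_integral => x _.
  rewrite /patch kE indicE; case: ifPn => _; by rewrite ?mulr1 ?mulr0.
Qed.

Lemma eventsT (Z : R -> Omega -> R) (J : set R) : events Z J setT.
Proof.
exact: (@measurableT _ (g_sigma_algebraType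
  [set A | exists u B, [/\ J u, measurable B & A = Z u @^-1` B]])).
Qed.

(** X is stationary. *)
Lemma law_X t (B : set R) : 0 <= t -> measurable B ->
  P (X S t @^-1` B) = P (X S 0 @^-1` B).
Proof.
move=> t0 mB.
have := @df_markov _ _ _ _ _ _ _ _ HD 0 t setT B (lexx 0) t0 (@eventsT (X S) `[0, 0]) mB.
rewrite setTI add0r => ->; rewrite [RHS](df_initial HD mB) -(df_stationary HD t0 mB).
apply: (@integral_X0 (fun x => trans S th1 (t, x) B)) => //.
have mk := measurable_kernel (trans S th1) B mB.
apply: (measurableT_comp mk); exact: pair1_measurable.
Qed.

Lemma integral_X t (f : R -> \bar R) : 0 <= t -> (forall x, (0 <= f x)%E) ->
  measurable_fun setT f -> (\int[P]_w f (X S t w) = \int[P]_w f (X S 0 w))%E.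
Proof.
move=> t0 f0 mf.
apply: (@ge0_integral_eqlaw _ _ _ _ _ _ _ P P setT measurableT setT measurableT
  (Xt t) (measurable_X t0) (Xt 0) (measurable_X (lexx 0))) => // B mB.
by rewrite !setTI; exact: law_X.
Qed.

Lemma X0_inner : {ae P, forall w, inner S (X S 0 w)}.
Proof.
have mC : measurable (~` inner S) by exact: measurableC measurable_inner.
exists (X S 0 @^-1` (~` inner S)); split.
- rewrite -[X in measurable X]setTI.
  exact: (measurable_X (lexx 0) measurableT mC).
- rewrite (df_initial HD)//.
  by rewrite setICr integral_set0.
- by [].
Qed.

Lemma events_measurable s (A : set Omega) : 0 <= s ->
  events (X S) `[0, s] A -> measurable A.
Proof.
move=> s0; apply: (smallest_sub (@sigma_algebra_measurable _ Omega)).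
move=> _ [u [B [/= us mB ->]]]; rewrite -[X in measurable X]setTI.
by apply: (measurable_X (t := u)) => //; move: us; rewrite in_itv/= => /andP[].
Qed.

Lemma L2norm2_X t (f f' : R -> R) : 0 <= t -> measurable_fun setT f' ->
  (forall x, inner S x -> f' x = f x) ->
  (\int[P]_w (f' (X S t w) ^+ 2)%:E = L2norm2 S th1 f)%E.
Proof.
move=> t0 mf' ff'.
have mf2 : measurable_fun setT (fun x => (f' x ^+ 2)%:E).
  by apply/measurable_EFinP; exact: measurable_funX.
have f20 x : (0 <= (f' x ^+ 2)%:E)%E by rewrite lee_fin sqr_ge0.
rewrite (integral_X t0 f20 mf2) (integral_X0 f20 mf2).
by apply: eq_integral => x; rewrite inE => xS; rewrite ff'// EFinM.
Qed.

(** Functions of the state are extended by 0 to the whole line, as they are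
    measurable on the state space only. *)
Lemma measurable_patch_state (f : R -> R) : measurable_fun (state S) f ->
  measurable_fun setT (f \_ (state S)).
Proof.
by move=> mf; exact: (measurable_restrictT f (measurable_state)).1 mf.
Qed.

Lemma patch_state (f : R -> R) x : state S x -> (f \_ (state S)) x = f x.
Proof. by move=> xS; rewrite patchE mem_set. Qed.

Lemma L1_L2X t (f : R -> R) : 0 <= t -> measurable_fun (state S) f ->
  (L2norm2 S th1 f < +oo)%E ->
  L1 P (fun w => f (X S t w) ^+ 2) /\ L1 P (fun w => f (X S t w)).
Proof.
move=> t0 mf fL.
have fE w : f (X S t w) = (f \_ (state S)) (X S t w).
  by rewrite patch_state//; exact: (df_state HD).
have mfp := measurable_patch_state mf.
have mfX : measurable_fun setT (fun w => f (X S t w)).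
  rewrite (_ : (fun w => _) = (f \_ (state S)) \o X S t); last exact/funext.
  exact: measurableT_comp mfp (measurable_X t0).
have L2 : L1 P (fun w => f (X S t w) ^+ 2).
  apply: L1_ge0 => //; first exact: measurable_funX.
  by move=> w; exact: sqr_ge0.
  under eq_integral do rewrite fE.
  rewrite (L2norm2_X t0 mfp (f := f))// => x /(proj1 (sd_state HS)) xs.
  exact: patch_state.
split => //.
apply: (L1_le (W := fun w => 1 + f (X S t w) ^+ 2)) => //; last exact: L1D (L1_cst P 1) L2.
by move=> w; set a := f _; rewrite ler_norml; nra.
Qed.

Lemma eigval_le0 m : eigval S th1 m <= 0.
Proof.
elim: m => [|m ih]; first by rewrite (pds_eigval0 HP).
exact: le_trans (ltW (pds_decr HP m)) ih.
Qed.

(** * Eigenfunctions of the diffusion *)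

Section OneEigenfunction.
Variable m : nat.
Local Notation phi := (eigfun S th1 m).
Local Notation lam := (eigval S th1 m).
Let Hgen : generator S th1 phi (fun x => lam * phi x).
Proof. exact: (pds_eigen HP). Qed.

Lemma measurable_eigfun : measurable_fun (state S) phi.
Proof. by have [[]] := Hgen. Qed.

Lemma eigfun_L2 t : 0 <= t ->
  L1 P (fun w => phi (X S t w) ^+ 2) /\ L1 P (fun w => phi (X S t w)).
Proof. by move=> t0; have [[a b] _ _] := Hgen; exact: L1_L2X. Qed.

Let phi' := phi \_ (state S).
Let mphi' : measurable_fun setT phi'.
Proof. exact: measurable_patch_state measurable_eigfun. Qed.

Let tr h x := trans S th1 (h, x).

Let semiE h x : semigroup S th1 h phi x = \int[tr h x]_z phi' z.
Proof. by rewrite /semigroup Rintegral_mkcond. Qed.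

Let msemi h : measurable_fun setT (fun x => \int[tr h x]_z phi' z).
Proof.
have mk B : measurable B -> measurable_fun setT (fun x => tr h x B).
  move=> mB; apply: (measurableT_comp (measurable_kernel (trans S th1) B mB)).
  exact: pair1_measurable.
exact: (measurable_kernel_mean mk).
Qed.

Variables (B : set R) (mB : measurable B).
Let A := X S 0 @^-1` B.
Let u t := \int[P]_w (\1_A w * phi (X S t w)).

Let eventA s : 0 <= s -> events (X S) `[0, s] A.
Proof.
move=> s0; apply: sub_sigma_algebra; exists 0, B; split => //.
by rewrite /= in_itv/= lexx s0.
Qed.

Let mA : measurable A.
Proof. exact: (events_measurable (lexx 0) (eventA (lexx 0))). Qed.

Let A1 w : `|\1_A w : R| <= 1.
Proof. by rewrite ger0_norm// indicE lern1 leq_b1. Qed.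

(* One step of Euler's scheme for u: by the Markov property the error is h times
   the mean on A of psi' (X_t), where psi is the defect in the generator equation
   at h, and psi' is a version of it that is measurable on the whole line. *)
Let step t h : 0 <= t -> 0 < h ->
  let psi := fun x => h^-1 * (semigroup S th1 h phi x - phi x) - lam * phi x in
  let psi' := fun x => h^-1 * (\int[tr h x]_z phi' z - phi' x) - lam * phi' x in
  [/\ measurable_fun setT psi',
      (forall x, inner S x -> psi' x = psi x),
      L1 P (fun w => \1_A w * psi' (X S t w)) &
      u (t + h) - (1 + lam * h) * u t = h * \int[P]_w (\1_A w * psi' (X S t w))].
Proof.
move=> t0 h0 psi psi'.
have th : 0 <= t + h by rewrite addr_ge0// ltW.
have mpsi : measurable_fun setT psi'.
  apply: measurable_funB; last exact: measurable_funM.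
  by apply: measurable_funM => //; apply: measurable_funB => //; exact: msemi.
have phiE s w : 0 <= s -> phi' (X S s w) = phi (X S s w).
  by move=> s0; apply: patch_state; exact: (df_state HD).
have mtr B' : measurable B' -> measurable_fun setT (fun w => tr h (X S t w) B').
  move=> mB'; apply: (measurableT_comp (f := fun x => tr h x B')) (measurable_X t0).
  apply: (measurableT_comp (measurable_kernel (trans S th1) B' mB')).
  exact: pair1_measurable.
have Lphi : L1 P (phi' \o X S (t + h)).
  by apply: eq_L1 (eigfun_L2 th).2 => w; rewrite /= phiE.
have [K1 K2] := @kernel_mean _ _ _ _ _ P A mA (Xt (t + h)) (measurable_X th)
  (fun w => tr h (X S t w)) mtr
  (fun B' mB' => df_markov HD t0 (ltW h0) (eventA t0) mB') phi' mphi' Lphi.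
have Lt : L1 P (fun w => \1_A w * phi (X S t w)).
  exact: (@L1_bdd _ _ _ _ \1_A _ 1 (measurable_indic mA) A1 (eigfun_L2 t0).2).
have psiE w : h * (\1_A w * psi' (X S t w)) =
    \1_A w * (\int[tr h (X S t w)]_z phi' z) - (1 + lam * h) * (\1_A w * phi (X S t w)).
  by rewrite /psi' phiE//; field; rewrite gt_eqF.
have LhP : L1 P (fun w => h * (\1_A w * psi' (X S t w))).
  by apply: (eq_L1 _ (L1B K1 (L1Z (1 + lam * h) Lt))) => w; rewrite psiE.
have LP : L1 P (fun w => \1_A w * psi' (X S t w)).
  apply: (eq_L1 _ (L1Z h^-1 LhP)) => w; by rewrite mulrA mulVf ?mul1r// gt_eqF.
split => //.
  move=> x xS; rewrite /psi' /psi semiE /phi' patch_state//.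
  exact: (proj1 (sd_state HS)).
rewrite -(EZ h LP); under [RHS]eq_E do rewrite psiE.
rewrite (EB K1 (L1Z _ Lt)) (EZ _ Lt) -K2; congr (_ - _).
by apply: eq_E => w; rewrite /= phiE.
Qed.

(** E[phi (X_t); X_0 in B] = exp (lam t) E[phi (X_0); X_0 in B].  As X_t has the
    density q for every t, the error of Euler's scheme is bounded, uniformly in
    t, by the L^2(q) norm of the defect, which tends to 0 with h. *)
Lemma eigfun_martingale t : 0 <= t ->
  \int[P]_w (\1_B (X S 0 w) * phi (X S t w)) =
  expR (lam * t) * \int[P]_w (\1_B (X S 0 w) * phi (X S 0 w)).
Proof.
have iE w : \1_B (X S 0 w) = \1_A w :> R by rewrite !indicE.
have uE s : \int[P]_w (\1_B (X S 0 w) * phi (X S s w)) = u s.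
  by apply: eq_E => w; rewrite iE.
rewrite !uE; move: t; apply: euler_exponential; first exact: eigval_le0.
move=> e e0.
have [_ _ cvg0] := Hgen.
have e20 : (0 < (e ^+ 2)%:E)%E by rewrite lte_fin exprn_gt0.
have : \forall h \near (0 : R)^'+, (L2norm2 S th1 (fun x =>
    h^-1 * (semigroup S th1 h phi x - phi x) - lam * phi x)%R < (e ^+ 2)%:E)%E.
  apply: (cvg0 [set y | (y < (e ^+ 2)%:E)%E]); apply: open_nbhs_nbhs; split => //.
  exact: open_ereal_lt_ereal.
move=> [eta /= eta0 He]; exists eta => // h /andP[h0 heta] t t0.
have := He h; rewrite /ball_/= sub0r normrN gtr0_norm// => /(_ heta h0) hL.
have [mpsi psiE Lpsi ->] := step t0 h0.
set psi' := (fun x => _) in mpsi psiE Lpsi *.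
have L2 : L1 P (fun w => psi' (X S t w) ^+ 2).
  apply: L1_ge0.
  - by apply: measurable_funX; exact: measurableT_comp mpsi (measurable_X t0).
  - by move=> w; exact: sqr_ge0.
  - rewrite (L2norm2_X t0 mpsi psiE); apply: lt_trans hL _; exact: ltry.
have E2 : \int[P]_w (psi' (X S t w) ^+ 2) <= e ^+ 2.
  by rewrite -lee_fin -(L1_E L2) (L2norm2_X t0 mpsi psiE) ltW.
rewrite normrM gtr0_norm// mulrC ler_pM2r//.
apply: le_trans (E_norm Lpsi) _.
(* |a| <= e / 2 + a^2 / (2 e) at a = psi' (X_t), where E[a^2] <= e^2. *)
pose bd w := 2^-1 * e + (2 * e)^-1 * psi' (X S t w) ^+ 2.
have Lbd : L1 P bd by apply: L1D; [exact: L1_cst|exact: L1Z].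
apply: (@le_trans _ _ (\int[P]_w bd w)).
  apply: E_le => //; first exact: L1_norm.
  move=> w; rewrite normrM; apply: (@le_trans _ _ `|psi' (X S t w)|).
    by rewrite ler_piMl.
  rewrite /bd; set a := psi' _.
  rewrite -(real_normK (num_real a)); have := normr_ge0 a; set b := `|a| => b0.
  rewrite -subr_ge0 (_ : _ - b = (2 * e)^-1 * (b - e) ^+ 2).
    by rewrite mulr_ge0 ?sqr_ge0// invr_ge0 mulr_ge0// ltW.
  by field; rewrite gt_eqF.
rewrite (ED (L1_cst P (2^-1 * e)) (L1Z (2 * e)^-1 L2)) (EZ _ L2) E_cst.
apply: (@le_trans _ _ (2^-1 * e + (2 * e)^-1 * e ^+ 2)).
  by rewrite lerD2l ler_wpM2l// invr_ge0 mulr_ge0// ltW.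
by rewrite (_ : _ + _ = e)//; field; rewrite gt_eqF.
Qed.

End OneEigenfunction.
Local Notation phi m := (eigfun S th1 m).

Lemma inner_prod_X0 (f g : R -> R) :
  measurable_fun (state S) f -> measurable_fun (state S) g ->
  inner_prod S th1 f g = \int[P]_w (f (X S 0 w) * g (X S 0 w)).
Proof.
move=> mf mg.
pose h : R -> R := (fun x => f x * g x) \_ (state S).
have mh : measurable_fun setT h.
  by apply: (measurable_patch_state); exact: measurable_funM.
have hX w : f (X S 0 w) * g (X S 0 w) = h (X S 0 w).
  by rewrite /h patch_state//; exact: (df_state HD).
transitivity (\int[mu]_(x in inner S) (h x * q x)).
  apply: eq_Rintegral => x; rewrite inE => xS.
  by rewrite /h patch_state//; exact: (sd_state HS).1.
transitivity (\int[P]_w h (X S 0 w)); last by apply: eq_E => w; rewrite hX.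
rewrite /Rintegral; congr fine; rewrite [LHS]integralE [RHS]integralE.
have mE : measurable_fun setT (EFin \o h) by exact/measurable_EFinP.
have pos x : ((fun x => (h x * q x)%:E)^\+ x = (EFin \o h)^\+ x * (q x)%:E)%E.
  rewrite unlock /= -!EFin_max -EFinM. rewrite maxr_pMl ?mul0r//.
  exact: statdens_ge0.
have neg x : ((fun x => (h x * q x)%:E)^\- x = (EFin \o h)^\- x * (q x)%:E)%E.
  rewrite unlock /= -!EFin_max -EFinM maxr_pMl ?mul0r ?mulNr//.
  exact: statdens_ge0.
congr (_ - _)%E.
- transitivity (\int[mu]_(x in inner S) ((EFin \o h)^\+ x * (q x)%:E))%E.
    by apply: eq_integral => x _; exact: pos.
  rewrite -(integral_X0 (f := ((EFin \o h)^\+)%E))//.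
  + by apply: eq_integral => w _; rewrite unlock.
  + exact: measurable_funepos.
- transitivity (\int[mu]_(x in inner S) ((EFin \o h)^\- x * (q x)%:E))%E.
    by apply: eq_integral => x _; exact: neg.
  rewrite -(integral_X0 (f := ((EFin \o h)^\-)%E))//.
  + by apply: eq_integral => w _; rewrite unlock.
  + exact: measurable_funeneg.
Qed.

(** The functions 1, phi_1, ..., phi_M are orthonormal, hence linearly
    independent on the interior of the state space. *)
Lemma eigfun_independent M (c : 'I_M -> R) (k : R) :
  (forall b, inner S b -> \sum_m c m * phi m.+1 b = k) -> forall j, c j = 0.
Proof.
move=> ck j.
have mphi m := measurable_eigfun m.
have mphiX m : measurable_fun setT (fun w => phi m (X S 0 w)).
  by apply: L1_meas; exact: (eigfun_L2 m (lexx 0)).2.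
have Ephi m l : \int[P]_w (phi m (X S 0 w) * phi l (X S 0 w)) = (m == l)%:R.
  by rewrite -(pds_orthonormal HP) inner_prod_X0.
have Lphi m l : L1 P (fun w => phi m (X S 0 w) * phi l (X S 0 w)).
  by apply: L1_mul => //; exact: (eigfun_L2 _ (lexx 0)).1.
have -> : c j = \int[P]_w (\sum_m c m * (phi m.+1 (X S 0 w) * phi j.+1 (X S 0 w))).
  rewrite E_sum; last by move=> m _; exact: L1Z.
  rewrite (bigD1 j)//= EZ// Ephi eqxx mulr1 big1 ?addr0// => m mj.
  by rewrite EZ// Ephi eqSS (inj_eq val_inj) (negbTE mj) mulr0.
transitivity (\int[P]_w (k * (phi 0 (X S 0 w) * phi j.+1 (X S 0 w)))).
  apply: E_ae.
  - by apply: measurable_sum => m; apply: measurable_funM => //; exact: measurable_funM.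
  - by apply: measurable_funM => //; exact: measurable_funM.
  apply: filterS (X0_inner) => w wS.
  rewrite (pds_eigfun0 HP); last exact: (df_state HD).
  by rewrite mul1r -(ck _ wS) mulr_suml; apply: eq_bigr => m _; rewrite mulrA.
by rewrite EZ// Ephi mulr0.
Qed.

Lemma V_spanning (Delta : R) M a : exists b : 'I_M -> R,
  (forall k, inner S (b k)) /\
  \matrix_(k, m) V S Delta M a (b k) th1 th2 m 0 \in unitmx.
Proof.
apply: (spanning_unitmx (D := inner S)
  (g := fun b (m : 'I_M) => V S Delta M a b th1 th2 m 0)) => c cV.
apply: (@eigfun_independent M c (\sum_m c m *
  (expR (- laplace S th2 (- eigval S th1 m.+1) * Delta) * phi m.+1 a))) => b bS.
apply/eqP; rewrite -subr_eq0 -sumrB -[X in _ == X](cV b bS); apply/eqP.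
by apply: eq_bigr => m _; rewrite mxE mulrBr.
Qed.

(** * The observed chain *)

Section SubordinateChain.
Variable Delta : R.
Hypothesis Delta_gt0 : 0 < Delta.
Local Notation Ti i := (fun w => T S (i%:R * Delta) w : RT).
Local Notation Yi i := (Y S Delta i : Omega -> RT).

Let HT : levy_subordinator S th1 th2. Proof. exact: sd_subordinator. Qed.

(** The sets that generate the sigma-algebra [events Z J]. *)
Definition evgen (Z : R -> Omega -> R) (J : set R) : set (set Omega) :=
  [set A | exists u B, [/\ J u, measurable B & A = Z u @^-1` B]].

(* The sample space with the events determined by the diffusion, resp. by the
   subordinator up to time i * Delta, or at all times. *)
Local Notation OX := (g_sigma_algebraType (evgen (X S) `[0, +oo[)).
Local Notation OT i := (g_sigma_algebraType (evgen (T S) `[0, i%:R * Delta])).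
Local Notation OTT := (g_sigma_algebraType (evgen (T S) `[0, +oo[)).

Let time_ge0 i : 0 <= i%:R * Delta. Proof. by rewrite mulr_ge0// ltW. Qed.

Lemma T_ge0 t w : 0 <= t -> 0 <= T S t w.
Proof. by move=> t0; rewrite -(ls_zero HT w); exact: (ls_nondecreasing HT). Qed.

Let increment_ge0 s t w : 0 <= s -> 0 <= t -> 0 <= increment S s t w.
Proof.
move=> s0 t0; rewrite /increment subr_ge0; apply: (ls_nondecreasing HT) => //.
by rewrite lerDl.
Qed.

Let maxT i w : Num.max (T S (i%:R * Delta) w) 0 = T S (i%:R * Delta) w.
Proof. by apply/max_idPl; exact: T_ge0. Qed.

Let measurable_evgen Z J u : J u ->
  measurable_fun setT (Z u : g_sigma_algebraType (evgen Z J) -> RT).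
Proof.
move=> Ju _ B mB; rewrite setTI; apply: sub_sigma_algebra; exists u, B; split => //.
Qed.

Let sub_measurable Z J (G := g_sigma_algebraType (evgen Z J)) (A : set G) :
  (forall u, J u -> measurable_fun setT (Z u)) -> measurable A ->
  measurable (A : set Omega).
Proof.
move=> mZ; apply: (smallest_sub (@sigma_algebra_measurable _ Omega)).
by move=> _ [u [B [Ju mB ->]]]; rewrite -[X in measurable X]setTI; exact: mZ.
Qed.

Let idX : measurable_fun setT (fun w : Omega => (w : OX)).
Proof.
move=> _ A mA; rewrite setTI; apply: sub_measurable mA => u.
by rewrite /= in_itv/= andbT => u0; exact: (df_meas HD).
Qed.

Let idT i : measurable_fun setT (fun w : Omega => (w : OT i)).
Proof.
move=> _ A mA; rewrite setTI; apply: sub_measurable mA => u.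
by rewrite /= in_itv/= => /andP[u0 _]; exact: (ls_meas HT).
Qed.

Let idTT i : measurable_fun setT (fun w : OTT => (w : OT i)).
Proof.
move=> _ A mA; rewrite setTI.
apply: (@sub_sigma_algebra2 _ setT _ (evgen (T S) `[0, i%:R * Delta])) mA.
move=> _ [u [B [+ mB ->]]]; rewrite /= in_itv/= => /andP[u0 _].
by exists u, B; split => //; rewrite /= in_itv/= u0.
Qed.

Let measurable_Ti i j : (j <= i)%N ->
  measurable_fun setT (Ti j : OT i -> RT).
Proof.
move=> ji; apply: measurable_evgen; rewrite /= in_itv/= time_ge0/=.
by rewrite ler_pM2r// ler_nat.
Qed.

(* X as a function of outcome and time.  Negative times do not occur. *)
Let XX (z : OX * RT) : RT := X S (Num.max z.2 0) z.1.

Let measurable_XX : measurable_fun setT XX.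
Proof.
apply: (@joint_measurable R _ OX (X S)).
- by move=> t t0; apply: measurable_evgen; rewrite /= in_itv/= t0.
- exact: (df_cont HD).
Qed.

Let indXT i (A : set OX) (B : set (OT i)) : measurable A -> measurable B ->
  P (A `&` B) = (P A * P B)%E.
Proof.
move=> mA mB; apply: (sd_indep HS Hth1 Hth2) => //.
have := idTT measurableT mB; rewrite setTI; exact.
Qed.

(* The increment of the subordinator over the i-th sampling interval. *)
Let tau i (w : Omega) : RT := increment S (i%:R * Delta) Delta w.

Let measurable_tau i : measurable_fun setT (tau i).
Proof.
apply: measurable_funB; apply: (ls_meas HT) => //.
by rewrite addr_ge0// ltW.
Qed.

(* The subordinator up to time i * Delta, and its next increment. *)
Let zeta i (w : Omega) : OT i * RT := (w, tau i w).

Let measurable_zetaT i : measurable_fun setT (zeta i : OTT -> OT i * RT).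
Proof.
apply/measurable_fun_pairP; split; first exact: idTT.
have mT u : 0 <= u -> measurable_fun setT (T S u : OTT -> RT).
  by move=> u0; apply: measurable_evgen; rewrite /= in_itv/= u0.
apply: measurable_funB; apply: mT => //.
by rewrite addr_ge0// ltW.
Qed.

Let measurable_zeta i : measurable_fun setT (zeta i).
Proof. by apply/measurable_fun_pairP; split; [exact: idT|exact: measurable_tau]. Qed.

Let ind_zeta i (A : set OX) (B : set (OT i * RT)) : measurable A -> measurable B ->
  P (A `&` zeta i @^-1` B) = (P A * P (zeta i @^-1` B))%E.
Proof.
move=> mA mB; apply: (sd_indep HS Hth1 Hth2) => //.
have := @measurable_zetaT i measurableT _ mB; rewrite setTI; exact.
Qed.

Let ind_tau i (A : set (OT i)) (B : set RT) : measurable A -> measurable B ->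
  P (A `&` tau i @^-1` B) = (P A * P (tau i @^-1` B))%E.
Proof.
move=> mA mB; apply: (ls_indep HT (time_ge0 i) (ltW Delta_gt0)) => //.
Qed.

Lemma YE i w : Y S Delta i w = XX (w, T S (i%:R * Delta) w).
Proof. by rewrite /XX/= maxT. Qed.

Lemma measurable_Y i : measurable_fun setT (Yi i).
Proof.
rewrite (_ : Yi i = XX \o (fun w => (w, T S (i%:R * Delta) w))); last first.
  by apply/funext => w; rewrite YE.
apply: measurableT_comp => //.
apply/measurable_fun_pairP; split; first exact: idX.
exact: (ls_meas HT).
Qed.

(** An event of the past of Y is, for a fixed path of the subordinator, an
    event of the past of the diffusion. *)
Lemma past_lift i (A : set (past (fun j => Yi j) i)) : measurable A ->
  exists A2 : set (OX * OT i),
    [/\ measurable A2, (forall w, A w <-> A2 (w, w)) &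
     forall w', events (X S) `[0, T S (i%:R * Delta) w'] [set w | A2 (w, w')]].
Proof.
move: A; apply: smallest_sub; last first.
  move=> _ [j [B [ji mB ->]]].
  exists [set z | B (XX (z.1, T S (j%:R * Delta) z.2))]; split.
  - rewrite -[X in measurable X]setTI.
    have m : measurable_fun setT (fun z : OX * OT i => XX (z.1, T S (j%:R * Delta) z.2)).
      apply: measurableT_comp => //.
      apply/measurable_fun_pairP; split; first exact: measurable_fst.
      exact: (measurableT_comp (measurable_Ti ji) measurable_snd).
    exact: m.
  - by move=> w /=; rewrite -YE.
  - move=> w'; apply: sub_sigma_algebra; exists (T S (j%:R * Delta) w'), B; split => //.
      rewrite /= in_itv/= T_ge0//=; apply: (ls_nondecreasing HT) => //.
      by rewrite ler_pM2r// ler_nat.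
    by apply/seteqP; split => w /=; rewrite /XX/= maxT.
split.
- exists set0; split => // w'.
  by have := @measurable0 _ (g_sigma_algebraType (evgen (X S) `[0, T S (i%:R * Delta) w'])).
- move=> A [A2 [mA2 AA2 A2e]]; exists (~` A2); split.
  + exact: measurableC.
  + by move=> w /=; rewrite -AA2; split => [[]|].
  + move=> w'; have := A2e w'.
    exact: (@measurableC _ (g_sigma_algebraType (evgen (X S) `[0, T S (i%:R * Delta) w']))).
- move=> F HF.
  have /choice[A2 HA2] := HF.
  exists (\bigcup_n A2 n); split.
  + by apply: bigcup_measurable => n _; have [] := HA2 n.
  + by move=> w; split => -[n _ h]; exists n => //; have [_ /(_ w)[? ?] _] := HA2 n; auto.
  + move=> w'.
    have := @bigcupT_measurable _ (g_sigma_algebraType (evgen (X S) `[0, T S (i%:R * Delta) w']))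
      (fun n => [set w | A2 n (w, w')]).
    by apply => n; have [_ _] := HA2 n; apply.
Qed.

Let mkY y B : measurable B ->
  measurable_fun setT (fun w => trans S th1 (T S Delta w, y) B).
Proof.
move=> mB; apply: (measurableT_comp (measurable_kernel (trans S th1) B mB)).
apply/measurable_fun_pairP; split; first exact: (ls_meas HT (ltW Delta_gt0)).
exact: measurable_cst.
Qed.

(** The transition kernel of the observed chain: the transition function of the
    diffusion run for a random time distributed as T_Delta. *)
Definition Ykernel (y : RT) : {measure set RT -> \bar R} :=
  mixture_measure P measurableT (mkY y).

Let YkernelE y B : Ykernel y B = (\int[P]_w trans S th1 (T S Delta w, y) B)%E.
Proof. by []. Qed.

Let measurable_Ykernel B : measurable B -> measurable_fun setT (Ykernel ^~ B).
Proof.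
move=> mB.
have mF : measurable_fun setT (fun z : Omega * RT => trans S th1 (T S Delta z.1, z.2) B).
  apply: (measurableT_comp (measurable_kernel (trans S th1) B mB)).
  apply/measurable_fun_pairP; split; last exact: measurable_snd.
  exact: (measurableT_comp (ls_meas HT (ltW Delta_gt0)) measurable_fst).
exact: (@measurable_fun_fubini_tonelli_G _ _ _ _ _ P _ mF).
Qed.

HB.instance Definition _ :=
  isKernel.Build _ _ _ _ R Ykernel measurable_Ykernel.

Let Ykernel_prob y : Ykernel y setT = 1%E.
Proof.
rewrite YkernelE.
under eq_integral do rewrite prob_kernel.
by rewrite integral_cst// mul1e; exact: probability_setT.
Qed.

HB.instance Definition _ :=
  Kernel_isProbability.Build _ _ _ _ R Ykernel Ykernel_prob.

Let tau_law i (B : set RT) : measurable B ->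
  P (tau i @^-1` B) = P (T S Delta @^-1` B).
Proof. by move=> mB; exact: (ls_stationary HT (time_ge0 i) (ltW Delta_gt0) mB). Qed.

Let tau_ge0 i w : 0 <= tau i w.
Proof. exact: increment_ge0 (ltW Delta_gt0). Qed.

Let T_succ i w : T S (i.+1%:R * Delta) w = T S (i%:R * Delta) w + tau i w.
Proof. by rewrite /tau /increment addrC subrK -natr1 mulrDl mul1r. Qed.

Let integral_tau i (y : RT) B : measurable B ->
  (\int[P]_w trans S th1 ((Num.max (tau i w) 0)%R, y) B = Ykernel y B)%E.
Proof.
move=> mB; rewrite YkernelE.
have mf : measurable_fun setT (fun t : RT => trans S th1 ((Num.max t 0)%R, y) B).
  apply: (measurableT_comp (measurable_kernel (trans S th1) B mB)).
  apply/measurable_fun_pairP; split; last exact: measurable_cst.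
  exact: measurable_maxr.
have mT : measurable_fun setT (T S Delta : Omega -> RT) by exact: (ls_meas HT (ltW Delta_gt0)).
rewrite (@ge0_integral_eqlaw _ _ _ _ _ _ _ P P setT measurableT setT measurableT
  (tau i) (@measurable_tau i) (T S Delta : Omega -> RT) mT _
  (fun t => trans S th1 ((Num.max t 0)%R, y) B))//.
- apply: eq_integral => w _; congr (trans S th1 (_, _) _); apply/max_idPl.
  by apply: T_ge0; exact: ltW.
- by move=> B' mB'; rewrite !setTI; exact: tau_law.
Qed.

(** The outcome w is replaced by three copies, which independence allows: one for
    the diffusion, one for the subordinator up to time i * Delta, one for its
    next increment.  With the last two fixed, the Markov property of the
    diffusion at the time T_{i Delta} applies; averaging over the increment gives
    the kernel. *)
Lemma Y_markov i (A : set (past (fun j => Yi j) i)) (B : set RT) :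
  measurable A -> measurable B ->
  P (A `&` Yi i.+1 @^-1` B) = (\int[P]_(w in A) Ykernel (Yi i w) B)%E.
Proof.
move=> mA mB; have [A2 [mA2 AA2 A2e]] := past_lift mA.
have mA' : measurable (A : set Omega).
  exact: (past_measurable (Y := fun j => Yi j) measurable_Y mA).
pose Xi (z : OX * OT i) : RT := XX (z.1, T S (i%:R * Delta) z.2).
have mXi : measurable_fun setT Xi.
  apply: measurableT_comp => //.
  apply/measurable_fun_pairP; split; first exact: measurable_fst.
  exact: (measurableT_comp (measurable_Ti (leqnn i)) measurable_snd).
have mi (D D' : measure_display) (U : measurableType D) (f : U -> OX * OT i) :
   measurable_fun setT f -> measurable_fun setT (fun u => (\1_A2 (f u))%:E : \bar R).
  move=> mf; apply/measurable_EFinP.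
  exact: (measurableT_comp (measurable_indic mA2) mf).
have mfst3 : measurable_fun setT (fun z : OX * (OT i * RT) => (z.1, z.2.1)).
  apply/measurable_fun_pairP; split; first exact: measurable_fst.
  exact: (measurableT_comp measurable_fst measurable_snd).
pose F (z : OX * (OT i * RT)) : \bar R :=
  ((\1_A2 (z.1, z.2.1))%:E *
   (\1_B (XX (z.1, T S (i%:R * Delta) z.2.1 + Num.max z.2.2 0)%R))%:E)%E.
pose G (z : OX * (OT i * RT)) : \bar R :=
  ((\1_A2 (z.1, z.2.1))%:E * trans S th1 ((Num.max z.2.2 0)%R, Xi (z.1, z.2.1)) B)%E.
have F0 z : (0 <= F z)%E by rewrite mule_ge0.
have G0 z : (0 <= G z)%E by rewrite mule_ge0.
have m22 : measurable_fun setT (fun z : OX * (OT i * RT) => Num.max z.2.2 0 : RT).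
  apply: (@measurable_maxr _ _ _ _ (fun z : OX * (OT i * RT) => z.2.2) (cst 0)) => //.
  exact: (measurableT_comp measurable_snd measurable_snd).
have mF : measurable_fun setT F.
  apply: emeasurable_funM; first exact: (mi _ d).
  apply/measurable_EFinP; apply: (measurableT_comp (measurable_indic mB)).
  apply: measurableT_comp => //.
  apply/measurable_fun_pairP; split; first exact: measurable_fst.
  apply: measurable_funD; last exact: m22.
  apply: (measurableT_comp (measurable_Ti (leqnn i))).
  exact: (measurableT_comp measurable_fst measurable_snd).
have mG : measurable_fun setT G.
  apply: emeasurable_funM; first exact: (mi _ d).
  apply: (measurableT_comp (measurable_kernel (trans S th1) B mB)).
  apply/measurable_fun_pairP; split; first exact: m22.
  exact: (measurableT_comp mXi mfst3).
have FG : (\int[P]_w F (w, zeta i w) = \int[P]_w G (w, zeta i w))%E.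
  rewrite (integral_indep2 idX (@measurable_zeta i) (@ind_zeta i) F0 mF).
  rewrite [RHS](integral_indep2 idX (@measurable_zeta i) (@ind_zeta i) G0 mG).
  apply: eq_integral => w' _; rewrite /F/G/zeta/=.
  pose Aw : set Omega := [set w | A2 (w, w')].
  have ev : events (X S) `[0, T S (i%:R * Delta) w'] Aw := A2e w'.
  have s0 : 0 <= T S (i%:R * Delta) w' by exact: T_ge0.
  have t0 := tau_ge0 i w'.
  have mAw : measurable Aw := events_measurable s0 ev.
  have mt : Num.max (tau i w') 0 = tau i w' by exact/max_idPl.
  transitivity (P (Aw `&` X S (T S (i%:R * Delta) w' + tau i w') @^-1` B)).
    rewrite -[in RHS](setIT (_ `&` _)) -integral_indic//.
      apply: eq_integral => w _; rewrite mt -EFinM; congr EFin.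
      rewrite /XX/= (max_idPl _); last by rewrite addr_ge0.
      rewrite !indicE -natrM mulnb; congr (nat_of_bool _)%:R.
      by apply/andP/idP; rewrite !inE => h; exact: h.
    apply: measurableI => //; rewrite -[X in measurable X]setTI.
    by apply: (df_meas HD (addr_ge0 s0 t0)).
  rewrite (df_markov HD s0 t0 ev mB) integral_mkcond; apply: eq_integral => w _.
  rewrite mt /Xi /XX/= maxT /patch indicE.
  rewrite (_ : ((w, w') \in A2) = (w \in Aw)); last by apply/idP/idP; rewrite !inE.
  by case: (w \in Aw); rewrite ?mul1e ?mul0e.
transitivity (\int[P]_w F (w, zeta i w))%E.
  rewrite -[in LHS](setIT (_ `&` _)) -integral_indic//.
    apply: eq_integral => w _; rewrite /F/zeta/= -EFinM; congr EFin.
    have -> : XX (w, (T S (i%:R * Delta) w + Num.max (tau i w) 0)%R) = Yi i.+1 w.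
      by rewrite YE T_succ (max_idPl (tau_ge0 i w)).
    rewrite !indicE -natrM mulnb; congr (nat_of_bool _)%:R.
    by apply/idP/andP; rewrite !inE => -[h1 h2]; split => //; exact/AA2.
  apply: measurableI => //; rewrite -[X in measurable X]setTI.
  exact: measurable_Y.
rewrite FG.
pose H (z : OX * OT i) : \bar R := ((\1_A2 z)%:E * Ykernel (Xi z) B)%E.
have H0 z : (0 <= H z)%E by rewrite mule_ge0.
have mH : measurable_fun setT H.
  apply: emeasurable_funM; first by apply: (mi _ d); exact: measurable_id.
  exact: (measurableT_comp (measurable_kernel Ykernel B mB) mXi).
rewrite (integral_indep1 idX (@measurable_zeta i) (@ind_zeta i) G0 mG).
transitivity (\int[P]_w \int[P]_w' H (w, w'))%E.
  apply: eq_integral => w _.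
  have mGw : measurable_fun setT (fun v => G (w : OX, v)).
    by apply: measurableT_comp => //; exact: pair1_measurable.
  rewrite (@integral_indep1 _ _ _ _ _ _ _ P ((fun w => w) : Omega -> OT i) (@idT i) (tau i) (@measurable_tau i)
    (@ind_tau i) (fun v => G (w : OX, v)))//.
  apply: eq_integral => w' _; rewrite /G/H/=.
  rewrite ge0_integralZl//; first by rewrite integral_tau.
  apply: (measurableT_comp (measurable_kernel (trans S th1) B mB)).
  apply/measurable_fun_pairP; split; last exact: measurable_cst.
  exact: (measurable_maxr (@measurable_tau i)).
rewrite -(integral_indep1 idX (@idT i) (@indXT i) H0 mH).
rewrite [RHS]integral_mkcond; apply: eq_integral => w _.
rewrite /H /Xi/= -YE /patch indicE.
rewrite (_ : ((w, w) \in A2) = (w \in (A : set Omega))); last first.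
  by apply/idP/idP; rewrite !inE => h; exact/AA2.
by case: (w \in _); rewrite ?mul1e ?mul0e.
Qed.

(** The subordinator being independent of X, and X stationary, Y_i is
    distributed as X_0. *)
Lemma Y_stationary i (B : set RT) : measurable B ->
  P (Yi i @^-1` B) = P (Yi 0 @^-1` B).
Proof.
move=> mB.
suff H j : P (Yi j @^-1` B) = P (X S 0 @^-1` B) by rewrite !H.
have mYB : measurable (Yi j @^-1` B).
  by rewrite -[X in measurable X]setTI; exact: measurable_Y.
rewrite -[in LHS](setIT (_ @^-1` _)) -integral_indic//.
pose F (z : OX * OT j) : \bar R := (\1_B (XX (z.1, T S (j%:R * Delta) z.2)))%:E.
have mF : measurable_fun setT F.
  apply/measurable_EFinP; apply: (measurableT_comp (measurable_indic mB)).
  apply: measurableT_comp => //.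
  apply/measurable_fun_pairP; split; first exact: measurable_fst.
  exact: (measurableT_comp (measurable_Ti (leqnn j)) measurable_snd).
have F0 z : (0 <= F z)%E by rewrite lee_fin.
transitivity (\int[P]_w F (w, w))%E.
  by apply: eq_integral => w _; rewrite /F/= -YE !indicE.
rewrite (integral_indep2 idX (@idT j) (@indXT j) F0 mF).
transitivity (\int[P]_w' (cst (P (X S 0 @^-1` B)) w'))%E.
  apply: eq_integral => w' _; rewrite /F/=.
  have s0 : 0 <= T S (j%:R * Delta) w' by exact: T_ge0.
  rewrite -(law_X s0 mB) -[in RHS](setIT (_ @^-1` _)) -integral_indic//.
    by apply: eq_integral => w _; rewrite /XX/= maxT !indicE.
  by rewrite -[X in measurable X]setTI; exact: (df_meas HD s0).
rewrite integral_cst//.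
by have /= -> := @probability_setT _ _ _ P; rewrite mule1.
Qed.

Lemma Y_state i w : state S (Yi i w).
Proof. by apply: (df_state HD); exact: T_ge0. Qed.

Lemma Y0E w : Yi 0 w = X S 0 w.
Proof. by rewrite /Y mul0r (ls_zero HT). Qed.

Lemma Y_inner i : {ae P, forall w, inner S (Yi i w)}.
Proof.
have mC : measurable (~` inner S) by exact: measurableC measurable_inner.
exists (Yi i @^-1` (~` inner S)); split => //.
  by rewrite -[X in measurable X]setTI; exact: measurable_Y.
rewrite Y_stationary//.
rewrite (_ : Yi 0 @^-1` _ = X S 0 @^-1` (~` inner S)); last first.
  by apply/seteqP; split => w /=; rewrite Y0E.
by rewrite (df_initial HD)// setICr integral_set0.
Qed.

Lemma L1_Y i (f : R -> R) : measurable_fun (state S) f ->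
  L1 P (fun w => f (X S 0 w)) -> L1 P (fun w => f (Yi i w)).
Proof.
move=> mf Lf; have mf' := measurable_patch_state mf.
have H : L1 P (fun w => \1_setT w * (f \_ (state S)) (Yi i w)).
  apply: (@L1_eqlaw _ _ _ _ _ _ _ P P setT measurableT setT measurableT _
    (@measurable_Y 0) _ (@measurable_Y i) _ _ mf').
    by move=> B mB; rewrite !setTI; exact/esym/Y_stationary.
  apply: eq_L1 Lf => w; rewrite indicT mul1r patch_state ?Y0E//.
  exact: (df_state HD).
by apply: eq_L1 H => w; rewrite indicT mul1r patch_state//; exact: Y_state.
Qed.

Let ind_T (A : set OX) (B : set RT) : measurable A -> measurable B ->
  P (A `&` (T S Delta : Omega -> RT) @^-1` B) =
  (P A * P ((T S Delta : Omega -> RT) @^-1` B))%E.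
Proof.
move=> mA mB; apply: (sd_indep HS Hth1 Hth2) => //.
apply: sub_sigma_algebra; exists Delta, B; split => //.
by rewrite /= in_itv/= ltW.
Qed.

(** The eigenvalue of the transition operator of the chain at phi_m. *)
Definition eigmult m : R := expR (- laplace S th2 (- eigval S th1 m) * Delta).

Lemma E_laplace m : \int[P]_w expR (eigval S th1 m * T S Delta w) = eigmult m.
Proof.
have l0 : 0 <= - eigval S th1 m by rewrite oppr_ge0 (eigval_le0).
have := ls_laplace HT (ltW Delta_gt0) l0; rewrite opprK unlock => H.
by rewrite /Rintegral H.
Qed.

(** The eigenfunctions of the diffusion are eigenfunctions of the observed
    chain. *)
Lemma Y_eigfun m :
  cexp P (Yi 0) (fun w => eigfun S th1 m (Yi 1 w))
    (fun y => eigmult m * (eigfun S th1 m \_ (state S)) y).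
Proof.
set phi := eigfun S th1 m; pose phi' := phi \_ (state S).
have mphi : measurable_fun (state S) phi by exact: (measurable_eigfun).
have mphi' : measurable_fun setT phi' by exact: (measurable_patch_state).
have LX t : 0 <= t -> L1 P (fun w => phi (X S t w)).
  by move=> t0; exact: (eigfun_L2 m t0).2.
have phiE t w : 0 <= t -> phi' (X S t w) = phi (X S t w).
  by move=> t0; apply: patch_state; exact: (df_state HD).
have phiY i w : phi' (Yi i w) = phi (Yi i w).
  by apply: patch_state; exact: Y_state.
split.
- exact: L1_Y mphi (LX 0 (lexx 0)).
- exact: measurable_funM.
- apply: (eq_L1 _ (L1Z (eigmult m) (L1_Y 0 mphi (LX 0 (lexx 0))))) => w.
  by rewrite /= -[in RHS]/phi' phiY.
move=> B mB.
have iB x : `|\1_B x : R| <= 1 by rewrite ger0_norm// indicE lern1 leq_b1.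
(* By independence the time T_Delta may be held fixed at t, and then
   [eigfun_martingale] applies. *)
pose F (z : OX * RT) : R := \1_B (XX (z.1, 0)) * phi' (XX z).
have mX0 : measurable_fun setT (fun w : OX => XX (w, 0)).
  by apply: measurableT_comp => //; apply/measurable_fun_pairP; split.
have mF : measurable_fun setT F.
  apply: measurable_funM; last exact: (measurableT_comp mphi' measurable_XX).
  apply: (measurableT_comp (measurable_indic mB)).
  exact: (measurableT_comp mX0 measurable_fst).
pose c := \int[P]_w (\1_B (X S 0 w) * phi (X S 0 w)).
pose g (t : RT) : R := expR (eigval S th1 m * Num.max t 0) * c.
have lam0 := eigval_le0 m.
have mg0 : measurable_fun setT (fun t : RT => expR (eigval S th1 m * Num.max t 0)).
  apply: (measurableT_comp (@measurable_expR R)).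
  by apply: measurable_funM => //; exact: measurable_maxr.
have mg : measurable_fun setT g by exact: measurable_funM.
have m1B t : 0 <= t -> measurable_fun setT (fun w => \1_B (X S t w) : R).
  by move=> t0; apply: (measurableT_comp (measurable_indic mB)); exact: (df_meas HD t0).
have mTD : measurable_fun setT (T S Delta : Omega -> RT).
  exact: (ls_meas HT (ltW Delta_gt0)).
have LB Z : L1 P Z -> L1 P (fun w => \1_B (X S 0 w) * Z w).
  exact: (@L1_bdd _ _ _ _ (fun w => \1_B (X S 0 w)) _ 1 (m1B 0 (lexx 0)) (fun w => iB _)).
have Y1E w : XX (w, T S Delta w) = Yi 1 w by rewrite YE mul1r.
have X0E w : XX (w, 0) = X S 0 w by rewrite /XX/= maxxx.
have m0 (t : R) : 0 <= Num.max t 0 by rewrite le_max lexx orbT.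
pose ex (t : R) := expR (eigval S th1 m * Num.max t 0).
have gle (t : R) : `|expR (eigval S th1 m * Num.max t 0)| <= 1.
  by rewrite ger0_norm ?expR_ge0// -[leRHS]expR0 ler_expR mulr_le0_ge0.
have := @E_indep2 _ _ _ _ _ OX RT P ((fun w => w) : Omega -> OX) idX
  (T S Delta : Omega -> RT) mTD ind_T F g mF.
have H1 : L1 P (fun w => F (w, T S Delta w)).
  apply: (eq_L1 _ (LB _ (L1_Y 1 mphi (LX 0 (lexx 0))))) => w.
  by rewrite /F/= X0E Y1E phiY.
have H2 : L1 P (g \o T S Delta).
  apply: (@L1_bdd _ _ _ _ (fun w => ex (T S Delta w)) (fun=> c) 1).
  - exact: (measurableT_comp mg0 mTD).
  - by move=> w; exact: gle.
  - exact: L1_cst.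
have H3 t : L1 P (fun w => F (w, t)).
  apply: (eq_L1 _ (LB _ (LX _ (m0 t)))) => w.
  by rewrite /F/= X0E /XX/= phiE.
have H4 t : \int[P]_w F (w, t) = g t.
  rewrite /g -(eigfun_martingale m mB (m0 t)).
  by apply: eq_E => w; rewrite /F/= X0E /XX/= phiE.
move=> /(_ H1 mg H2 H3 H4) H5.
transitivity (\int[P]_w F (w, T S Delta w)).
  by apply: eq_E => w; rewrite /F/= X0E Y1E Y0E phiY.
rewrite H5.
transitivity (c * eigmult m).
  rewrite -E_laplace -EZ.
    apply: eq_E => w; rewrite /g mulrC; congr (_ * expR (_ * _)).
    by apply/max_idPl; apply: T_ge0; exact: ltW.
  apply: (eq_L1 _ (@L1_bdd _ _ _ _ (fun w => ex (T S Delta w)) _ 1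
    (measurableT_comp mg0 mTD) (fun w => gle _) (L1_cst P 1))) => w.
  by rewrite mulr1 /ex (max_idPl _)//; apply: T_ge0; exact: ltW.
rewrite mulrC /c -EZ.
  by apply: eq_E => w; rewrite !Y0E mulrCA -[in RHS]/phi' phiE.
exact: LB (LX _ (lexx 0)).
Qed.

End SubordinateChain.
End SubordinateDiffusion.

(** * Expectations of random matrices *)

Section MatrixExpectation.
Context (R : realType) (d : measure_display) (T : measurableType d)
        (P : probability T R).

(** Measurability of all entries of a matrix valued function. *)
Definition mx_measurable (d' : measure_display) (U : measurableType d')
    (a b : nat) (Z : U -> 'M[R]_(a, b)) : Prop :=
  forall i j, measurable_fun setT (fun w => Z w i j).

Lemma mx_measurable_mul (d' : measure_display) (U : measurableType d')
    (a b c : nat) (Z : U -> 'M[R]_(a, b)) (Z' : U -> 'M[R]_(b, c)) :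
  mx_measurable Z -> mx_measurable Z' -> mx_measurable (fun w => Z w *m Z' w).
Proof.
move=> mZ mZ' i j; rewrite (_ : (fun w => _) = fun w => \sum_k Z w i k * Z' w k j).
  by apply: measurable_sum => k; exact: measurable_funM.
by apply/funext => w; rewrite mxE.
Qed.

Lemma mx_measurable_tr (d' : measure_display) (U : measurableType d')
    (a b : nat) (Z : U -> 'M[R]_(a, b)) :
  mx_measurable Z -> mx_measurable (fun w => (Z w)^T).
Proof.
move=> mZ i j; apply: eq_measurable_fun (mZ j i) => w _; by rewrite mxE.
Qed.

Lemma measurable_det (d' : measure_display) (U : measurableType d')
    (a : nat) (Z : U -> 'M[R]_a) :
  mx_measurable Z -> measurable_fun setT (fun w => \det (Z w)).
Proof.
move=> mZ; apply: measurable_sum => s; apply: measurable_funM => //.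
pose F r w := \prod_(i <- r) Z w i (perm.fun_of_perm s i).
rewrite -[X in measurable_fun _ X]/(F (index_enum 'I_a)) /F.
elim: (index_enum _) => [|i r ih].
  by under eq_fun do rewrite big_nil; exact: measurable_cst.
by under eq_fun do rewrite big_cons; exact: measurable_funM.
Qed.

Lemma mx_measurable_adj (d' : measure_display) (U : measurableType d')
    (a : nat) (Z : U -> 'M[R]_a) :
  mx_measurable Z -> mx_measurable (fun w => \adj (Z w)).
Proof.
move=> mZ i j.
rewrite (_ : (fun w => _) = fun w => (-1) ^+ (j + i) * \det (row' j (col' i (Z w)))).
  apply: measurable_funM => //; apply: measurable_det => k l.
  rewrite (_ : (fun w => _) = fun w => Z w (lift j k) (lift i l))//.
  by apply/funext => w; rewrite !mxE.
by apply/funext => w; rewrite mxE /cofactor.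
Qed.

Lemma mx_measurable_scale (d' : measure_display) (U : measurableType d')
    (a b : nat) (c : U -> R) (Z : U -> 'M[R]_(a, b)) :
  measurable_fun setT c -> mx_measurable Z -> mx_measurable (fun w => c w *: Z w).
Proof.
move=> mc mZ i j; rewrite (_ : (fun w => _) = fun w => c w * Z w i j).
  exact: measurable_funM.
by apply/funext => w; rewrite mxE.
Qed.

(** Cramer's formula: unlike invmx, it has entries that are rational functions
    also at singular matrices. *)
Definition cramer a (A : 'M[R]_a) : 'M[R]_a := (\det A)^-1 *: \adj A.

Lemma cramerE a (A : 'M[R]_a) : A \in unitmx -> cramer A = invmx A.
Proof. by move=> uA; rewrite /cramer /invmx uA. Qed.

Lemma measurable_inv : measurable_fun setT (fun x : R => x^-1).
Proof.
have mN : measurable (~` [set (0 : R)]) by apply: measurableC.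
rewrite -(setUv [set (0 : R)]); apply/measurable_funU => //; split.
  exact: measurable_fun_set1.
apply: open_continuous_measurable_fun; first exact/closed_openC/closed_eq.
by move=> x; rewrite inE/= => /eqP x0; exact: inv_continuous.
Qed.

Lemma mx_measurable_cramer (d' : measure_display) (U : measurableType d')
    (a : nat) (Z : U -> 'M[R]_a) :
  mx_measurable Z -> mx_measurable (fun w => cramer (Z w)).
Proof.
move=> mZ; apply: mx_measurable_scale; last exact: mx_measurable_adj.
exact: (measurableT_comp measurable_inv (measurable_det mZ)).
Qed.

Lemma mx_integrable_measurable (a b : nat) (Z : T -> 'M[R]_(a, b)) :
  mx_integrable P Z -> mx_measurable Z.
Proof. by move=> LZ i j; apply: (L1_meas (P := P)); exact: LZ. Qed.

Lemma mx_integrable_tr (a b : nat) (Z : T -> 'M[R]_(a, b)) :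
  mx_integrable P Z -> mx_integrable P (fun w => (Z w)^T).
Proof.
by move=> LZ i j; apply: (eq_L1 (Z := fun w => Z w j i)) => [w|]; [rewrite mxE|exact: LZ].
Qed.

Lemma Emx_tr (a b : nat) (Z : T -> 'M[R]_(a, b)) :
  Emx P (fun w => (Z w)^T) = (Emx P Z)^T.
Proof. by apply/matrixP => i j; rewrite !mxE; apply: eq_E => w; rewrite mxE. Qed.

Lemma mx_integrableD (a b : nat) (Z Z' : T -> 'M[R]_(a, b)) :
  mx_integrable P Z -> mx_integrable P Z' -> mx_integrable P (fun w => Z w + Z' w).
Proof.
move=> LZ LZ' i j; apply: (eq_L1 (Z := fun w => Z w i j + Z' w i j)) => [w|].
  by rewrite mxE.
by apply: L1D; [exact: LZ|exact: LZ'].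
Qed.

Lemma EmxD (a b : nat) (Z Z' : T -> 'M[R]_(a, b)) :
  mx_integrable P Z -> mx_integrable P Z' ->
  Emx P (fun w => Z w + Z' w) = Emx P Z + Emx P Z'.
Proof.
move=> LZ LZ'; apply/matrixP => i j; rewrite !mxE.
by rewrite -(ED (LZ i j) (LZ' i j)); apply: eq_E => w; rewrite mxE.
Qed.

Lemma mx_integrable_mull (a b c : nat) (A : 'M[R]_(a, b)) (Z : T -> 'M[R]_(b, c)) :
  mx_integrable P Z -> mx_integrable P (fun w => A *m Z w).
Proof.
move=> LZ i j; apply: (eq_L1 (Z := fun w => \sum_k A i k * Z w k j)) => [w|].
  by rewrite mxE.
by apply: L1_sum => k _; apply: L1Z; exact: LZ.
Qed.

Lemma Emx_mull (a b c : nat) (A : 'M[R]_(a, b)) (Z : T -> 'M[R]_(b, c)) :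
  mx_integrable P Z -> Emx P (fun w => A *m Z w) = A *m Emx P Z.
Proof.
move=> LZ; apply/matrixP => i j; rewrite !mxE.
transitivity (\int[P]_w \sum_k A i k * Z w k j).
  by apply: eq_E => w; rewrite mxE.
rewrite E_sum; last by move=> k _; apply: L1Z; exact: LZ.
by apply: eq_bigr => k _; rewrite mxE; apply: EZ; exact: LZ.
Qed.

Lemma mx_integrable_mulr (a b c : nat) (Z : T -> 'M[R]_(a, b)) (B : 'M[R]_(b, c)) :
  mx_integrable P Z -> mx_integrable P (fun w => Z w *m B).
Proof.
move=> LZ i j; apply: (eq_L1 (Z := fun w => \sum_k B k j * Z w i k)) => [w|].
  by rewrite mxE; apply: eq_bigr => k _; rewrite mulrC.
by apply: L1_sum => k _; apply: L1Z; exact: LZ.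
Qed.

Lemma Emx_mulr (a b c : nat) (Z : T -> 'M[R]_(a, b)) (B : 'M[R]_(b, c)) :
  mx_integrable P Z -> Emx P (fun w => Z w *m B) = Emx P Z *m B.
Proof.
move=> LZ; apply: trmx_inj; rewrite -Emx_tr trmx_mul.
rewrite -(Emx_tr Z) -Emx_mull; last exact: mx_integrable_tr.
by congr (Emx P _); apply/funext => w; rewrite trmx_mul.
Qed.

Lemma mx_integrableB (a b : nat) (Z Z' : T -> 'M[R]_(a, b)) :
  mx_integrable P Z -> mx_integrable P Z' -> mx_integrable P (fun w => Z w - Z' w).
Proof.
move=> LZ LZ' i j; apply: (eq_L1 (Z := fun w => Z w i j - Z' w i j)) => [w|].
  by rewrite !mxE.
by apply: L1B; [exact: LZ|exact: LZ'].
Qed.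

Lemma EmxB (a b : nat) (Z Z' : T -> 'M[R]_(a, b)) :
  mx_integrable P Z -> mx_integrable P Z' ->
  Emx P (fun w => Z w - Z' w) = Emx P Z - Emx P Z'.
Proof.
move=> LZ LZ'; apply/matrixP => i j; rewrite !mxE.
by rewrite -(EB (LZ i j) (LZ' i j)); apply: eq_E => w; rewrite !mxE.
Qed.

Lemma mx_integrable_ae (a b : nat) (Z Z' : T -> 'M[R]_(a, b)) :
  mx_measurable Z' -> {ae P, forall w, Z w = Z' w} ->
  mx_integrable P Z -> mx_integrable P Z'.
Proof.
move=> mZ' h LZ i j; apply: (L1_ae (mZ' i j) _ (LZ i j)).
by apply: filterS h => w ->.
Qed.

Lemma Emx_ae (a b : nat) (Z Z' : T -> 'M[R]_(a, b)) :
  mx_measurable Z -> mx_measurable Z' -> {ae P, forall w, Z w = Z' w} ->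
  Emx P Z = Emx P Z'.
Proof.
move=> mZ mZ' h; apply/matrixP => i j; rewrite !mxE; apply: E_ae => //.
by apply: filterS h => w ->.
Qed.

Lemma psd_Emx (k : nat) (Z : T -> 'cV[R]_k) :
  mx_integrable P (fun w => Z w *m (Z w)^T) -> psd (Emx P (fun w => Z w *m (Z w)^T)).
Proof.
move=> LZ; split.
  rewrite -Emx_tr; congr (Emx P _); apply/funext => w.
  by rewrite trmx_mul trmxK.
move=> x; rewrite -Emx_mull// -Emx_mulr; last exact: mx_integrable_mull.
rewrite mxE; apply: Rintegral_ge0 => w _.
rewrite mulmxA -mulmxA (_ : x^T *m Z w = ((Z w)^T *m x)^T); last first.
  by rewrite trmx_mul trmxK.
by rewrite mxE; apply: sumr_ge0 => i _; rewrite mxE -expr2 sqr_ge0.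
Qed.

(** If E[Z Z*'] = E[Z* Z*'], then E[Z Z'] - E[Z* Z*'] = E[(Z - Z* )(Z - Z* )']. *)
Lemma psd_EmxB (k : nat) (Z Zs : T -> 'cV[R]_k) :
  mx_integrable P (fun w => Z w *m (Z w)^T) ->
  mx_integrable P (fun w => Z w *m (Zs w)^T) ->
  mx_integrable P (fun w => Zs w *m (Zs w)^T) ->
  Emx P (fun w => Z w *m (Zs w)^T) = Emx P (fun w => Zs w *m (Zs w)^T) ->
  psd (Emx P (fun w => Z w *m (Z w)^T) - Emx P (fun w => Zs w *m (Zs w)^T)).
Proof.
move=> LZZ LZS LSS cross.
have LSZ := mx_integrable_tr LZS.
have E w : (Z w - Zs w) *m (Z w - Zs w)^T =
    Z w *m (Z w)^T - Z w *m (Zs w)^T - ((Z w *m (Zs w)^T)^T - Zs w *m (Zs w)^T).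
  by rewrite linearB/= mulmxBl !mulmxBr trmx_mul trmxK.
have L1 := mx_integrableB LZZ LZS; have L2 := mx_integrableB LSZ LSS.
suff <- : Emx P (fun w => (Z w - Zs w) *m (Z w - Zs w)^T) =
    Emx P (fun w => Z w *m (Z w)^T) - Emx P (fun w => Zs w *m (Zs w)^T).
  apply: psd_Emx; rewrite (_ : (fun w => _) = (fun w => Z w *m (Z w)^T - Z w *m (Zs w)^T -
    ((Z w *m (Zs w)^T)^T - Zs w *m (Zs w)^T))); last exact/funext.
  exact: mx_integrableB.
rewrite (_ : (fun w => (Z w - Zs w) *m _) = (fun w => Z w *m (Z w)^T - Z w *m (Zs w)^T -
    ((Z w *m (Zs w)^T)^T - Zs w *m (Zs w)^T))); last exact/funext.
rewrite (EmxB L1 L2) (EmxB LZZ LZS) (EmxB LSZ LSS) Emx_tr cross.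
rewrite -[X in _ - (X - _)]Emx_tr (_ : (fun w => (Zs w *m _)^T) = (fun w => Zs w *m (Zs w)^T)).
  by rewrite [X in _ - X]subrr subr0.
by apply/funext => w; rewrite trmx_mul trmxK.
Qed.

End MatrixExpectation.

(** * Means of weighted conditional means *)

Section WeightedMeans.
Context (R : realType) (d d' : measure_display) (T : measurableType d)
        (U : measurableType d') (P : probability T R).
Variables (xi : T -> U) (mxi : measurable_fun setT xi).

Lemma mx_measurable_comp (a b : nat) (Z : U -> 'M[R]_(a, b)) :
  mx_measurable Z -> mx_measurable (fun w => Z (xi w)).
Proof. by move=> mZ i j; exact: (measurableT_comp (mZ i j) mxi). Qed.

(** A random matrix may be replaced by its conditional mean in an integrable
    product with a function of the conditioning variable. *)
Lemma Emx_pullout (M a b : nat) (Z : T -> 'M[R]_(M, a)) (z : U -> 'M[R]_(M, a))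
    (N : U -> 'M[R]_(M, b)) :
  (forall m i, cexp P xi (fun w => Z w m i) (fun u => z u m i)) ->
  mx_measurable N -> mx_integrable P (fun w => (Z w)^T *m N (xi w)) ->
  mx_integrable P (fun w => (z (xi w))^T *m N (xi w)) /\
  Emx P (fun w => (Z w)^T *m N (xi w)) = Emx P (fun w => (z (xi w))^T *m N (xi w)).
Proof.
move=> hz mN LZ.
have E (Z' : T -> 'M[R]_(M, a)) i j w : ((Z' w)^T *m N (xi w)) i j =
    \sum_m N (xi w) m j * Z' w m i.
  by rewrite mxE; apply: eq_bigr => m _; rewrite mxE mulrC.
have H i j : cexp P xi (fun w => \sum_m N (xi w) m j * Z w m i)
    (fun u => \sum_m N u m j * z u m i).
  apply: (cexp_pullout mxi (a := fun m u => N u m j)) => //.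
  by apply: eq_L1 (LZ i j) => w; rewrite E.
split.
  move=> i j; apply: eq_L1 (ce_L1g (H i j)) => w.
  by rewrite (E (fun w => z (xi w))).
apply/matrixP => i j; rewrite !mxE.
transitivity (\int[P]_w (\sum_m N (xi w) m j * Z w m i)).
  by apply: eq_E => w; rewrite E.
by rewrite (cexp_E (H i j)); apply: eq_E => w; rewrite (E (fun w => z (xi w))).
Qed.

Variables (D : set U) (xiD : {ae P, forall w, D (xi w)}).
(* Lam, e1, e2 and ef are the conditional means of V V', of the derivatives of V
   in theta1 and theta2, and of V f~1'; Ws stands for W*. *)
Variables (M p1 p2 : nat) (Lam : U -> 'M[R]_M) (e1 : U -> 'M[R]_(M, p1))
  (e2 : U -> 'M[R]_(M, p2)) (ef : U -> 'M[R]_(M, p1)) (C2 C3 : 'M[R]_(p1, p2)).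
Hypotheses (mLam : mx_measurable Lam) (me1 : mx_measurable e1)
  (me2 : mx_measurable e2) (mef : mx_measurable ef).
Hypothesis uLam : forall y, D y -> Lam y \in unitmx.
Hypothesis sLam : {ae P, forall w, (Lam (xi w))^T = Lam (xi w)}.
Variable Ws : U -> 'M[R]_(M, p2).
Hypothesis mWs : mx_measurable Ws.
Hypothesis WsE : forall y, D y ->
  Ws y = invmx (Lam y) *m (e2 y + e1 y *m C2 + ef y *m C3).

Let mc := mx_measurable_comp.
Let J y := cramer (Lam y).
Let mJ : mx_measurable J. Proof. exact: mx_measurable_cramer. Qed.

(** Lambda cancels in W' Lambda W*. *)
Lemma Emx_Lam_Wstar (W : U -> 'M[R]_(M, p2)) : mx_measurable W ->
  mx_integrable P (fun w => (W (xi w))^T *m e2 (xi w)) ->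
  mx_integrable P (fun w => (W (xi w))^T *m e1 (xi w)) ->
  mx_integrable P (fun w => (W (xi w))^T *m ef (xi w)) ->
  Emx P (fun w => (W (xi w))^T *m Lam (xi w) *m Ws (xi w)) =
  Emx P (fun w => (W (xi w))^T *m e2 (xi w)) +
  Emx P (fun w => (W (xi w))^T *m e1 (xi w)) *m C2 +
  Emx P (fun w => (W (xi w))^T *m ef (xi w)) *m C3.
Proof.
move=> mW L2 L1 Lf.
have L1' := mx_integrable_mulr C2 L1; have Lf' := mx_integrable_mulr C3 Lf.
have L21 := mx_integrableD L2 L1'; have L21f := mx_integrableD L21 Lf'.
rewrite -!Emx_mulr// -EmxD// -EmxD//; apply: Emx_ae.
- apply: mx_measurable_mul; last exact: mc.
  by apply: mx_measurable_mul; [apply: mx_measurable_tr; exact: mc|exact: mc].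
- exact: mx_integrable_measurable L21f.
apply: filterS xiD => w Dw.
by rewrite WsE// -mulmxA mulKVmx ?uLam// !mulmxDr !mulmxA.
Qed.

(** The means of e' W* for a matrix e of conditional means. *)
Lemma Emx_Wstar a (e : U -> 'M[R]_(M, a)) : mx_measurable e ->
  mx_integrable P (fun w => (e (xi w))^T *m (J (xi w) *m e2 (xi w))) ->
  mx_integrable P (fun w => (e (xi w))^T *m (J (xi w) *m e1 (xi w))) ->
  mx_integrable P (fun w => (e (xi w))^T *m (J (xi w) *m ef (xi w))) ->
  Emx P (fun w => (e (xi w))^T *m Ws (xi w)) =
  Emx P (fun w => (e (xi w))^T *m (J (xi w) *m e2 (xi w))) +
  Emx P (fun w => (e (xi w))^T *m (J (xi w) *m e1 (xi w))) *m C2 +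
  Emx P (fun w => (e (xi w))^T *m (J (xi w) *m ef (xi w))) *m C3.
Proof.
move=> me L2 L1 Lf.
have L1' := mx_integrable_mulr C2 L1; have Lf' := mx_integrable_mulr C3 Lf.
have L21 := mx_integrableD L2 L1'; have L21f := mx_integrableD L21 Lf'.
rewrite -!Emx_mulr// -EmxD// -EmxD//; apply: Emx_ae.
- by apply: mx_measurable_mul; [apply: mx_measurable_tr; exact: mc|exact: mc].
- exact: mx_integrable_measurable L21f.
apply: filterS xiD => w Dw.
by rewrite WsE// /J cramerE ?uLam// !mulmxDr !mulmxA.
Qed.

(** Lambda is symmetric outside a null set, and so is its inverse. *)
Lemma Emx_swap a b (e : U -> 'M[R]_(M, a)) (e' : U -> 'M[R]_(M, b)) :
  mx_integrable P (fun w => (e (xi w))^T *m (J (xi w) *m e' (xi w))) ->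
  mx_measurable e -> mx_measurable e' ->
  mx_integrable P (fun w => (e' (xi w))^T *m (J (xi w) *m e (xi w))) /\
  Emx P (fun w => (e' (xi w))^T *m (J (xi w) *m e (xi w))) =
  (Emx P (fun w => (e (xi w))^T *m (J (xi w) *m e' (xi w))))^T.
Proof.
move=> L me me'.
have Lt := mx_integrable_tr L.
have m' : mx_measurable (fun w => (e' (xi w))^T *m (J (xi w) *m e (xi w))).
  apply: mx_measurable_mul; first by apply: mx_measurable_tr; exact: mc.
  by apply: mx_measurable_mul; exact: mc.
have h : {ae P, forall w, ((e (xi w))^T *m (J (xi w) *m e' (xi w)))^T =
    (e' (xi w))^T *m (J (xi w) *m e (xi w))}.
  apply: filterS2 xiD sLam => w Dw sw.
  rewrite !trmx_mul trmxK -mulmxA; congr (_ *m (_ *m _)).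
  by rewrite /J cramerE ?uLam// trmx_inv sw.
split; first exact: mx_integrable_ae Lt.
by rewrite -Emx_tr; apply/esym/Emx_ae => //; exact: mx_integrable_measurable Lt.
Qed.

End WeightedMeans.

(** * Matrix algebra *)

(** The mean E[G G*'], where G = F2 - B F1 and G* = F2* - Bs F1, once the moments
    in it are expressed by C2 and C3. *)
Lemma cross_covariance (K : fieldType) (p1 p2 : nat) (N : K)
    (A S11 : 'M[K]_p1) (D21 D21s : 'M[K]_(p2, p1)) (D22 S22x : 'M[K]_p2)
    (S12 S12s C2 C3 : 'M[K]_(p1, p2)) : A \in unitmx ->
  S22x = D22 + D21 *m C2 + N *: (S12^T *m C3) ->
  D21s^T = N *: (A^T *m C3) ->
  S12s = A *m C2 + N *: (S11 *m C3) ->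
  let B := D21 *m invmx A in let Bs := D21s *m invmx A in
  S22x - S12^T *m Bs^T - B *m S12s + B *m S11 *m Bs^T = D22.
Proof.
move=> uA -> D21E -> B Bs.
have -> : Bs^T = N *: C3.
  rewrite /Bs trmx_mul D21E -scalemxAr trmx_inv mulKmx ?unitmx_tr//.
rewrite mulmxDr -!scalemxAr /B -!mulmxA (mulmxA (invmx A) A) mulVmx// mul1mx.
set x := _ *m C2; set y := _ *: (_ *m C3); set z := _ *: (_ *m (_ *m _)).
clearbody x y z; apply/matrixP => i j; rewrite !mxE; ring.
Qed.

(** The two rows of the linear system; their left-hand sides below are
    E[e1' W*] and E[ef' W*] by [Emx_Wstar]. *)
Lemma normal_equations (K : fieldType) (p1 p2 : nat) (N : K)
    (A S11 Q2 Q3 Q5 : 'M[K]_p1) (Q1 Q4 C2 C3 : 'M[K]_(p1, p2)) :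
  block_mx (- Q2) (A^T - Q3) (A - Q3^T) (N *: S11 - Q5) *m col_mx C2 C3 =
    col_mx Q1 Q4 ->
  Q1 + Q2 *m C2 + Q3 *m C3 = A^T *m C3 /\
  Q4 + Q3^T *m C2 + Q5 *m C3 = A *m C2 + N *: (S11 *m C3).
Proof.
rewrite mul_block_col => /eq_col_mx[<- <-].
rewrite !mulmxBl mulNmx scalemxAl; split.
  set x := Q2 *m _; set y := A^T *m _; set z := Q3 *m _.
  by clearbody x y z; apply/matrixP => i j; rewrite !mxE; ring.
set x := A *m _; set y := Q3^T *m _; set z := (N *: S11) *m C3; set u := Q5 *m _.
by clearbody x y z u; apply/matrixP => i j; rewrite !mxE; ring.
Qed.

Lemma sandwichE (K : fieldType) (p1 p2 : nat) (B Bs : 'M[K]_(p2, p1))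
    (a : 'M[K]_p1) (b : 'M[K]_(p1, p2)) (c : 'M[K]_(p2, p1)) (e : 'M[K]_p2) :
  row_mx (- B) 1%:M *m block_mx a b c e *m col_mx (- Bs^T) 1%:M =
  e - c *m Bs^T - B *m b + B *m a *m Bs^T.
Proof.
rewrite mul_row_block mul_row_col !mul1mx mulmx1 mulNmx mulmxN mulmxDl opprD.
rewrite !mulNmx opprK.
set x := _ *m _; set y := c *m _; set z := B *m b.
by clearbody x y z; apply/matrixP => i j; rewrite !mxE; ring.
Qed.

(** * The optimal weighting matrix *)

Lemma eq_cexp (R : realType) (d d' : measure_display) (T : measurableType d)
    (U : measurableType d') (P : probability T R) (xi : T -> U) (Z Z' : T -> R)
    (g g' : U -> R) : (forall w, Z w = Z' w) -> (forall u, g u = g' u) ->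
  cexp P xi Z g -> cexp P xi Z' g'.
Proof. by move=> /funext -> /funext ->. Qed.

Lemma cond_expectation_cexp (R : realType) (d d' : measure_display)
    (T : measurableType d) (U : measurableType d') (P : probability T R)
    (xi : T -> U) (a b : nat) (Z : T -> 'M[R]_(a, b)) (g : U -> 'M[R]_(a, b)) :
  cond_expectation P xi Z g ->
  forall i j, cexp P xi (fun w => Z w i j) (fun u => g u i j).
Proof.
move=> [LZ mg Lg eqZ] i j; split => //; first exact: LZ.
  exact: Lg.
by move=> A mA; rewrite -!E_preimage; exact: eqZ.
Qed.

(** The means of products of F2 - B F1 and F2s - Bs F1. *)
Lemma Emx_influence (R : realType) (d : measure_display) (T : measurableType d)
    (P : probability T R) (p1 p2 : nat) (F1 : T -> 'cV[R]_p1)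
    (F2 F2s : T -> 'cV[R]_p2) (A As : 'M[R]_p2) (B Bs : 'M[R]_(p2, p1)) :
  mx_integrable P (fun w => F1 w *m (F1 w)^T) ->
  mx_integrable P (fun w => F1 w *m (F2 w)^T) ->
  mx_integrable P (fun w => F1 w *m (F2s w)^T) ->
  mx_integrable P (fun w => F2 w *m (F2s w)^T) ->
  let Z w := A *m (F2 w - B *m F1 w) in let Zs w := As *m (F2s w - Bs *m F1 w) in
  mx_integrable P (fun w => Z w *m (Zs w)^T) /\
  Emx P (fun w => Z w *m (Zs w)^T) =
  A *m (Emx P (fun w => F2 w *m (F2s w)^T)
        - (Emx P (fun w => F1 w *m (F2 w)^T))^T *m Bs^T
        - B *m Emx P (fun w => F1 w *m (F2s w)^T)
        + B *m Emx P (fun w => F1 w *m (F1 w)^T) *m Bs^T) *m As^T.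
Proof.
move=> L11 L12 L12s L22 Z Zs.
have L21 := mx_integrable_tr L12.
have LB := mx_integrable_mulr Bs^T L21.
have L1 := mx_integrableB L22 LB.
have LC := mx_integrable_mull B L12s.
have L2 := mx_integrableB L1 LC.
have LE := mx_integrable_mull B L11.
have LD := mx_integrable_mulr Bs^T LE.
have L3 := mx_integrableD L2 LD.
have L4 := mx_integrable_mull A L3.
have E : (fun w => Z w *m (Zs w)^T) = (fun w => A *m (F2 w *m (F2s w)^T
    - (F1 w *m (F2 w)^T)^T *m Bs^T - B *m (F1 w *m (F2s w)^T)
    + B *m (F1 w *m (F1 w)^T) *m Bs^T) *m As^T).
  apply/funext => w; rewrite /Z /Zs trmx_mul -!mulmxA; congr (A *m _).
  rewrite !mulmxA; congr (_ *m As^T).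
  rewrite linearB/= !trmx_mul trmxK mulmxBl !mulmxBr opprB -!mulmxA.
  rewrite -!addrA; congr (_ + (_ + _)).
  by rewrite addrC.
rewrite E; split; first exact: mx_integrable_mulr.
rewrite Emx_mulr// Emx_mull// EmxD// EmxB// EmxB// Emx_mulr// Emx_tr Emx_mull//.
by rewrite Emx_mulr// Emx_mull.
Qed.

Section Assembly.
Context (R : realType) (p1 p2 : nat) (d : measure_display)
        (Omega : measurableType d) (S : model R p1 p2 Omega) (Delta : R).
Variables (M n' : nat) (f1 : R -> R -> 'cV[R]_p1 -> 'cV[R]_p1).
Local Notation n := n'.+1.
Hypothesis Delta_gt0 : 0 < Delta.
Hypothesis HS : subordinate_diffusion S.
Hypothesis Hf1 : moment_function S Delta f1.
Variables (th1 : 'cV[R]_p1) (th2 : 'cV[R]_p2).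
Hypotheses (Hth1 : Theta1 S th1) (Hth2 : Theta2 S th2).
Hypothesis HdV1 : forall y1 y2, inner S y1 -> inner S y2 ->
  dtheta_exists (fun t => V S Delta M y1 y2 t th2) th1.
Hypothesis HdV2 : forall y1 y2, inner S y1 -> inner S y2 ->
  dtheta_exists (fun t => V S Delta M y1 y2 th1 t) th2.
Local Notation P := (prob S th1 th2).
Local Notation RT := (measurableTypeR R).
Local Notation Yi i := (Y S Delta i : Omega -> RT).
Local Notation pair i := (fun w => (Yi i w, Yi i.+1 w)).
Variables (Lambda : R -> 'M[R]_M) (EdV1 : R -> 'M[R]_(M, p1))
  (EdV2 : R -> 'M[R]_(M, p2)) (ft1 : R * R -> 'cV[R]_p1) (EVf : R -> 'M[R]_(M, p1)).
Local Notation vE w := (V S Delta M (Yi 0 w) (Yi 1 w) th1 th2).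
Hypothesis HLam : cond_expectation P (Yi 0) (fun w => vE w *m (vE w)^T) Lambda.
Hypothesis HEdV1 : cond_expectation P (Yi 0)
  (fun w => dV1 S Delta M (Yi 0 w) (Yi 1 w) th1 th2) EdV1.
Hypothesis HEdV2 : cond_expectation P (Yi 0)
  (fun w => dV2 S Delta M (Yi 0 w) (Yi 1 w) th1 th2) EdV2.
Hypothesis Hft : cond_expectation P (fun w => (Yi 0 w, Yi 1 w))
  (f1_sum S Delta n f1 th1) ft1.
Hypothesis HEVf : cond_expectation P (Yi 0)
  (fun w => vE w *m (ft1 (Yi 0 w, Yi 1 w))^T) EVf.

Let mY i : measurable_fun setT (Yi i) := measurable_Y HS Hth1 Hth2 Delta_gt0 i.
Let markov := @Y_markov _ _ _ _ _ _ _ _ HS Hth1 Hth2 _ Delta_gt0.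
Let stat := @Y_stationary _ _ _ _ _ _ _ _ HS Hth1 Hth2 _ Delta_gt0.
Let Yst := @Y_state _ _ _ _ _ _ _ _ HS Hth1 Hth2 _ Delta_gt0.
Let Yin := @Y_inner _ _ _ _ _ _ _ _ HS Hth1 Hth2 _ Delta_gt0.
Let mSt : measurable (state S : set RT) := measurable_state HS.
Let mIn : measurable (inner S : set RT) := measurable_inner S.
Let InSt : inner S `<=` state S := (sd_state HS).1.

Let ph m : RT -> R := eigfun S th1 m \_ (state S).
Let mph m : measurable_fun setT (ph m).
Proof. exact: (measurable_patch_state HS (measurable_eigfun HS Hth1 m)). Qed.
Let phE m y : state S y -> ph m y = eigfun S th1 m y.
Proof. exact: patch_state. Qed.

(* V as a function of consecutive values of Y, extended by 0. *)
Let v (m : 'I_M) (u : RT * RT) : R :=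
  ph m.+1 u.2 - eigmult S th1 th2 Delta m.+1 * ph m.+1 u.1.

Let mv m : measurable_fun setT (v m).
Proof.
apply: measurable_funB; first exact: (measurableT_comp (mph m.+1) measurable_snd).
by apply: measurable_funM => //; exact: (measurableT_comp (mph m.+1) measurable_fst).
Qed.

Let vV m y z : state S y -> state S z -> v m (y, z) = V S Delta M y z th1 th2 m 0.
Proof. by move=> ys zs; rewrite mxE /v/= !phE. Qed.

Let v0 m : cexp P (Yi 0) (fun w => v m (pair 0 w)) (fun=> 0).
Proof.
have h := @Y_eigfun _ _ _ _ _ _ _ _ HS Hth1 Hth2 _ Delta_gt0 m.+1.
have L0 : L1 P (ph m.+1 \o Yi 0).
  have := ce_L1 h => _.
  have := L1_Y HS Hth1 Hth2 Delta_gt0 0 (measurable_eigfun HS Hth1 m.+1)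
    (eigfun_L2 HS Hth1 Hth2 m.+1 (lexx 0)).2.
  by apply: eq_L1 => w; rewrite /= phE.
have h0 := cexp_Z (mY 0) (- eigmult S th1 th2 Delta m.+1) (cexp_self (P := P) (mph m.+1) L0).
apply: eq_cexp (cexp_D (mY 0) h h0) => [w|y]; last by rewrite mulNr subrr.
by rewrite /v/= mulNr -(phE m.+1 (@Yst 1 w)).
Qed.

Let vv m k : cexp P (Yi 0) (fun w => v m (pair 0 w) * v k (pair 0 w))
  (fun y => Lambda y m k).
Proof.
apply: eq_cexp (cond_expectation_cexp HLam m k) => // w.
by rewrite mxE big_ord1 [X in _ * X]mxE !vV//; exact: Yst.
Qed.

(* The components of f1, extended by 0. *)
Let f k : RT * RT -> R := (fun z => f1 z.1 z.2 th1 k 0) \_ (state S `*` state S).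

Let mf k : measurable_fun setT (f k).
Proof.
apply: (measurable_restrictT _ _).1; first exact: measurableX.
exact: (mf_meas Hf1 k Hth1).
Qed.

Let fE k i w : f k (pair i w) = f1 (Yi i w) (Yi i.+1 w) th1 k 0.
Proof. by rewrite /f patchE mem_set//; split; exact: Yst. Qed.

Let Lf k : L1 P (fun w => f k (pair 0 w)).
Proof. by apply: eq_L1 (mf_integrable Hf1 Hth1 Hth2 k 0) => w; rewrite fE. Qed.

Let F1E k w : F1obs S Delta n f1 th1 w k 0 = \sum_(j < n) f k (pair j w).
Proof. by rewrite /F1obs /F1 summxE; apply: eq_bigr => j _; rewrite fE. Qed.

Let ftE k : cexp P (pair 0)
  (fun w => \sum_(j < n) (n - j)%:R * f k (pair j w)) (fun u => ft1 u k 0).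
Proof.
apply: eq_cexp (cond_expectation_cexp Hft k 0) => // w.
rewrite /f1_sum summxE; apply: eq_bigr => j _.
by rewrite mxE fE.
Qed.

Let VfE k m : cexp P (Yi 0) (fun w => v m (pair 0 w) * ft1 (pair 0 w) k 0)
  (fun y => EVf y m k).
Proof.
apply: eq_cexp (cond_expectation_cexp HEVf m k) => // w.
by rewrite mxE big_ord1 [X in _ * X]mxE vV//; exact: Yst.
Qed.

(** The values of a weighting matrix at (th1, th2), set to 0 outside the state
    space, where weights need not be measurable. *)
Definition state_weight (W : weight R p1 p2 M) (y : RT) : 'M[R]_(M, p2) :=
  \matrix_(m, l) ((fun y => W y th1 th2 m l) \_ (state S)) y.

Section OneWeight.
Variables (W : weight R p1 p2 M) (HW : calW S Delta n f1 th1 th2 W).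
Local Notation Wp := (state_weight W).

Lemma state_weightE y : state S y -> Wp y = W y th1 th2.
Proof. by move=> ys; apply/matrixP => m l; rewrite mxE patch_state. Qed.

Lemma measurable_state_weight : mx_measurable Wp.
Proof.
move=> m l; rewrite (_ : (fun w => _) = (fun y => W y th1 th2 m l) \_ (state S)).
  by apply: (measurable_patch_state HS); exact: (cw_meas HW m l Hth1 Hth2).
by apply/funext => y; rewrite mxE.
Qed.

Local Lemma F2E l w : F2obs S Delta n th1 th2 W w l 0 =
  \sum_(i < n) wterm v (fun m y => Wp y m l) (pair i w).
Proof.
rewrite /F2obs /F2 summxE; apply: eq_bigr => i _.
rewrite /WV /wterm mxE; apply: eq_bigr => m _.
by rewrite mxE /= state_weightE ?vV//; exact: Yst.
Qed.

(** The mean derivative of the estimating function in a parameter x, of which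
    both parameters of the model are functions. *)
Let E_dF2 (p : nat) (Th : set 'cV[R]_p) (x : 'cV[R]_p) (a : 'cV[R]_p -> 'cV[R]_p1)
    (b : 'cV[R]_p -> 'cV[R]_p2) (EdV : R -> 'M[R]_(M, p)) :
  open Th -> Th x -> a x = th1 -> b x = th2 ->
  (forall t, Th t -> Theta1 S (a t) /\ Theta2 S (b t)) ->
  (forall y1 y2, inner S y1 -> inner S y2 ->
     dtheta_exists (fun t => V S Delta M y1 y2 (a t) (b t)) x) ->
  cond_expectation P (Yi 0)
    (fun w => dtheta (fun t => V S Delta M (Yi 0 w) (Yi 1 w) (a t) (b t)) x) EdV ->
  (forall y, (forall i, inner S (y i)) ->
     dtheta_exists (fun t => F2 S Delta n W y (a t) (b t)) x) ->
  mx_integrable P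
    (fun w => dtheta (fun t => F2 S Delta n W (Yobs S Delta w) (a t) (b t)) x) ->
  (forall i, (i < n)%N -> mx_integrable P (fun w =>
     dtheta (fun t => WV S Delta W (Y S Delta i w) (Y S Delta i.+1 w) (a t) (b t)) x)) ->
  mx_integrable P (fun w => (Wp (Yi 0 w))^T *m EdV (Yi 0 w)) /\
  Emx P (fun w => dtheta (fun t => F2 S Delta n W (Yobs S Delta w) (a t) (b t)) x) =
  n%:R *: Emx P (fun w => (Wp (Yi 0 w))^T *m EdV (Yi 0 w)).
Proof.
move=> oTh Thx ax bx Thab HdV HEdV HdF LdF LdWV.
pose w k m (y : RT) (t : 'cV[R]_p) : R := W y (a t) (b t) m k.
pose vt m (u : RT * RT) (t : 'cV[R]_p) : R := V S Delta M u.1 u.2 (a t) (b t) m 0.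
have WVE k y z : (fun t => WV S Delta W y z (a t) (b t) k 0) =
    (fun t => \sum_m w k m y t * vt m (y, z) t).
  by apply/funext => t; rewrite mxE; apply: eq_bigr => m _; rewrite mxE.
have F2t k (y : nat -> R) : (fun t => F2 S Delta n W y (a t) (b t) k 0) =
    (fun t => \sum_(i < n) \sum_m w k m (y i) t * vt m (y i, y i.+1) t).
  apply/funext => t; rewrite summxE; apply: eq_bigr => i _.
  exact: (congr1 (fun f => f t) (WVE k (y i) (y i.+1))).
have mvt m t : Th t ->
    measurable_fun (inner S `*` inner S : set (RT * RT)) (fun u => vt m u t).
  move=> /Thab[Ta Tb].
  have me (q : RT * RT -> RT) : measurable_fun setT q ->
      (forall u, (inner S `*` inner S) u -> inner S (q u)) ->
      measurable_fun (inner S `*` inner S : set (RT * RT))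
        (fun u => eigfun S (a t) m.+1 (q u)).
    move=> mq qI.
    apply: (@measurable_comp _ _ _ _ _ _ (state S) (eigfun S (a t) m.+1) _ q mSt).
    - by move=> _ [u /qI qu <-]; exact: InSt.
    - exact: (measurable_eigfun HS Ta).
    - exact: measurable_funTS.
  rewrite (_ : (fun u => _) = (fun u => eigfun S (a t) m.+1 u.2 -
    expR (- laplace S (b t) (- eigval S (a t) m.+1) * Delta) * eigfun S (a t) m.+1 u.1)).
    apply: measurable_funB; first by apply: me => // -[? ?] [].
    by apply: measurable_funM => //; apply: me => // -[? ?] [].
  by apply/funext => u; rewrite /vt mxE.
have H k l := @E_derive_wsum R _ _ Omega RT P (fun i => Yi i) mY _ markov stat
  (inner S) mIn Yin _ Th oTh x (delta_mx l 0) Thx M n' (w k) vt.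
have Hkl k l : L1 P (fun o => \sum_m Wp (Yi 0 o) m k * EdV (Yi 0 o) m l) /\
   \int[P]_o 'D_(delta_mx l 0) (fun t => \sum_(i < n) \sum_m
      w k m (pair i o).1 t * vt m (pair i o) t) x =
   n%:R * \int[P]_o (\sum_m Wp (Yi 0 o) m k * EdV (Yi 0 o) m l).
  apply: (H k l _ _ _ _ _ (fun m y => Wp y m k) (fun m y => EdV y m l)) => //.
  - move=> m t /Thab[Ta Tb]; apply: measurable_funS (cw_meas HW m k Ta Tb) => //.
  - by move=> m [y z] [/= yi zi]; exact: HdV.
  - move=> y Hy; rewrite -F2t; exact: HdF.
  - move=> y yi; have [c [ci uc]] := V_spanning HS Hth1 Hth2 Delta M y.
    by exists c; split => //; rewrite /vt/= ax bx.
  - by move=> m; exact: measurable_state_weight.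
  - by move=> m y yi; rewrite state_weightE /w ?ax ?bx//; exact: InSt.
  - move=> m; apply: eq_cexp (v0 m) => // o; rewrite /vt ax bx.
    by rewrite vV//; exact: Yst.
  - move=> m; apply: eq_cexp (cond_expectation_cexp HEdV m l) => // o.
    by rewrite mxE.
  - move=> i ni; apply: eq_L1 (LdWV i ni k l) => o; rewrite mxE.
    by rewrite WVE.
  - apply: eq_L1 (LdF k l) => o; rewrite mxE.
    by rewrite F2t.
split.
  move=> k l; apply: eq_L1 (Hkl k l).1 => o; rewrite [RHS]mxE.
  by apply: eq_bigr => m _; rewrite [X in _ = X * _]mxE.
apply/matrixP => k l; rewrite !mxE.
transitivity (\int[P]_o 'D_(delta_mx l 0) (fun t => \sum_(i < n) \sum_m
      w k m (pair i o).1 t * vt m (pair i o) t) x).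
  by apply: eq_E => o; rewrite mxE F2t.
rewrite (Hkl k l).2; congr (_ * _); apply: eq_E => o; rewrite mxE.
by apply: eq_bigr => m _; rewrite [X in _ = X * _]mxE.
Qed.

(** The mean formulas for D21, D22, S12 and, below, the second moments of F2. *)
Lemma E_dF21 : mx_integrable P (fun w => (Wp (Yi 0 w))^T *m EdV1 (Yi 0 w)) /\
  D21 S Delta n th1 th2 W = n%:R *: Emx P (fun w => (Wp (Yi 0 w))^T *m EdV1 (Yi 0 w)).
Proof.
apply: (@E_dF2 p1 (Theta1 S) th1 id (fun=> th2)) => //.
- exact: (sd_open HS).1.
- exact: (cw_dF21 HW).
- exact: (cw_D21 HW).
- exact: (cw_WV1 HW).
Qed.

Lemma E_dF22 : mx_integrable P (fun w => (Wp (Yi 0 w))^T *m EdV2 (Yi 0 w)) /\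
  D22 S Delta n th1 th2 W = n%:R *: Emx P (fun w => (Wp (Yi 0 w))^T *m EdV2 (Yi 0 w)).
Proof.
apply: (@E_dF2 p2 (Theta2 S) th2 (fun=> th1) id) => //.
- exact: (sd_open HS).2.
- exact: (cw_dF22 HW).
- exact: (cw_D22 HW).
- exact: (cw_WV2 HW).
Qed.

Local Lemma F1_L2 k : L1 P (fun w => (\sum_(j < n) f k (pair j w)) ^+ 2).
Proof.
apply: eq_L1 (cw_S11 HW k k) => w.
by rewrite mxE big_ord1 [X in _ * X]mxE F1E -expr2.
Qed.

Local Lemma F2_L2 l : L1 P (fun w =>
  (\sum_(i < n) wterm v (fun m y => Wp y m l) (pair i w)) ^+ 2).
Proof.
apply: eq_L1 (cw_S22 HW l l) => w.
by rewrite mxE big_ord1 [X in _ * X]mxE F2E -expr2.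
Qed.

Lemma E_F1F2 : mx_integrable P (fun w => (Wp (Yi 0 w))^T *m EVf (Yi 0 w)) /\
  (S12 S Delta n f1 th1 th2 W)^T =
  Emx P (fun w => (Wp (Yi 0 w))^T *m EVf (Yi 0 w)).
Proof.
have H l k := @E_fsum_wsum _ _ _ _ _ P (fun i => Yi i) mY _ markov stat M v mv v0
  (f k) (mf k) (Lf k) n (fun u => ft1 u k 0) (fun m y => EVf y m k)
  (ftE k) (VfE k) (fun m y => Wp y m l) (fun m => measurable_state_weight m l)
  (wterm_L2 mY markov stat mv v0 vv (fun m => measurable_state_weight m l)
    (F2_L2 l)) (F1_L2 k).
split.
  move=> l k; apply: eq_L1 (H l k).1 => w; rewrite mxE.
  by apply: eq_bigr => m _; rewrite [X in _ = X * _]mxE.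
apply/matrixP => l k; rewrite !mxE.
transitivity (\int[P]_w ((\sum_(j < n) f k (pair j w)) *
    (\sum_(i < n) wterm v (fun m y => Wp y m l) (pair i w)))).
  by apply: eq_E => w; rewrite mxE big_ord1 [X in _ * X]mxE F1E F2E.
rewrite (H l k).2; apply: eq_E => w; rewrite mxE.
by apply: eq_bigr => m _; rewrite [X in _ = X * _]mxE.
Qed.

End OneWeight.

Lemma E_F2F2 (W W' : weight R p1 p2 M) : calW S Delta n f1 th1 th2 W ->
  calW S Delta n f1 th1 th2 W' ->
  mx_integrable P (fun w => F2obs S Delta n th1 th2 W w *m
    (F2obs S Delta n th1 th2 W' w)^T) /\
  Emx P (fun w => F2obs S Delta n th1 th2 W w *m
    (F2obs S Delta n th1 th2 W' w)^T) =
  n%:R *: Emx P (fun w => (state_weight W (Yi 0 w))^T *m Lambda (Yi 0 w)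
    *m state_weight W' (Yi 0 w)).
Proof.
move=> HW HW'.
have mW m l := measurable_state_weight HW m l.
have mW' m l := measurable_state_weight HW' m l.
have LF l := F2_L2 HW l; have LF' l := F2_L2 HW' l.
have H l l' := @E_wsum_wsum _ _ _ _ _ P (fun i => Yi i) mY _ markov stat M v mv v0
  (fun m k y => Lambda y m k) vv (fun m y => state_weight W y m l)
  (fun m y => state_weight W' y m l') n' (fun m => mW m l) (fun m => mW' m l')
  (LF l) (LF' l').
have mS W0 : calW S Delta n f1 th1 th2 W0 -> forall l, measurable_fun setT
    (fun w => \sum_(i < n) wterm v (fun m y => state_weight W0 y m l) (pair i w)).
  move=> HW0 l; apply: measurable_sum => i.
  apply: (measurableT_comp (measurable_wterm mv (fun m => measurable_state_weight HW0 m l))).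
  by apply/measurable_fun_pairP; split; exact: mY.
split.
  move=> l l'; apply: eq_L1 (L1_mul (mS _ HW l) (mS _ HW' l') (LF l) (LF' l')) => w.
  by rewrite [RHS]mxE big_ord1 [X in _ = _ * X]mxE !F2E.
apply/matrixP => l l'; rewrite mxE [RHS]mxE [X in _ = _ * X]mxE.
transitivity (\int[P]_w ((\sum_(i < n) wterm v (fun m y => state_weight W y m l) (pair i w)) *
   (\sum_(i < n) wterm v (fun m y => state_weight W' y m l') (pair i w)))).
  by apply: eq_E => w; rewrite [LHS]mxE big_ord1 [X in _ * X = _]mxE !F2E.
rewrite (H l l').2; congr (_ * _); apply: eq_E => w.
rewrite exchange_big [RHS]mxE; apply: eq_bigr => k _ /=.
rewrite [X in _ = X * _]mxE mulr_suml; apply: eq_bigr => m _.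
by rewrite [X in _ = X * _ * _]mxE mulrAC.
Qed.

(* The random vector Z of a weighting matrix, the second moment of which is avar. *)
Let infl (W : weight R p1 p2 M) w :=
  invmx (D22 S Delta n th1 th2 W) *m (F2obs S Delta n th1 th2 W w -
    D21 S Delta n th1 th2 W *m invmx (D11 S Delta n f1 th1 th2)
      *m F1obs S Delta n f1 th1 w).

Hypothesis uLam : forall y, inner S y -> Lambda y \in unitmx.
Hypothesis uD : D11 S Delta n f1 th1 th2 \in unitmx.
Variables (Wstar : weight R p1 p2 M) (C2 C3 : 'M[R]_(p1, p2)).
Hypothesis HWs : calW S Delta n f1 th1 th2 Wstar.
Hypothesis WsE : forall y, inner S y -> Wstar y th1 th2 =
  invmx (Lambda y) *m (EdV2 y + EdV1 y *m C2 + EVf y *m C3).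
Local Notation dv1 w := (dV1 S Delta M (Yi 0 w) (Yi 1 w) th1 th2).
Local Notation ft w := (ft1 (Yi 0 w, Yi 1 w)).
Local Notation iL w := (invmx (Lambda (Yi 0 w))).
Local Notation J := (fun y : RT => cramer (Lambda y)).
Let q1 w := (dv1 w)^T *m iL w *m EdV2 (Yi 0 w).
Let q2 w := (dv1 w)^T *m iL w *m EdV1 (Yi 0 w).
Let q3 w := (dv1 w)^T *m iL w *m EVf (Yi 0 w).
Let q4 w := ft w *m (vE w)^T *m iL w *m EdV2 (Yi 0 w).
Let q5 w := ft w *m (vE w)^T *m iL w *m EVf (Yi 0 w).
Hypotheses (Lq1 : mx_integrable P q1) (Lq2 : mx_integrable P q2)
  (Lq3 : mx_integrable P q3) (Lq4 : mx_integrable P q4) (Lq5 : mx_integrable P q5).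
Local Notation D := (D11 S Delta n f1 th1 th2).
Local Notation S11' := (S11 S Delta n f1 th1 th2).
Hypothesis system : block_mx (- Emx P q2) (D^T - Emx P q3)
  (D - (Emx P q3)^T) (n%:R *: S11' - Emx P q5) *m col_mx C2 C3 =
  col_mx (Emx P q1) (Emx P q4).

Let cexp_mx_meas a b (Z : Omega -> 'M[R]_(a, b)) (z : R -> 'M[R]_(a, b)) :
  cond_expectation P (Yi 0) Z z -> mx_measurable (z : RT -> _).
Proof. by case. Qed.

Let sLam : {ae P, forall w, (Lambda (Yi 0 w))^T = Lambda (Yi 0 w)}.
Proof.
have h m k : {ae P, forall w, Lambda (Yi 0 w) m k = Lambda (Yi 0 w) k m}.
  have vvC : cexp P (Yi 0) (fun w => v m (pair 0 w) * v k (pair 0 w))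
      (fun y => Lambda y k m).
    by apply: eq_cexp (vv k m) => // w; rewrite mulrC.
  have Q := cexp_uniq (mY 0) (vv m k) vvC. exact: Q.
have h2 m : {ae P, forall w, forall k, Lambda (Yi 0 w) m k = Lambda (Yi 0 w) k m}.
  exact: filter_forall.
have : {ae P, forall w, forall m k, Lambda (Yi 0 w) m k = Lambda (Yi 0 w) k m}.
  exact: filter_forall.
by apply: filterS => w hw; apply/matrixP => m k; rewrite mxE hw.
Qed.

(* The matrices Q1, ..., Q5, with the random matrix Z replaced by its conditional
   mean z. *)
Let E_q a b (Z : Omega -> 'M[R]_(M, a)) (z : R -> 'M[R]_(M, a))
    (e : RT -> 'M[R]_(M, b)) :
  cond_expectation P (Yi 0) Z z -> mx_measurable e ->
  mx_integrable P (fun w => (Z w)^T *m iL w *m e (Yi 0 w)) ->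
  mx_integrable P (fun w => (z (Yi 0 w))^T *m (J (Yi 0 w) *m e (Yi 0 w))) /\
  Emx P (fun w => (Z w)^T *m iL w *m e (Yi 0 w)) =
  Emx P (fun w => (z (Yi 0 w))^T *m (J (Yi 0 w) *m e (Yi 0 w))).
Proof.
move=> hZ me LZ.
pose N (y : RT) := J y *m e y.
have mN : mx_measurable N.
  by apply: mx_measurable_mul => //; apply: mx_measurable_cramer; exact: cexp_mx_meas HLam.
have mZ : mx_measurable Z by case: hZ => LZ0 _ _ _; exact: mx_integrable_measurable LZ0.
have mZN : mx_measurable (fun w => (Z w)^T *m N (Yi 0 w)).
  apply: mx_measurable_mul; first exact: mx_measurable_tr.
  exact: (mx_measurable_comp (mY 0)).
have ZN : {ae P, forall w, (Z w)^T *m iL w *m e (Yi 0 w) = (Z w)^T *m N (Yi 0 w)}.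
  apply: filterS (Yin 0) => w wi.
  by rewrite /N cramerE ?uLam// mulmxA.
have LZN := mx_integrable_ae mZN ZN LZ.
have [L E] := Emx_pullout (mY 0) (cond_expectation_cexp hZ) mN LZN.
split; first exact: L.
by rewrite -E; apply: Emx_ae => //; exact: mx_integrable_measurable LZ.
Qed.

Lemma optimal_weight : optimal S Delta n f1 th1 th2 Wstar.
Proof.
have mLam := cexp_mx_meas HLam; have me1 := cexp_mx_meas HEdV1.
have me2 := cexp_mx_meas HEdV2; have mef := cexp_mx_meas HEVf.
have [L1 E1] := E_q HEdV1 me2 Lq1.
have [L2 E2] := E_q HEdV1 me1 Lq2.
have [L3 E3] := E_q HEdV1 mef Lq3.
have Vf w : (vE w *m (ft w)^T)^T = ft w *m (vE w)^T by rewrite trmx_mul trmxK.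
have q4E : (fun w => (vE w *m (ft w)^T)^T *m iL w *m EdV2 (Yi 0 w)) = q4.
  by apply/funext => w; rewrite Vf.
have q5E : (fun w => (vE w *m (ft w)^T)^T *m iL w *m EVf (Yi 0 w)) = q5.
  by apply/funext => w; rewrite Vf.
have Lq4' := Lq4; have Lq5' := Lq5; rewrite -q4E in Lq4'; rewrite -q5E in Lq5'.
have [L4 E4] := E_q HEVf me2 Lq4'; have [L5 E5] := E_q HEVf mef Lq5'.
rewrite q4E in E4; rewrite q5E in E5.
have [L3t E3t] := Emx_swap (mY 0) (Yin 0) mLam uLam sLam L3 me1 mef.
have mWs := measurable_state_weight HWs.
have WsE' y : inner S y -> state_weight Wstar y =
    invmx (Lambda y) *m (EdV2 y + EdV1 y *m C2 + EVf y *m C3).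
  by move=> yi; rewrite state_weightE ?WsE//; exact: InSt.
have [row1 row2] := normal_equations system.
have D21s : (D21 S Delta n th1 th2 Wstar)^T = n%:R *: (D^T *m C3).
  rewrite (E_dF21 HWs).2 linearZ/= -Emx_tr -row1 [Emx P q1]E1 [Emx P q2]E2 [Emx P q3]E3.
  rewrite -(Emx_Wstar (mY 0) (Yin 0) uLam mWs WsE' me1 L1 L2 L3).
  by congr (_ *: Emx P _); apply/funext => w; rewrite trmx_mul trmxK.
have S12s : S12 S Delta n f1 th1 th2 Wstar = D *m C2 + n%:R *: (S11' *m C3).
  rewrite -row2 E4 [Emx P q3]E3 E5 -E3t.
  rewrite -(Emx_Wstar (mY 0) (Yin 0) uLam mWs WsE' mef L4 L3t L5).
  rewrite -[LHS]trmxK (E_F1F2 HWs).2 -Emx_tr.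
  by congr (Emx P _); apply/funext => w; rewrite trmx_mul trmxK.
(* The mean E[Z Z*'] does not depend on W. *)
have cross W : calW S Delta n f1 th1 th2 W ->
    mx_integrable P (fun w => infl W w *m (infl Wstar w)^T) /\
    Emx P (fun w => infl W w *m (infl Wstar w)^T) =
      (invmx (D22 S Delta n th1 th2 Wstar))^T.
  move=> HW.
  have [LF2 EF2] := E_F2F2 HW HWs.
  have [LZ EZ] := Emx_influence (invmx (D22 S Delta n th1 th2 W))
    (invmx (D22 S Delta n th1 th2 Wstar)) (D21 S Delta n th1 th2 W *m invmx D)
    (D21 S Delta n th1 th2 Wstar *m invmx D)
    (cw_S11 HW) (cw_S12 HW) (cw_S12 HWs) LF2.
  split; first exact: LZ.
  rewrite [LHS]EZ.
  rewrite -[Emx P (fun w => F1obs _ _ _ _ _ w *m (F1obs _ _ _ _ _ w)^T)]/S11'.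
  rewrite (cross_covariance (D22 := D22 S Delta n th1 th2 W)
    (C2 := C2) (C3 := C3) (N := n%:R))//.
    by rewrite mulVmx ?mul1mx//; exact: cw_unit HW.
  rewrite EF2 (Emx_Lam_Wstar (mY 0) (Yin 0) mLam uLam mWs WsE'
    (measurable_state_weight HW) (E_dF22 HW).1 (E_dF21 HW).1 (E_F1F2 HW).1).
  rewrite (E_dF22 HW).2 (E_dF21 HW).2.
  rewrite -[Emx P (fun w => F1obs _ _ _ _ _ w *m _)]/(S12 S Delta n f1 th1 th2 W).
  by rewrite (E_F1F2 HW).2 !scalerDr -scalemxAl.
have avarE W : calW S Delta n f1 th1 th2 W ->
    mx_integrable P (fun w => infl W w *m (infl W w)^T) /\
    avar S Delta n f1 th1 th2 W = Emx P (fun w => infl W w *m (infl W w)^T).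
  move=> HW.
  have [LZ EZ] := Emx_influence (invmx (D22 S Delta n th1 th2 W))
    (invmx (D22 S Delta n th1 th2 W)) (D21 S Delta n th1 th2 W *m invmx D)
    (D21 S Delta n th1 th2 W *m invmx D)
    (cw_S11 HW) (cw_S12 HW) (cw_S12 HW) (cw_S22 HW).
  split; first exact: LZ.
  rewrite [RHS]EZ /avar /S21 -!mulmxA; congr (_ *m _).
  by rewrite -trmx_inv -trmx_mul !mulmxA sandwichE trmx_inv.
move=> W HW; have [LZZ ->] := avarE W HW; have [LSS ->] := avarE Wstar HWs.
have [LZS EZS] := cross W HW; have [_ ESS] := cross Wstar HWs.
exact: (psd_EmxB LZZ LZS LSS (etrans EZS (esym ESS))).
Qed.

End Assembly.

Theorem proposition3p2 (R : realType) (p1 p2 : nat) (d : measure_display)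
    (Omega : measurableType d) (S : model R p1 p2 Omega) (Delta : R)
    (M n : nat) (f1 : R -> R -> 'cV[R]_p1 -> 'cV[R]_p1)
    (Delta_gt0 : 0 < Delta) (M_gt0 : (0 < M)%N) (n_gt0 : (0 < n)%N)
    (HS : subordinate_diffusion S)
    (Hf1 : moment_function S Delta f1)
    (th1 : 'cV[R]_p1) (th2 : 'cV[R]_p2)
    (Hth1 : Theta1 S th1) (Hth2 : Theta2 S th2)
    (HdV1 : forall y1 y2, inner S y1 -> inner S y2 ->
       dtheta_exists (fun t => V S Delta M y1 y2 t th2) th1)
    (HdV2 : forall y1 y2, inner S y1 -> inner S y2 ->
       dtheta_exists (fun t => V S Delta M y1 y2 th1 t) th2)
    (Lambda : R -> 'M[R]_M) (EdV1 : R -> 'M[R]_(M, p1))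
    (EdV2 : R -> 'M[R]_(M, p2)) (ft1 : R * R -> 'cV[R]_p1)
    (EVf : R -> 'M[R]_(M, p1)) (Wstar : weight R p1 p2 M)
    (C1 : 'M[R]_p2) (C2 C3 : 'M[R]_(p1, p2)) :
  let P := prob S th1 th2 in
  let Y0 : Omega -> measurableTypeR R := Y S Delta 0 in
  let Y1 : Omega -> measurableTypeR R := Y S Delta 1 in
  let v w := V S Delta M (Y0 w) (Y1 w) th1 th2 in
  let dv1 w := dV1 S Delta M (Y0 w) (Y1 w) th1 th2 in
  let dv2 w := dV2 S Delta M (Y0 w) (Y1 w) th1 th2 in
  let f w := ft1 (Y0 w, Y1 w) in
  let iL w := invmx (Lambda (Y0 w)) in
  cond_expectation P Y0 (fun w => v w *m (v w)^T) Lambda ->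
  cond_expectation P Y0 dv1 EdV1 ->
  cond_expectation P Y0 dv2 EdV2 ->
  cond_expectation P (fun w => (Y0 w, Y1 w)) (f1_sum S Delta n f1 th1) ft1 ->
  cond_expectation P Y0 (fun w => v w *m (f w)^T) EVf ->
  (forall y, inner S y -> Lambda y \in unitmx) ->
  D11 S Delta n f1 th1 th2 \in unitmx ->
  calW S Delta n f1 th1 th2 Wstar ->
  (forall y, inner S y -> Wstar y th1 th2 =
     invmx (Lambda y) *m (EdV2 y *m C1 + EdV1 y *m C2 + EVf y *m C3)) ->
  let q1 w := (dv1 w)^T *m iL w *m EdV2 (Y0 w) in
  let q2 w := (dv1 w)^T *m iL w *m EdV1 (Y0 w) in
  let q3 w := (dv1 w)^T *m iL w *m EVf (Y0 w) in
  let q4 w := f w *m (v w)^T *m iL w *m EdV2 (Y0 w) in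
  let q5 w := f w *m (v w)^T *m iL w *m EVf (Y0 w) in
  mx_integrable P q1 -> mx_integrable P q2 -> mx_integrable P q3 ->
  mx_integrable P q4 -> mx_integrable P q5 ->
  let Q1 := Emx P q1 in
  let Q2 := Emx P q2 in
  let Q3 := Emx P q3 in
  let Q4 := Emx P q4 in
  let Q5 := Emx P q5 in
  let D := D11 S Delta n f1 th1 th2 in
  C1 = 1%:M ->
  block_mx (- Q2) (D^T - Q3)
           (D - Q3^T) (n%:R *: S11 S Delta n f1 th1 th2 - Q5)
    *m col_mx C2 C3 = col_mx Q1 Q4 ->
  optimal S Delta n f1 th1 th2 Wstar.
Proof.
move=> P Y0 Y1 v dv1 dv2 f iL HLam HEdV1 HEdV2 Hft HEVf uLam uD HWs WsE.
move=> q1 q2 q3 q4 q5 Lq1 Lq2 Lq3 Lq4 Lq5 Q1 Q2 Q3 Q4 Q5 D C1E system.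
rewrite {}C1E in WsE.
case: n n_gt0 Hft uD HWs @D system => // n' _ Hft uD HWs D system.
have WsE' y : inner S y -> Wstar y th1 th2 =
    invmx (Lambda y) *m (EdV2 y + EdV1 y *m C2 + EVf y *m C3).
  by move=> yi; rewrite WsE// mulmx1.
exact: (optimal_weight Delta_gt0 HS Hf1 Hth1 Hth2 HdV1 HdV2 HLam HEdV1 HEdV2
  Hft HEVf uLam uD HWs WsE' Lq1 Lq2 Lq3 Lq4 Lq5 system).
Qed.
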